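(* Let $\mathcal{C}$, $G$, $H$ be as described in the context, and suppose that both $G$ and $H$ act transitively on $\mathcal{C}(x,y)$. If $\operatorname{char}(k)=p\neq 2,3$, then $k\mathcal{C}$ is of finite representation type if and only if both $O^{p'}G$ and $O^{p'}H$ act trivially on $\mathcal{C}(x,y)$.
   Context: $k$ is an algebraically closed field of characteristic $p\geqslant 0$. A finite EI category is a small category with finitely many morphisms in which every endomorphism is an isomorphism. Its category algebra $k\mathcal{C}$ is the $k$-algebra with basis the set of all morphisms, the product of two morphisms being their composite (composed from right to left) if it exists and $0$ otherwise. $k\mathcal{C}$ is of finite representation type if it has only finitely many isomorphism classes of finitely generated indecomposable left modules. $\mathcal{C}$ is a connected skeletal finite EI category with exactly two objects $x,y$, with $\mathcal{C}(x,y)\neq\emptyset$ and $\mathcal{C}(y,x)=\emptyset$; here $\mathcal{C}(x,y)$ is the set of morphisms from $x$ to $y$. $G=\mathcal{C}(x,x)$ and $H=\mathcal{C}(y,y)$ act on $\mathcal{C}(x,y)$ by composition on the right and on the left respectively. Standing assumption: both $G$ and $H$ have cyclic Sylow $p$-subgroups. For a finite group $X$, $O^{p'}X$ is the subgroup generated by all Sylow $p$-subgroups of $X$; when $p=0$, the trivial group is regarded as the Sylow $0$-subgroup. A subgroup acts trivially on $\mathcal{C}(x,y)$ if it fixes every element. *)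

(* Defs.v *)
From HB Require Import structures.
From mathcomp Require Import all_boot all_order all_algebra all_fingroup all_solvable.

Set Implicit Arguments.
Unset Strict Implicit.
Unset Printing Implicit Defensive.

Import GRing.Theory.
Local Open Scope ring_scope.

(* A category with finitely many morphisms has finitely many objects (each has
   an identity).  [cat_comp g f] is "g after f". *)
Record finEICat := FinEICat {
  cat_obj :> finType;
  cat_hom : cat_obj -> cat_obj -> finType;
  cat_id : forall a, cat_hom a a;
  cat_comp : forall a b c, cat_hom b c -> cat_hom a b -> cat_hom a c;
  cat_comp1m : forall a b (f : cat_hom a b), cat_comp (cat_id b) f = f;
  cat_compm1 : forall a b (f : cat_hom a b), cat_comp f (cat_id a) = f;
  cat_compA : forall a b c d (h : cat_hom c d) (g : cat_hom b c) (f : cat_hom a b),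
    cat_comp h (cat_comp g f) = cat_comp (cat_comp h g) f;
  cat_EI : forall a (f : cat_hom a a),
    exists g : cat_hom a a, cat_comp g f = cat_id a /\ cat_comp f g = cat_id a
}.

Arguments cat_hom {C} a b : rename.
Arguments cat_id {C} a : rename.
Arguments cat_comp {C a b c} g f : rename.

Definition cat_isomorphic (C : finEICat) (a b : C) : Prop :=
  exists (f : cat_hom a b) (g : cat_hom b a),
    cat_comp g f = cat_id a /\ cat_comp f g = cat_id b.

Definition cat_skeletal (C : finEICat) : Prop :=
  forall a b : C, cat_isomorphic a b -> a = b.

(* [0 < #|T|] says that the hom-set T is nonempty. *)
Definition cat_adj (C : finEICat) : rel C :=
  [rel a b | (0 < #|@cat_hom C a b|)%N || (0 < #|@cat_hom C b a|)%N].

Definition cat_connected (C : finEICat) : Prop :=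
  (0 < #|C|)%N /\ forall a b : C, connect (@cat_adj C) a b.

Definition cat_aut (C : finEICat) (a : C) : Type := @cat_hom C a a.

Section AutGroup.

Variables (C : finEICat) (a : C).

HB.instance Definition _ := Finite.on (cat_aut a).

Definition cat_inv (f : cat_aut a) : cat_aut a :=
  odflt f [pick g : cat_aut a | cat_comp g f == cat_id a].

Fact cat_aut_mulA :
  associative (fun g f : cat_aut a => cat_comp g f : cat_aut a).
Proof. by move=> h g f; rewrite cat_compA. Qed.

Fact cat_aut_mul1 :
  left_id (cat_id a : cat_aut a) (fun g f : cat_aut a => cat_comp g f : cat_aut a).
Proof. by move=> f; rewrite cat_comp1m. Qed.

Fact cat_aut_mulV :
  left_inverse (cat_id a : cat_aut a) cat_inv
    (fun g f : cat_aut a => cat_comp g f : cat_aut a).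
Proof.
move=> f; rewrite /cat_inv; case: pickP => [g /eqP //|no_inv].
by have [g [gf _]] := cat_EI f; have:= no_inv g; rewrite gf eqxx.
Qed.

HB.instance Definition _ :=
  Finite_isGroup.Build (cat_aut a) cat_aut_mulA cat_aut_mul1 cat_aut_mulV.

End AutGroup.

Definition cat_mor (C : finEICat) : finType :=
  {ab : C * C & @cat_hom C ab.1 ab.2}.

Definition Mor (C : finEICat) (a b : C) (f : cat_hom a b) : cat_mor C :=
  Tagged (fun ab : C * C => @cat_hom C ab.1 ab.2) (i := (a, b)) f.

(* Elements are coefficient vectors indexed by the morphisms.  The ring product
   is the convolution product below, not the pointwise one of {ffun _ -> k}. *)
Definition cat_alg (k : fieldType) (C : finEICat) : Type := {ffun cat_mor C -> k}.

Section CategoryAlgebra.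

Variables (k : fieldType) (C : finEICat).

Local Notation A := (cat_alg k C).

HB.instance Definition _ := GRing.Zmodule.copy A {ffun cat_mor C -> k}.
HB.instance Definition _ := GRing.Lmodule.copy A {ffun cat_mor C -> k^o}.

Definition cat_alg_basis (h : cat_mor C) : A := [ffun h' => (h' == h)%:R].

Definition cat_alg_one : A := \sum_(a : C) cat_alg_basis (Mor (cat_id a)).

Definition cat_alg_mul (u v : A) : A :=
  [ffun h => \sum_(b : C) \sum_(g : cat_hom b (tag h).2)
               \sum_(f : cat_hom (tag h).1 b | cat_comp g f == tagged h)
                 u (Mor g) * v (Mor f)].

Fact cat_algP (u v : A) :
  (forall a b (f : @cat_hom C a b), u (Mor f) = v (Mor f)) -> u = v.
Proof. by move=> uv; apply/ffunP => -[[a b] f]; apply: uv. Qed.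

Fact cat_alg_mulE (u v : A) a c (h : cat_hom a c) :
  cat_alg_mul u v (Mor h) =
  \sum_(b : C) \sum_(g : cat_hom b c) \sum_(f : cat_hom a b | cat_comp g f == h)
     u (Mor g) * v (Mor f).
Proof. by rewrite ffunE. Qed.

Fact cat_alg_addE (u v : A) h : (u + v) h = u h + v h.
Proof. by rewrite ffunE. Qed.

Fact cat_alg_sumE (I : Type) (r : seq I) (P : pred I) (F : I -> A) h :
  (\sum_(i <- r | P i) F i) h = \sum_(i <- r | P i) F i h.
Proof. exact: sum_ffunE. Qed.

Fact cat_alg_basisE a b (f g : @cat_hom C a b) :
  cat_alg_basis (Mor g) (Mor f) = (f == g)%:R.
Proof. by rewrite ffunE /Mor eq_Tagged. Qed.

Fact cat_alg_basis_neq h h' : h' != h -> cat_alg_basis h h' = 0.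
Proof. by rewrite ffunE => /negPf->. Qed.

Fact sum_fibers (S T : finType) (phi : T -> S) (P : pred S) (F : S -> T -> k) :
  \sum_(s | P s) \sum_(t | phi t == s) F s t = \sum_(t | P (phi t)) F (phi t) t.
Proof.
rewrite (exchange_big_dep (fun t => P (phi t))) /=; last by move=> s t ? /eqP->.
apply: eq_bigr => t Pt; rewrite (bigD1 (phi t)) ?Pt ?eqxx //= big1 ?addr0 //.
by move=> s /andP[/andP[_ /eqP->]]; rewrite eqxx.
Qed.

Fact cat_alg_mulA : associative cat_alg_mul.
Proof.
move=> u v w; apply: cat_algP => a d h; rewrite !cat_alg_mulE.
transitivity (\sum_(b : C) \sum_(g : cat_hom b d) \sum_(c : C)
    \sum_(g' : cat_hom c b)
    \sum_(f : cat_hom a c | cat_comp g (cat_comp g' f) == h)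
      u (Mor g) * (v (Mor g') * w (Mor f))).
  apply: eq_bigr => b _; apply: eq_bigr => g _.
  under eq_bigr do rewrite cat_alg_mulE mulr_sumr.
  rewrite exchange_big /=; apply: eq_bigr => c _.
  under eq_bigr do rewrite mulr_sumr.
  rewrite exchange_big /=; apply: eq_bigr => g' _.
  under eq_bigr do rewrite mulr_sumr.
  exact: (sum_fibers _ _ (fun _ f => u (Mor g) * (v (Mor g') * w (Mor f)))).
under eq_bigr do rewrite exchange_big /=.
rewrite exchange_big /=; apply: eq_bigr => c _.
transitivity (\sum_(m : cat_hom c d) \sum_(b : C) \sum_(g : cat_hom b d)
    \sum_(g' : cat_hom c b | cat_comp g g' == m)
    \sum_(f : cat_hom a c | cat_comp m f == h)
      u (Mor g) * (v (Mor g') * w (Mor f))).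
  rewrite [RHS]exchange_big /=; apply: eq_bigr => b _.
  rewrite [RHS]exchange_big /=; apply: eq_bigr => g _.
  rewrite (sum_fibers _ xpredT (fun m g' =>
    \sum_(f : cat_hom a c | cat_comp m f == h)
      u (Mor g) * (v (Mor g') * w (Mor f)))).
  by apply: eq_bigr => g' _; apply: eq_bigl => f; rewrite cat_compA.
apply: eq_bigr => m _.
under [RHS]eq_bigr do rewrite cat_alg_mulE mulr_suml.
rewrite [RHS]exchange_big /=; apply: eq_bigr => b _.
under [RHS]eq_bigr do rewrite mulr_suml.
rewrite [RHS]exchange_big /=; apply: eq_bigr => g _.
under [RHS]eq_bigr do rewrite mulr_suml.
rewrite [RHS]exchange_big /=; apply: eq_bigr => g' _.
by apply: eq_bigr => f _; rewrite mulrA.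
Qed.

Fact cat_alg_one_neq a b (f : @cat_hom C a b) : a != b -> cat_alg_one (Mor f) = 0.
Proof.
move=> ab; rewrite cat_alg_sumE big1 // => c _; apply: cat_alg_basis_neq.
by apply: contraNneq ab => /(congr1 tag) /= [-> ->].
Qed.

Fact cat_alg_one_eq a (f : @cat_hom C a a) : cat_alg_one (Mor f) = (f == cat_id a)%:R.
Proof.
rewrite cat_alg_sumE (bigD1 a) //= big1 ?addr0 ?cat_alg_basisE // => c ca.
by apply: cat_alg_basis_neq; apply: contraNneq ca => /(congr1 tag) /= [->].
Qed.

Fact cat_alg_mul1l : left_id cat_alg_one cat_alg_mul.
Proof.
move=> u; apply: cat_algP => a c h; rewrite cat_alg_mulE (bigD1 c) //=.
rewrite [X in _ + X]big1 ?addr0 => [|b bc]; last first.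
  by rewrite big1 // => g _; rewrite big1 // => f _; rewrite cat_alg_one_neq ?mul0r.
rewrite (bigD1 (cat_id c)) //= [X in _ + X]big1 ?addr0 => [|g gc]; last first.
  by rewrite big1 // => f _; rewrite cat_alg_one_eq (negPf gc) mul0r.
under eq_bigl do rewrite cat_comp1m.
by rewrite big_pred1_eq cat_alg_one_eq eqxx mul1r.
Qed.

Fact cat_alg_mul1r : right_id cat_alg_one cat_alg_mul.
Proof.
move=> u; apply: cat_algP => a c h; rewrite cat_alg_mulE (bigD1 a) //=.
rewrite [X in _ + X]big1 ?addr0 => [|b ba]; last first.
  rewrite big1 // => g _; rewrite big1 // => f _.
  by rewrite cat_alg_one_neq ?mulr0 // eq_sym.
rewrite (bigD1 h) //= [X in _ + X]big1 ?addr0 => [|g gh]; last first.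
  rewrite big1 // => f /eqP gf; rewrite cat_alg_one_eq.
  by case: eqP gf => [->|_ _]; rewrite ?mulr0 // cat_compm1 => /eqP; rewrite (negPf gh).
rewrite (bigD1 (cat_id a)) ?cat_compm1 //= cat_alg_one_eq eqxx mulr1.
by rewrite big1 ?addr0 // => f /andP[_ /negPf fa]; rewrite cat_alg_one_eq fa mulr0.
Qed.

Fact cat_alg_mulDl : left_distributive cat_alg_mul +%R.
Proof.
move=> u v w; apply: cat_algP => a c h; rewrite cat_alg_addE !cat_alg_mulE.
rewrite -big_split; apply: eq_bigr => b _; rewrite -big_split; apply: eq_bigr => g _.
by rewrite -big_split; apply: eq_bigr => f _; rewrite cat_alg_addE mulrDl.
Qed.

Fact cat_alg_mulDr : right_distributive cat_alg_mul +%R.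
Proof.
move=> u v w; apply: cat_algP => a c h; rewrite cat_alg_addE !cat_alg_mulE.
rewrite -big_split; apply: eq_bigr => b _; rewrite -big_split; apply: eq_bigr => g _.
by rewrite -big_split; apply: eq_bigr => f _; rewrite cat_alg_addE mulrDr.
Qed.

HB.instance Definition _ := GRing.Zmodule_isPzRing.Build A
  cat_alg_mulA cat_alg_mul1l cat_alg_mul1r cat_alg_mulDl cat_alg_mulDr.

Lemma cat_alg_basisM a b c (g : @cat_hom C b c) (f : @cat_hom C a b) :
  cat_alg_basis (Mor g) * cat_alg_basis (Mor f) = cat_alg_basis (Mor (cat_comp g f)).
Proof.
apply: cat_algP => a' c' h.
have -> : (cat_alg_basis (Mor g) * cat_alg_basis (Mor f)) (Mor h)
  = cat_alg_mul (cat_alg_basis (Mor g)) (cat_alg_basis (Mor f)) (Mor h) by [].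
rewrite cat_alg_mulE.
have [[ea ec]|ne] := eqVneq (a', c') (a, c); last first.
  rewrite [RHS]cat_alg_basis_neq; last first.
    by apply: contraNneq ne => /(congr1 tag) /= ->.
  rewrite big1 // => b' _; rewrite big1 // => g' _; rewrite big1 // => f' _.
  rewrite !ffunE; case: (Mor g' =P Mor g) => [/(congr1 tag) /= [_ ec]|]; rewrite ?mul0r //.
  case: (Mor f' =P Mor f) => [/(congr1 tag) /= [ea _]|]; rewrite ?mulr0 //.
  by rewrite ea ec eqxx in ne.
move: h; rewrite {}ea {}ec => h; rewrite cat_alg_basisE.
rewrite (bigD1 b) //= [X in _ + X]big1 ?addr0 => [|b' bb]; last first.
  rewrite big1 // => g' _; rewrite big1 // => f' _.
  rewrite [X in X * _]cat_alg_basis_neq ?mul0r //.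
  by apply: contraNneq bb => /(congr1 tag) /= [->].
rewrite (bigD1 g) //= [X in _ + X]big1 ?addr0 => [|g' gg]; last first.
  by rewrite big1 // => f' _; rewrite cat_alg_basisE (negPf gg) mul0r.
under eq_bigr do rewrite !cat_alg_basisE eqxx mul1r.
have [eh|nh] := eqVneq h (cat_comp g f).
  rewrite (bigD1 f) ?eh //= eqxx big1 ?addr0 // => f' /andP[_ /negPf->] //.
rewrite big1 // => f' /eqP gf; case: eqP => // ef.
by rewrite -gf ef eqxx in nh.
Qed.

Lemma cat_alg_basisM0 a b b' c (g : @cat_hom C b' c) (f : @cat_hom C a b) :
  b' != b -> cat_alg_basis (Mor g) * cat_alg_basis (Mor f) = 0.
Proof.
move=> bb; apply: cat_algP => a' c' h.
have -> : (cat_alg_basis (Mor g) * cat_alg_basis (Mor f)) (Mor h)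
  = cat_alg_mul (cat_alg_basis (Mor g)) (cat_alg_basis (Mor f)) (Mor h) by [].
rewrite cat_alg_mulE [RHS]ffunE.
rewrite big1 // => d _; rewrite big1 // => g' _; rewrite big1 // => f' _.
rewrite !ffunE; case: (Mor g' =P Mor g) => [/(congr1 tag) /= [db _]|]; rewrite ?mul0r //.
case: (Mor f' =P Mor f) => [/(congr1 tag) /= [_ db']|]; rewrite ?mulr0 //.
by rewrite -db -db' eqxx in bb.
Qed.

Lemma cat_alg_scaleAl (c : k) (u v : A) : c *: (u * v) = (c *: u) * v.
Proof.
apply/ffunP => h; rewrite !ffunE [LHS]mulr_sumr; apply: eq_bigr => b _.
rewrite mulr_sumr; apply: eq_bigr => g _; rewrite mulr_sumr.
by apply: eq_bigr => f _; rewrite ffunE mulrA.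
Qed.

Lemma cat_alg_scaleAr (c : k) (u v : A) : c *: (u * v) = u * (c *: v).
Proof.
apply/ffunP => h; rewrite !ffunE [LHS]mulr_sumr; apply: eq_bigr => b _.
rewrite mulr_sumr; apply: eq_bigr => g _; rewrite mulr_sumr.
by apply: eq_bigr => f _; rewrite ffunE mulrCA.
Qed.

End CategoryAlgebra.

Section RepresentationType.

Variable A : pzRingType.

Definition lmod_iso (M N : lmodType A) : Prop :=
  exists phi : {linear M -> N}, bijective phi.

Definition lmod_trivial (M : lmodType A) : Prop := forall m : M, m = 0.

Definition lmod_fg (M : lmodType A) : Prop :=
  exists (n : nat) (e : 'I_n -> M),
    forall m : M, exists c : 'I_n -> A, m = \sum_(i < n) c i *: e i.

Definition lmod_indecomposable (M : lmodType A) : Prop :=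
  ~ lmod_trivial M /\
  forall U V : lmodType A,
    lmod_iso M (U * V)%type -> lmod_trivial U \/ lmod_trivial V.

Definition finite_rep_type : Prop :=
  exists (n : nat) (M : 'I_n -> lmodType A),
    forall N : lmodType A, lmod_fg N -> lmod_indecomposable N ->
      exists i : 'I_n, lmod_iso N (M i).

End RepresentationType.

(* Characteristic exactly p, where p = 0 is allowed. *)
Definition has_char (k : fieldType) (p : nat) : Prop :=
  if p is 0 then [pchar k] =i pred0 else p \in [pchar k].

(* For p = 0, ['Syl_0(G)] consists of the trivial group only (lemma [Syl0]). *)
Definition cyclic_Sylows (gT : finGroupType) (p : nat) (G : {group gT}) : Prop :=
  forall P : {group gT}, P \in ('Syl_p(G))%g -> cyclic P.

(* O^{p'}(G) *)
Definition pC_residual (gT : finGroupType) (p : nat) (G : {group gT}) : {set gT} :=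
  <<\bigcup_(P in 'Syl_p(G)) P>>%g.

Lemma Syl0 (gT : finGroupType) (G : {group gT}) : ('Syl_0(G))%g = [set 1%G].
Proof.
apply/setP => P; rewrite !inE; apply/idP/eqP => [/and3P[_ P0 _]|->].
  apply/val_inj => /=; apply/eqP; rewrite trivg_card1; apply/eqP.
  apply: (pnat_1 P0); apply/pnatP => // q pr_q _.
  by rewrite !inE; apply: contraTneq pr_q => ->.
rewrite /pHall sub1G pgroup1 /=; apply/pnatP => // q pr_q _.
by rewrite !inE; apply: contraTneq pr_q => ->.
Qed.

(* Main.v *)
Require Import Defs.
From HB Require Import structures.
From mathcomp Require Import all_boot all_order all_algebra all_fingroup all_solvable.
From mathcomp Require Import ring.
From Stdlib Require Import Classical ClassicalEpsilon.
Set Implicit Arguments.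
Unset Strict Implicit.
Unset Printing Implicit Defensive.

(** Fix a morphism f0 from x to y, and write A for the category algebra.  As G
and H act transitively on C(x,y) and the two actions commute, every stabiliser
is normal and C(x,y) is a torsor under a common quotient Q of G and H.  Each of
the two conditions says that p does not divide the order of Q.

Suppose that it does not.  Sylow p-subgroups P = <sg> of G and R = <tu> of H
then fix C(x,y) pointwise.  Let A1 be the subalgebra generated by P, R, the
two identities and one morphism z.  Averaging over the cosets of P in G and of
R in H gives a separability idempotent of A over A1 ([sep_sum_mul],
[sep_sum_central]): the two averages agree on C(x,y) because both kinds of
cosets are equidistributed over it ([coset_sum_average]).  Hence, as in
Higman's argument, every A-module N is a direct summand of the module coinduced
from its restriction to A1.  An A1-module consists of spaces V and W, nilpotent
operators X = sg - 1 on V and Y = tu - 1 on W, and a map Z from V to W with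
ZX = 0 and YZ = 0.  It is a direct sum of modules of finitely many shapes, a
Jordan block of X whose top is glued to the socle of a Jordan block of Y
([ex_glued_summand], [idem_glued_sum]).  So the identity of N is a sum of maps
through finitely many coinduced modules, and the Krull-Schmidt argument of
[finite_rep_type_criterion] bounds the number of indecomposable modules.

Suppose now that p divides the order of Q.  Some element of order p acts on
C(x,y) both as g0 on the right and as h0 on the left ([ex_order_p_step]).  Over
the group algebra of the subgroup that it generates, which is k[X]/(X^p) with
p > 3, maps of modules are of infinite type already among the modules killed
by X^4: four lines of cross-ratio l in a plane give a 12-dimensional module for
every l.  Its generators satisfy relations with matrix P + l Q, for a pencil
P + m Q of matrices over A ([four_lines_rigid], [four_lines_solution]).  On a
finite dimensional module the rank of P + m Q is maximal for all but finitely
many m; say that the module drops at the other values.  A direct sum drops at m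
only if one of its summands does ([drops_prod]), so for finite representation
type there would be finitely many values m at which some finite dimensional
module drops ([infinite_rep_type_of_drops]).  But the four-lines module with parameter l
drops at l, and it splits off the restriction of the module that it coinduces,
which therefore drops at l as well ([line_coind_drops]).  As k is infinite,
this is a contradiction. *)

(** * Submodules and coordinates *)

Lemma ex_least (P : nat -> Prop) n0 : P n0 -> exists n, P n /\ forall m, P m -> (n <= m)%N.
Proof.
elim/ltn_ind: n0 => n IH Pn.
have [[m [Pm mn]]|no] := classic (exists m, P m /\ (m < n)%N); first exact: IH mn Pm.
exists n; split=> // m Pm; rewrite leqNgt; apply/negP => mn; apply: no; by exists m.
Qed.

Lemma ex_greatest (P : nat -> Prop) D n0 : P n0 -> (forall n, P n -> (n <= D)%N) ->
  exists n, P n /\ forall m, P m -> (m <= n)%N.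
Proof.
move=> P0 bnd; have [|d [[le_dD Pd] min_d]] := @ex_least (fun d => (d <= D)%N /\ P (D - d)%N) (D - n0).
  by rewrite leq_subr subKn ?bnd.
exists (D - d)%N; split=> // m Pm; rewrite leq_subRL // addnC -leq_subRL ?bnd //.
by apply: min_d; rewrite leq_subr subKn ?bnd.
Qed.

Section Submodule.
Import GRing.Theory.
Local Open Scope ring_scope.
Variables (R : pzRingType) (N : lmodType R) (S : {pred N}).
Hypothesis clS : submod_closed S.

Definition submod of submod_closed S := {m : N | m \in S}.
Local Notation SN := (submod clS).
HB.instance Definition _ := SubChoice.on SN.
HB.instance Definition _ := GRing.SubChoice_isSubLmodule.Build R N S SN (GRing.submod_closed_semi clS).

Definition submod_val (u : SN) : N := \val u.
Fact submod_val_linear : linear submod_val.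
Proof. by move=> a u v; rewrite /submod_val linearP. Qed.
HB.instance Definition _ := GRing.isLinear.Build R SN N *:%R submod_val submod_val_linear.
Lemma submod_val_inj : injective submod_val. Proof. exact: val_inj. Qed.
Lemma submod_valP u : submod_val u \in S. Proof. exact: valP. Qed.
Lemma submod_ex m : m \in S -> exists u, submod_val u = m.
Proof. by move=> mS; exists (Sub m mS : SN); rewrite /submod_val SubK. Qed.
End Submodule.

Section Coord.
Import GRing.Theory.
Local Open Scope ring_scope.
Variables (k : fieldType).

Definition lincomb (X : lmodType k) r (u : 'I_r -> X) (c : 'rV[k]_r) : X :=
  \sum_i c 0 i *: u i.

Fact lincomb_linear (X : lmodType k) r (u : 'I_r -> X) : linear (lincomb u).
Proof.
move=> a c d; rewrite /lincomb scaler_sumr -big_split; apply: eq_bigr => i _.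
by rewrite !mxE scalerDl scalerA.
Qed.
HB.instance Definition _ (X : lmodType k) r (u : 'I_r -> X) :=
  GRing.isLinear.Build k 'rV[k]_r X *:%R (@lincomb X r u) (lincomb_linear u).

Definition fin_dim (X : lmodType k) : Prop :=
  exists n (t : {linear X -> 'rV[k]_n}), bijective t.

Lemma linear_inverse (R : pzRingType) (X Y : lmodType R) (f : {linear X -> Y}) :
  bijective f -> exists2 g : {linear Y -> X}, cancel f g & cancel g f.
Proof.
case=> g fK gK.
have lg : linear g by move=> a u v; apply: (can_inj fK); rewrite linearP !gK.
pose lgM := GRing.isLinear.Build _ _ _ _ g lg.
pose lgL : {linear Y -> X} := HB.pack g lgM.
by exists lgL.
Qed.

Lemma ex_linear (R : pzRingType) (X Y : lmodType R) (f : X -> Y) : linear f ->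
  exists g : {linear X -> Y}, g =1 f.
Proof.
move=> lf; pose fM := GRing.isLinear.Build _ _ _ _ f lf.
by pose fL : {linear X -> Y} := HB.pack f fM; exists fL.
Qed.

(** A bound on the sizes of independent families gives a maximal one, and a
maximal one spans.  Both ways of recognising a finite dimensional space used
below, by an injection into coordinates and by a finite spanning family, provide
such a bound. *)
Lemma fin_dim_bounded (X : lmodType k) D :
  (forall r (u : 'I_r -> X), injective (lincomb u) -> (r <= D)%N) -> fin_dim X.
Proof.
move=> bnd.
pose P r := exists u : 'I_r -> X, injective (lincomb u).
have P0 : P 0%N by exists (fun _ => 0) => a b _; apply/rowP=> [[]].
have [r [[u u_inj] max_r]] := @ex_greatest P D 0 P0 (fun r '(ex_intro u iu) => bnd r u iu).
have surj x : exists c, lincomb u c = x.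
  apply: NNPP => nox.
  suff /max_r : P r.+1 by rewrite ltnn.
  exists (fun i => oapp u x (unlift ord0 i)).
  have split_sum (c : 'rV[k]_r.+1) :
      lincomb (fun i => oapp u x (unlift ord0 i)) c = c 0 ord0 *: x
        + lincomb u (\row_i c 0 (lift ord0 i)).
    rewrite /lincomb big_ord_recl unlift_none /=; congr (_ + _).
    by apply: eq_bigr => i _; rewrite liftK mxE.
  set u' := fun i => _ in split_sum *.
  suff ker0 c : lincomb u' c = 0 -> c = 0.
    by move=> c d cd; apply/eqP; rewrite -subr_eq0; apply/eqP/ker0; rewrite linearB /= cd subrr.
  rewrite split_sum => /eqP.
  have [c0|c0] := eqVneq (c 0 ord0) 0.
    rewrite c0 scale0r add0r -(linear0 (lincomb u)) => /eqP /u_inj/rowP c1.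
    apply/rowP=> i; case: (unliftP ord0 i) => [j ->|-> //]; last by rewrite c0 mxE.
    by have := c1 j; rewrite !mxE.
  rewrite addr_eq0 => /eqP cx; case: nox.
  exists (- (c 0 ord0)^-1 *: \row_i c 0 (lift ord0 i)).
  by rewrite linearZ /= scaleNr -scalerN -cx scalerA mulVf ?scale1r.
have [t ut tu] : exists2 g : {linear X -> 'rV[k]_r}, cancel (lincomb u) g & cancel g (lincomb u).
  pose g x := epsilon (inhabits 0) (fun c => lincomb u c = x).
  have gK x : lincomb u (g x) = x by apply: (epsilon_spec (inhabits 0) (fun c => _ c = x)); apply: surj.
  by apply: (@linear_inverse _ _ _ (lincomb u)); exists g => // c; apply: u_inj.
by exists r, t; exists (lincomb u).
Qed.

Lemma rV_inj_row_free m n (M : 'M[k]_(m, n)) : injective (mulmx^~ M : 'rV_m -> _) -> row_free M.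
Proof.
move=> inj; rewrite -kermx_eq0; apply/eqP/row_matrixP => i.
by apply: inj; rewrite -row_mul mulmx_ker !row0 mul0mx.
Qed.

Lemma lincomb_coord (X : lmodType k) n (t : {linear X -> 'rV[k]_n}) r
  (u : 'I_r -> X) (c : 'rV[k]_r) : t (lincomb u c) = c *m \matrix_i t (u i).
Proof.
rewrite mulmx_sum_row linear_sum; apply: eq_bigr => i _.
by rewrite linearZ /= rowK.
Qed.

Lemma fin_dim_inj (X : lmodType k) D (t : {linear X -> 'rV[k]_D}) :
  injective t -> fin_dim X.
Proof.
move=> t_inj; apply: (@fin_dim_bounded _ D) => r u u_inj.
have : row_free (\matrix_i t (u i)).
  by apply: rV_inj_row_free => c d; rewrite /= -!lincomb_coord => /t_inj/u_inj.
by move=> /eqP <-; apply: rank_leq_col.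
Qed.

Lemma fin_dim_surj (X : lmodType k) D (s : {linear 'rV[k]_D -> X}) :
  (forall x, exists c, s c = x) -> fin_dim X.
Proof.
move=> s_surj; apply: (@fin_dim_bounded _ D) => r u u_inj.
pose g x := epsilon (inhabits 0) (fun c => s c = x).
have gK x : s (g x) = x by apply: (epsilon_spec (inhabits 0) (fun c => _ c = x)); apply: s_surj.
have : row_free (\matrix_i g (u i)).
  apply: rV_inj_row_free => c d; rewrite /= => /(congr1 s) cd; apply: u_inj.
  have sg e : s (e *m \matrix_i g (u i)) = lincomb u e.
    rewrite mulmx_sum_row linear_sum; apply: eq_bigr => i _.
    by rewrite linearZ /= rowK gK.
  by rewrite -!sg.
by move=> /eqP <-; apply: rank_leq_col.
Qed.

End Coord.

(** * Fitting projections of matrices *)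

Section MatrixForm.
Import GRing.Theory.
Local Open Scope ring_scope.
Variables (k : fieldType).

Lemma matrix_of_linear (X Y : lmodType k) m n (t : {linear X -> 'rV[k]_m})
    (t' : {linear Y -> 'rV[k]_n}) (f : {linear X -> Y}) :
  bijective t -> exists M : 'M[k]_(m, n), forall x, t' (f x) = t x *m M.
Proof.
move=> /linear_inverse[s tK sK]; exists (lin1_mx (t' \o f \o s)) => x.
by rewrite (mul_rV_lin1 (t' \o f \o s)) /= tK.
Qed.

Lemma eq_mx_rV m n (M M' : 'M[k]_(m, n)) : (forall u : 'rV_m, u *m M = u *m M') -> M = M'.
Proof. by move=> MM; apply/row_matrixP => i; rewrite !rowE MM. Qed.

(** The projection onto the part where F is invertible.  Write the
characteristic polynomial as q X^m with q(0) nonzero; a Bezout relation between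
q and X^(m+1) makes this projection a polynomial in F, so it commutes with every
matrix that commutes with F. *)
Lemma mx_fitting n (F : 'M[k]_n) : exists E : 'M[k]_n,
  [/\ E *m E = E, E = 1%:M -> F \in unitmx, E = 0 -> 1%:M - F \in unitmx
    & forall M : 'M_n, F *m M = M *m F -> E *m M = M *m E].
Proof.
case: n F => [|n] F.
  exists 0; split=> [||_|M _]; rewrite ?mul0mx ?mulmx0 //;
  by rewrite ?[X in X \in _]flatmx0 -?[X in X \in _](flatmx0 1%:M) unitmx1.
have [m [q q0 cE]] := multiplicity_XsubC (char_poly F) 0.
have {}q0 : ~~ root q 0 by move: q0; rewrite monic_neq0 ?char_poly_monic.
rewrite subr0 in cE.
(* The exponent m + 1 instead of m makes the projection a multiple of F. *)
have cop : coprimep q 'X^(m.+1).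
  by apply: coprimep_expr; rewrite -['X]subr0 coprimep_XsubC.
have [[u v] /= uv] := elimT (Bezout_eq1_coprimepP _ _) cop.
exists (horner_mx F (v * 'X^(m.+1))).
have E1 : 1%:M - horner_mx F (v * 'X^(m.+1)) = horner_mx F (u * q).
  by rewrite -[1%:M](rmorph1 (horner_mx F)) -rmorphB -uv /= addrK.
have qXm : horner_mx F (q * 'X^m) = 0 by rewrite -cE; apply: Cayley_Hamilton.
split.
- apply/eqP; rewrite eq_sym -subr_eq0 -{1}[horner_mx F _]mulmx1 -mulmxBr E1.
  have -> : horner_mx F (v * 'X^(m.+1)) *m horner_mx F (u * q) = horner_mx F (v * 'X^(m.+1) * (u * q)).
    by rewrite [RHS]rmorphM.
  have -> : v * 'X^(m.+1) * (u * q) = (v * 'X * u) * (q * 'X^m).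
    by rewrite exprS -!mulrA; congr (_ * (_ * _)); rewrite mulrC -!mulrA.
  by rewrite rmorphM /= qXm mulr0.
- rewrite exprSr mulrA rmorphM /= horner_mx_X => /mulmx1_unit[_ //].
- move=> E0; rewrite E0 subr0 in E1.
  have Fm : F ^+ m = 0.
    rewrite -[F ^+ m]mul1r -[1]/(1%:M) E1 -{2}[F]horner_mx_X -rmorphXn -rmorphM -mulrA rmorphM /= qXm.
    by rewrite mulr0.
  have : (1%:M - F) *m (\sum_(i < m) F ^+ i) = 1%:M.
    by rewrite -opprB mulNmx -[(F - _) *m _]subrX1 Fm sub0r opprK.
  by case/mulmx1_unit.
- move=> M FM; rewrite -[_ *m M]/(_ * M) -[M *m _]/(M * _).
  exact: (@comm_horner_mx _ _ F M _ FM).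
Qed.
End MatrixForm.

(** * Modules over an algebra as vector spaces *)

Section Modules.
Import GRing.Theory.
Local Open Scope ring_scope.

(** An alias of N, so that its structure over k does not compete with the one
over A.  A is only assumed to be a ring with a central map from k, because a
category algebra may be the zero ring. *)
Definition scal_restr (k : fieldType) (A : pzRingType) (iota : {rmorphism k -> A})
  (N : lmodType A) : Type := N.

Section ScalarRestriction.
Variables (k : fieldType) (A : pzRingType) (iota : {rmorphism k -> A}) (N : lmodType A).
HB.instance Definition _ := GRing.Zmodule.on (scal_restr iota N).

Definition scal_restr_scale (c : k) (m : scal_restr iota N) : scal_restr iota N := iota c *: (m : N).
Fact scal_restr_scaleA a b v : scal_restr_scale a (scal_restr_scale b v) = scal_restr_scale (a * b) v.
Proof. by rewrite /scal_restr_scale scalerA rmorphM. Qed.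
Fact scal_restr_scale1 : left_id 1 scal_restr_scale.
Proof. by move=> v; rewrite /scal_restr_scale rmorph1 scale1r. Qed.
Fact scal_restr_scaleDr : right_distributive scal_restr_scale +%R.
Proof. by move=> a u v; rewrite /scal_restr_scale scalerDr. Qed.
Fact scal_restr_scaleDl v : {morph scal_restr_scale^~ v : a b / a + b}.
Proof. by move=> a b; rewrite /scal_restr_scale rmorphD scalerDl. Qed.
HB.instance Definition _ := GRing.Zmodule_isLmodule.Build k (scal_restr iota N)
  scal_restr_scaleA scal_restr_scale1 scal_restr_scaleDr scal_restr_scaleDl.

Lemma scal_restr_scaleE c (m : N) : c *: (m : scal_restr iota N) = (iota c *: m : N).
Proof. by []. Qed.
End ScalarRestriction.

Variables (k : fieldType) (A : pzRingType) (iota : {rmorphism k -> A}).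
Hypothesis iotaC : forall c a, iota c * a = a * iota c.
Hypothesis A_span : exists d (b : 'I_d -> A),
  forall a, exists c : 'I_d -> k, a = \sum_i iota (c i) * b i.

Lemma scal_restr_linear (N N' : lmodType A) (f : {linear N -> N'}) :
  exists g : {linear scal_restr iota N -> scal_restr iota N'}, forall m, g m = f m.
Proof.
have /ex_linear[g gE] : linear (f : scal_restr iota N -> scal_restr iota N').
  by move=> a u v; rewrite linearP.
by exists g.
Qed.

Lemma scal_restr_act (N : lmodType A) (a : A) :
  exists g : {linear scal_restr iota N -> scal_restr iota N}, forall m, g m = a *: (m : N).
Proof.
have /ex_linear[g gE] : linear (fun m : scal_restr iota N => (a *: (m : N) : N) : scal_restr iota N).
  by move=> c u v; rewrite scalerDr scal_restr_scaleE scalerA -iotaC -scalerA.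
by exists g.
Qed.

Lemma fg_fin_dim (N : lmodType A) : lmod_fg N -> fin_dim (scal_restr iota N).
Proof.
case: A_span => d [b bA] [n [e eN]].
pose s (c : 'rV[k]_(n * d)) : scal_restr iota N :=
  \sum_i \sum_j vec_mx c i j *: ((b j *: e i : N) : scal_restr iota N).
have /ex_linear[g gE] : linear s.
  move=> a u v; rewrite /s scaler_sumr -big_split; apply: eq_bigr => i _ /=.
  rewrite scaler_sumr -big_split; apply: eq_bigr => j _ /=.
  by rewrite linearP !mxE scalerDl scalerA.
apply: (@fin_dim_surj _ _ _ g) => m.
have [a ->] := eN m.
pose c i := epsilon (inhabits (fun _ => 0)) (fun c : 'I_d -> k => a i = \sum_j iota (c j) * b j).
have cE i : a i = \sum_j iota (c i j) * b j.
  by apply: (epsilon_spec (inhabits (fun=> 0)) (fun c => a i = \sum_j iota (c j) * b j)).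
exists (mxvec (\matrix_(i, j) c i j)); rewrite gE /s; apply: eq_bigr => i _.
rewrite cE scaler_suml; apply: eq_bigr => j _.
by rewrite mxvecK mxE scal_restr_scaleE scalerA.
Qed.

Lemma fin_dim_fg (N : lmodType A) : fin_dim (scal_restr iota N) -> lmod_fg N.
Proof.
move=> [n [t /linear_inverse[s tK sK]]].
exists n, (fun i => s (delta_mx 0 i)) => m; exists (fun i => iota (t m 0 i)).
rewrite -{1}[m]tK {1}[t m]row_sum_delta linear_sum; apply: eq_bigr => i _.
by rewrite linearZ.
Qed.

Lemma iso_sym (N N' : lmodType A) : lmod_iso N N' -> lmod_iso N' N.
Proof. by case=> f /linear_inverse[g fK gK]; exists g; exists f. Qed.

Lemma iso_fin_dim (N N' : lmodType A) :
  lmod_iso N N' -> fin_dim (scal_restr iota N) -> fin_dim (scal_restr iota N').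
Proof.
move=> /iso_sym[f bf] [n [t bt]]; have [g gE] := scal_restr_linear f.
exists n, (t \o g); apply: bij_comp => //.
by apply: (eq_bij bf) => m; rewrite gE.
Qed.

Lemma idem_split (N : lmodType A) (e : {linear N -> N}) :
  (forall m, e (e m) = e m) ->
  exists U V : lmodType A, [/\ lmod_iso N (U * V)%type,
    lmod_trivial U -> forall m, e m = 0 & lmod_trivial V -> forall m, e m = m].
Proof.
move=> ee.
have cU : submod_closed [pred m | e m == m].
  by split=> [|a u v]; rewrite !inE ?linear0 // linearP => /eqP-> /eqP->.
have cV : submod_closed [pred m | e m == 0].
  by split=> [|a u v]; rewrite !inE ?linear0 // linearP => /eqP-> /eqP->; rewrite scaler0 addr0.
have eU m : e m \in [pred m | e m == m] by rewrite inE ee.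
have eV m : m - e m \in [pred m | e m == 0] by rewrite inE linearB ee subrr.
exists (submod cU), (submod cV); split; last 2 first.
- move=> U0 m; have [u <-] := submod_ex cU (eU m).
  by rewrite (U0 u) linear0.
- move=> V0 m; apply/eqP; rewrite eq_sym -subr_eq0.
  by have [v <-] := submod_ex cV (eV m); rewrite (V0 v) linear0.
pose g (w : (submod cU * submod cV)%type) := submod_val w.1 + submod_val w.2.
have /ex_linear[gL gE] : linear g.
  by move=> a u v; rewrite /g !linearP /= scalerDr addrACA.
apply: iso_sym; exists gL.
pose f m : (submod cU * submod cV)%type := (Sub (e m) (eU m), Sub (m - e m) (eV m)).
suff bg : bijective g by apply: (eq_bij bg) => m; rewrite gE.
exists f => [[u v]|m].
  have /eqP eu : e (submod_val u) == submod_val u := submod_valP u.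
  have /eqP ev : e (submod_val v) == 0 := submod_valP v.
  have euv : e (submod_val u + submod_val v) = submod_val u by rewrite linearD eu ev addr0.
  by congr (_, _); apply: submod_val_inj; rewrite /submod_val SubK -/submod_val /g /= euv // addrC addKr.
by rewrite /g /f /= /submod_val !SubK addrC subrK.
Qed.

Lemma indec_idem (N : lmodType A) (e : {linear N -> N}) :
  lmod_indecomposable N -> (forall m, e (e m) = e m) ->
  (forall m, e m = 0) \/ (forall m, e m = m).
Proof.
move=> [_ indN] /idem_split[U [V [/indN isoN U0 V0]]].
by case: isoN => [/U0|/V0]; [left|right].
Qed.

(** The endomorphism ring of N is local: the Fitting projection of f is an
A-linear idempotent, hence 0 or 1, and f is nilpotent or invertible. *)
Lemma indec_fitting (N : lmodType A) (f : {linear N -> N}) :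
  lmod_indecomposable N -> fin_dim (scal_restr iota N) ->
  bijective f \/ bijective (fun m => m - f m).
Proof.
move=> indN [n [t bt]]; have [s tK sK] := linear_inverse bt.
have bij_unit (h : N -> N) (H : 'M_n) : (forall m, t (h m) = t m *m H) ->
    H \in unitmx -> bijective h.
  move=> hH uH; exists (fun m => s (t m *m invmx H)) => m.
    by rewrite hH mulmxK.
  by apply: (can_inj tK); rewrite hH sK mulmxKV.
have mx_endo (h : {linear N -> N}) : exists H : 'M_n, forall m, t (h m) = t m *m H.
  have [hk hkE] := scal_restr_linear h; have [H HE] := matrix_of_linear t hk bt.
  by exists H => m; rewrite -HE hkE.
have [F FE] := mx_endo f.
have [E [EE E1 E0 Ecomm]] := mx_fitting F.
pose e (m : N) : N := s (t m *m E).
have /ex_linear[eL eE] : linear e.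
  move=> a u v.
  have [al alE] := scal_restr_act N a; have [M ME] := matrix_of_linear t al bt.
  have FM : F *m M = M *m F.
    apply: eq_mx_rV => w; rewrite -[w]sK !mulmxA -FE -!ME -FE !alE.
    by rewrite linearZ.
  have tD (x y : N) : t (x + y) = t x + t y := linearD t x y.
  have ta (x : N) : t (a *: x) = t x *m M by rewrite -ME alE.
  apply: (can_inj tK); rewrite sK !tD !ta /e !sK mulmxDl.
  by rewrite -!mulmxA Ecomm.
have [|e0|e1] := @indec_idem N eL indN.
- by move=> m; rewrite !eE /e sK -mulmxA EE.
- right; apply: (bij_unit _ (1%:M - F)); last first.
    apply: E0; apply: eq_mx_rV => u; rewrite mulmx0 -[u]sK -[_ *m E]sK -/(e _).
    by rewrite -eE e0 linear0.
  by move=> m; rewrite linearB FE mulmxBr mulmx1.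
- left; apply: (bij_unit _ F FE); apply: E1; apply: eq_mx_rV => u.
  by rewrite mulmx1 -[u in LHS]sK -[_ *m E]sK -/(e _) -eE e1 sK.
Qed.

End Modules.

(** * Krull-Schmidt arguments *)

Section KrullSchmidt.
Import GRing.Theory.
Local Open Scope ring_scope.
Variables (k : fieldType) (A : pzRingType) (iota : {rmorphism k -> A}).
Hypothesis iotaC : forall c a, iota c * a = a * iota c.
Hypothesis A_span : exists d (b : 'I_d -> A),
  forall a, exists c : 'I_d -> k, a = \sum_i iota (c i) * b i.

Local Notation fd N := (fin_dim (scal_restr iota N)).

(** The sums of endomorphisms of N that factor through modules in S.  They
contain the identity exactly when N is a direct summand of a finite direct sum
of modules in S, but no such direct sum has to be built. *)
Inductive sum_through (S : lmodType A -> Prop) (N : lmodType A) : (N -> N) -> Prop :=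
| SumThrough0 f : (forall m, f m = 0) -> sum_through S f
| SumThroughS (U : lmodType A) (a : {linear N -> U}) (b : {linear U -> N}) f f' :
    S U -> sum_through S f' -> (forall m, f m = b (a m) + f' m) -> sum_through S f.

Lemma sum_through_linear S N f : @sum_through S N f -> linear f.
Proof.
elim=> {f} [f f0|U a b f f' _ _ lf' fE] c u v; first by rewrite !f0 scaler0 addr0.
by rewrite !fE lf' !linearP /= scalerDr addrACA.
Qed.

Lemma sum_through_add S N f g h : @sum_through S N f -> @sum_through S N g ->
  (forall m, h m = f m + g m) -> @sum_through S N h.
Proof.
move=> Sf Sg; elim: Sf h => {f} [f f0|U a b f f' SU _ IH fE] h hE.
  elim: Sg h hE => {g} [g g0|U a b g g' SU Sg' _ gE] h hE.
    by apply: SumThrough0 => m; rewrite hE f0 g0 addr0.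
  by apply: (SumThroughS (a := a) (b := b) SU Sg') => m; rewrite hE f0 add0r.
apply: (SumThroughS (a := a) (b := b) SU (IH (fun m => f' m + g m) _)) => // m.
by rewrite hE fE addrA.
Qed.

Lemma sum_through_comp S (N N' : lmodType A) (c : {linear N -> N'}) (d : {linear N' -> N}) f :
  @sum_through S N f -> sum_through S (fun m => c (f (d m))).
Proof.
elim=> {f} [f f0|U a b f f' SU _ IH fE]; first by apply: SumThrough0 => m; rewrite f0 linear0.
by apply: (SumThroughS (a := a \o d) (b := c \o b) SU IH) => m; rewrite fE linearD.
Qed.

Lemma sum_through_trans (S S' : lmodType A -> Prop) N f : @sum_through S N f ->
  (forall U, S U -> @sum_through S' U id) -> @sum_through S' N f.
Proof.
move=> Sf SS'; elim: Sf => {f} [f f0|U a b f f' SU _ IH fE]; first exact: SumThrough0.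
by apply: (sum_through_add (sum_through_comp b a (SS' U SU)) IH).
Qed.

Lemma sum_through_sub (S S' : lmodType A -> Prop) N f : (forall U, S U -> S' U) ->
  @sum_through S N f -> @sum_through S' N f.
Proof.
move=> SS'; elim=> {f} [f f0|U a b f f' SU _ IH fE]; first exact: SumThrough0.
exact: (SumThroughS (SS' U SU) IH fE).
Qed.

(** In a local ring a sum that is a unit has a summand that is a unit: divide by
the sum, and either the first term is invertible or the rest is. *)
Lemma sum_through_bij S N f : lmod_indecomposable N -> fd N ->
  @sum_through S N f -> bijective f ->
  exists (U : lmodType A) (a : {linear N -> U}) (b : {linear U -> N}), S U /\ bijective (b \o a).
Proof.
move=> indN fdN; elim=> {f} [f f0|U a b f f' SU Sf' IH fE] bf.
  case: indN => [[]] m; have [g fK gK] := bf.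
  by rewrite -[m]fK f0 -(f0 0) fK.
have /ex_linear[fL fLE] : linear f.
  by move=> c u v; rewrite !fE (sum_through_linear Sf') !linearP /= scalerDr addrACA.
have bfL : bijective fL by apply: (eq_bij bf) => m; rewrite fLE.
have [g fK gK] := linear_inverse bfL.
have bg : bijective g by exists fL.
have [bu|bv] := indec_fitting iotaC (g \o b \o a) indN fdN.
  exists U, a, b; split=> //; apply: (eq_bij (bij_comp bfL bu)) => m /=.
  by rewrite gK.
apply: IH; apply: (eq_bij (bij_comp bfL bv)) => m /=.
by rewrite linearB /= gK fLE fE addrC addKr.
Qed.

(** If the endomorphism b a of N is invertible, then a (b a)^-1 b is an
idempotent of U; being nonzero, it is the identity. *)
Lemma indec_factor_iso (N U : lmodType A) (a : {linear N -> U}) (b : {linear U -> N}) :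
  ~ lmod_trivial N -> lmod_indecomposable U -> bijective (b \o a) -> lmod_iso N U.
Proof.
move=> N0 indU bba; have [g gK Kg] := linear_inverse (f := b \o a) bba.
have [|e0|e1] := @indec_idem _ U (a \o g \o b) indU.
- by move=> u; rewrite /= -[b (a _)]/((b \o a) _) gK.
- case: N0 => m; have am : a m = 0 by rewrite -[m]gK; exact: e0.
  by rewrite -[m]gK /= am !linear0.
- exists a; exists (g \o b) => [m|u]; first exact: gK.
  exact: e1.
Qed.

Lemma leq_dim_inj a b (f : {linear 'rV[k]_a -> 'rV[k]_b}) : injective f -> (a <= b)%N.
Proof.
move=> f_inj; have : row_free (lin1_mx f).
  by apply: rV_inj_row_free => u v; rewrite /= !mul_rV_lin1; apply: f_inj.
by move=> /eqP <-; apply: rank_leq_col.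
Qed.

Lemma pair_linear_l (U V : lmodType A) :
  exists f : {linear U -> (U * V)%type}, forall u, f u = (u, 0).
Proof.
apply: (@ex_linear A U (U * V)%type (fun u => (u, 0))) => c u v.
by congr (_, _); rewrite /= scaler0 addr0.
Qed.

Lemma pair_linear_r (U V : lmodType A) :
  exists f : {linear V -> (U * V)%type}, forall v, f v = (0, v).
Proof.
apply: (@ex_linear A V (U * V)%type (fun v => (0, v))) => c u v.
by congr (_, _); rewrite /= scaler0 addr0.
Qed.

Lemma prod_fin_dim (N U V : lmodType A) n (t : {linear scal_restr iota N -> 'rV[k]_n}) :
  bijective t -> lmod_iso N (U * V)%type ->
  exists a b (tU : {linear scal_restr iota U -> 'rV[k]_a}) (tV : {linear scal_restr iota V -> 'rV[k]_b}),
    [/\ bijective tU, bijective tV & (a + b <= n)%N].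
Proof.
move=> bt /iso_sym[f bf]; have [fk fkE] := scal_restr_linear iota f.
have fk_inj : injective fk by move=> x y; rewrite !fkE; apply: bij_inj.
have [iU0 iU0E] := pair_linear_l U V; have [iU iUE] := scal_restr_linear iota iU0.
have [iV0 iV0E] := pair_linear_r U V; have [iV iVE] := scal_restr_linear iota iV0.
have [a [tU bU]] : fd U.
  apply: (@fin_dim_inj _ _ _ (t \o fk \o iU)) => u v /= /(bij_inj bt)/fk_inj.
  by rewrite !iUE !iU0E => -[].
have [b [tV bV]] : fd V.
  apply: (@fin_dim_inj _ _ _ (t \o fk \o iV)) => u v /= /(bij_inj bt)/fk_inj.
  by rewrite !iVE !iV0E => -[].
exists a, b, tU, tV; split=> //.
have [sU tUK sUK] := linear_inverse bU; have [sV tVK sVK] := linear_inverse bV.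
pose h1 : {linear 'rV[k]_(a + b) -> 'rV[k]_n} := t \o fk \o iU \o sU \o lsubmx.
pose h2 : {linear 'rV[k]_(a + b) -> 'rV[k]_n} := t \o fk \o iV \o sV \o rsubmx.
apply: (@leq_dim_inj _ _ (h1 \+ h2)) => u v; rewrite /= -!linearD /= => /(bij_inj bt)/fk_inj.
rewrite !iUE !iVE !iU0E !iV0E => -[]; rewrite !addr0 !add0r.
move=> /(can_inj sUK) uv1 /(can_inj sVK) uv2.
by rewrite -[u]hsubmxK -[v]hsubmxK uv1 uv2.
Qed.

Lemma nontrivial_dim_gt0 (N : lmodType A) n (t : {linear scal_restr iota N -> 'rV[k]_n}) :
  bijective t -> ~ lmod_trivial N -> (0 < n)%N.
Proof.
move=> bt; case: n t bt => // t bt; case=> m; apply: (bij_inj bt).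
by apply/rowP => [[]].
Qed.

Lemma indec_or_split (N : lmodType A) : lmod_trivial N \/ lmod_indecomposable N \/
  exists U V : lmodType A,
    [/\ lmod_iso N (U * V)%type, ~ lmod_trivial U & ~ lmod_trivial V].
Proof.
have [N0|N0] := classic (lmod_trivial N); [by left|right].
have [|no] := classic (exists U V : lmodType A,
  [/\ lmod_iso N (U * V)%type, ~ lmod_trivial U & ~ lmod_trivial V]); [by right|left].
split=> // U V isoN; apply: NNPP => UV; apply: no; exists U, V; split=> // H; apply: UV.
  by left. by right.
Qed.

(** By induction on the dimension, splitting N as long as it is decomposable. *)
Lemma indec_decomposition (N : lmodType A) : fd N -> exists L : seq (lmodType A),
  (forall U, List.In U L -> lmod_indecomposable U /\ fd U) /\
  @sum_through (fun U => List.In U L) N id.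
Proof.
case=> n; have [m le_nm] := ubnP n; elim: m => // m IH in N n le_nm *.
move=> [t bt]; have [N0|[indN|[U [V [isoN U0 V0]]]]] := indec_or_split N.
- by exists [::]; split=> //; apply: SumThrough0.
- exists [:: N]; split=> [U [<-|//]|]; first by split=> //; exists n, t.
  apply: (@SumThroughS _ _ N idfun idfun _ (fun _ => 0)) => [|| m'].
  + by left.
  + exact: SumThrough0.
  + by rewrite addr0.
have [a [b [tU [tV [bU bV ab]]]]] := prod_fin_dim bt isoN.
have a0 := nontrivial_dim_gt0 bU U0; have b0 := nontrivial_dim_gt0 bV V0.
have [||LU [LU1 LU2]] := IH U a; first by rewrite -ltnS (leq_trans _ le_nm) // ltnS (leq_trans _ ab) // -addn1 leq_add2l.
  by exists tU.
have [||LV [LV1 LV2]] := IH V b; first by rewrite -ltnS (leq_trans _ le_nm) // ltnS (leq_trans _ ab) // -add1n leq_add2r.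
  by exists tV.
exists (LU ++ LV); split=> [W|].
  by move=> /(@List.in_app_or _ _ _ _)[/LU1|/LV1].
have [f /linear_inverse[g fK gK]] := isoN.
have [iU iUE] := pair_linear_l U V; have [iV iVE] := pair_linear_r U V.
have := sum_through_comp (g \o iU) (fst \o f) (sum_through_sub (S' := fun W => List.In W (LU ++ LV)) _ LU2).
move=> /(_ (fun W WL => @List.in_or_app _ _ _ _ (or_introl WL))) SU.
have := sum_through_comp (g \o iV) (snd \o f) (sum_through_sub (S' := fun W => List.In W (LU ++ LV)) _ LV2).
move=> /(_ (fun W WL => @List.in_or_app _ _ _ _ (or_intror WL))) SV.
apply: (sum_through_add SU SV) => x /=.
rewrite iUE iVE -linearD -{1}[x]fK; congr (g _).
case: (f x) => u v; congr (_, _); by rewrite /= ?addr0 ?add0r.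
Qed.

(** Decompose each module of Ts.  The identity of an indecomposable N is then a
sum of maps through finitely many indecomposable modules, and N is isomorphic to
one of them because one of the terms is invertible. *)
Theorem finite_rep_type_criterion (Ts : seq (lmodType A)) :
  (forall T, List.In T Ts -> fd T) ->
  (forall N : lmodType A, fd N -> lmod_indecomposable N ->
    @sum_through (fun T => List.In T Ts) N id) ->
  finite_rep_type A.
Proof.
move=> fdT through.
have [L [LP LT]] : exists L : seq (lmodType A),
  (forall U, List.In U L -> lmod_indecomposable U /\ fd U) /\
  forall T, List.In T Ts -> @sum_through (fun U => List.In U L) T id.
  elim: Ts fdT {through} => [|T Ts IH] fdT; first by exists [::]; split.
  have [|L [LP LT]] := IH; first by move=> U UTs; apply: fdT; right.
  have [|L' [LP' LT']] := @indec_decomposition T; first by apply: fdT; left.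
  exists (L' ++ L); split=> [U /(@List.in_app_or _ _ _ _)[/LP'|/LP] //|U [<-|/LT]].
    by apply: sum_through_sub LT' => W WL; apply: List.in_or_app; left.
  by apply: sum_through_sub => W WL; apply: List.in_or_app; right.
exists (size L), (fun i => nth (A^o : lmodType A) L i).
move=> N /(fg_fin_dim A_span) fdN indN.
have /(sum_through_bij indN fdN)[] := sum_through_trans (through N fdN indN) LT.
  by exists id.
move=> U [a [b [UL bab]]].
have isoNU : lmod_iso N U by apply: indec_factor_iso bab; [case: indN | have [] := LP U UL].
have [i iE] : exists i : 'I_(size L), nth (A^o : lmodType A) L i = U.
  elim: L UL {LP LT} => [//|V L IH] [->|UL]; first by exists ord0.
  by have [i <-] := IH UL; exists (lift ord0 i).
by exists i; rewrite iE.
Qed.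

End KrullSchmidt.

(** * Rank drops of matrix pencils *)

Section Pencils.
Import GRing.Theory.
Local Open Scope ring_scope.
Variable k : closedFieldType.

(** A root of (X - z_1) ... (X - z_n) X + 1 differs from all the z_i. *)
Lemma closed_infinite (s : seq k) : exists l, l \notin s.
Proof.
pose q := \prod_(z <- s) ('X - z%:P) * 'X + 1%:P : {poly k}.
have : size q != 1%N.
  have q0 : \prod_(z <- s) ('X - z%:P) * 'X != 0 :> {poly k}.
    by rewrite mulf_neq0 ?polyX_eq0 // monic_neq0 // monic_prod_XsubC.
  have sz : size (\prod_(z <- s) ('X - z%:P) * 'X : {poly k}) = (size s).+2.
    by rewrite size_mulX ?size_prod_XsubC // monic_neq0 // monic_prod_XsubC.
  by rewrite size_polyDl sz // size_poly1.
move/closed_rootP => [l]; rewrite rootE !hornerE => ql; exists l.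
apply: contraL ql => ls; have /eqP-> : (\prod_(z <- s) ('X - z%:P)).[l] == 0.
  by rewrite -rootE root_prod_XsubC.
by rewrite mul0r add0r oner_eq0.
Qed.

Lemma poly_roots_finite (q : {poly k}) : q != 0 -> exists s : seq k, forall l, q.[l] = 0 -> l \in s.
Proof.
move=> q0; have [s qE] := closed_field_poly_normal q; exists s => l /eqP.
rewrite qE hornerZ mulf_eq0 lead_coef_eq0 (negPf q0) /= -rootE.
by rewrite root_prod_XsubC.
Qed.

Lemma mxrank_factor m n (M : 'M[k]_(m, n)) : exists L R, L *m M *m R = 1%:M :> 'M_(\rank M).
Proof.
exists (pinvmx (col_base M)), (pinvmx (row_base M)).
have -> : pinvmx (col_base M) *m M = row_base M.
  transitivity (pinvmx (col_base M) *m (col_base M *m row_base M)).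
    by rewrite mulmx_base.
  by rewrite mulmxA mulVpmx ?col_base_full // mul1mx.
by rewrite mulmxVp ?row_base_free.
Qed.

(** At a value m0 of maximal rank r, choose L and R with L (P + m0 Q) R the
identity of size r.  The determinant of L (P + l Q) R is a nonzero polynomial in
l, and where it does not vanish the rank is at least r. *)
Lemma pencil_drop_finite n (P Q : 'M[k]_n) : exists s : seq k, forall l m,
  (\rank (P + l *: Q)%R < \rank (P + m *: Q)%R)%N -> l \in s.
Proof.
have [||r [[m0 <-] m0P]] := @ex_greatest (fun r => exists m, \rank (P + m *: Q)%R = r) n
  (\rank (P + 0 *: Q)%R); [by exists 0 | by move=> _ [m <-]; apply: rank_leq_row |].
have [L [R LR]] := mxrank_factor (P + m0 *: Q).
pose q : {poly k} := \det (map_mx polyC (L *m P *m R) + 'X *: map_mx polyC (L *m Q *m R)).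
have qE l : q.[l] = \det (L *m (P + l *: Q) *m R).
  rewrite mulmxDr mulmxDl -scalemxAr -scalemxAl /q; move: (_ *m R) (_ *m R) => X Y.
  rewrite -[LHS]/(horner_eval l _) -det_map_mx; congr (\det _).
  by apply/matrixP => i j; rewrite !mxE /= /horner_eval hornerD hornerM hornerX !hornerC.
have /poly_roots_finite[s sP] : q != 0.
  apply/eqP => q0; have := qE m0; rewrite q0 horner0 LR det1 => /eqP.
  by rewrite eq_sym oner_eq0.
exists s => l m lm; apply: sP; apply/eqP; apply: contraLR (leq_trans lm (m0P _ (ex_intro _ m erefl))).
rewrite qE -leqNgt -unitfE -[_ \is a _]/(_ \in unitmx) => U.

have LMR : L *m (P + l *: Q) *m (R *m invmx (L *m (P + l *: Q) *m R)) = 1%:M.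
  by rewrite mulmxA mulmxV.
exact: mulmx1_min_rank LMR.
Qed.

Lemma mxrank_idem_add n (E M : 'M[k]_n) : E *m E = E -> E *m M = M *m E ->
  \rank M = (\rank (E *m M) + \rank ((1%:M - E) *m M))%N.
Proof.
move=> EE EM.
rewrite -mxrank_disjoint_sum.
  apply: eqmx_rank; apply/andP; split.
    have {1}-> : M = E *m M + (1%:M - E) *m M by rewrite mulmxBl mul1mx addrC subrK.
    exact: addmx_sub_adds.
  by rewrite addsmx_sub !submxMl.
apply/eqP; rewrite -submx0; apply/rV_subP => u; rewrite sub_capmx => /andP[/submxP[a ua] /submxP[b ub]].
have uE : u *m E = u by rewrite ua EM -!mulmxA EE.
have E0 : (1%:M - E) *m M *m E = 0.
  by rewrite -mulmxA -EM mulmxA mulmxBl mul1mx EE subrr mul0mx.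
by rewrite -uE ub -mulmxA E0 mulmx0 sub0mx.
Qed.

Lemma rank_ker_lt m n (M M' : 'M[k]_(m, n)) :
  (forall u : 'rV_m, u *m M' = 0 -> u *m M = 0) ->
  (exists2 u : 'rV_m, u *m M = 0 & u *m M' != 0) -> (\rank M < \rank M')%N.
Proof.
move=> MM [u uM uM'].
have : (kermx M' < kermx M)%MS.
  apply/andP; split.
    by apply/rV_subP => v /sub_kermxP vM; apply/sub_kermxP/MM.
  apply: contra uM' => kk; apply/eqP/sub_kermxP; apply: submx_trans kk.
  exact/sub_kermxP.
move/rank_ltmx; rewrite !mxrank_ker ltn_sub2lE ?rank_leq_row //.
Qed.

(** E cuts the pencil into two.  The rank of the part (1 - E)(P + m Q) is for
almost all m at least its value at l; for the part E (P + m Q) the kernels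
decide. *)
Lemma pencil_drop_of_idem n (P Q E : 'M[k]_n) l :
  E *m E = E -> E *m P = P *m E -> E *m Q = Q *m E ->
  (forall m (u : 'rV_n), m != l -> u *m (P + m *: Q) *m E = 0 -> u *m (P + l *: Q) *m E = 0) ->
  (exists2 u : 'rV_n, u *m (P + l *: Q) *m E = 0
     & forall m, m != l -> u *m (P + m *: Q) *m E != 0) ->
  exists m, (\rank (P + l *: Q)%R < \rank (P + m *: Q)%R)%N.
Proof.
move=> EE EP EQ ker_sub [u0 u0l u0m].
have EPQ m : E *m (P + m *: Q) = (P + m *: Q) *m E.
  by rewrite mulmxDr mulmxDl -scalemxAr -scalemxAl EP EQ.
have [s sP] := pencil_drop_finite ((1%:M - E) *m P) ((1%:M - E) *m Q).
have [m] := closed_infinite (l :: s); rewrite inE negb_or => /andP[ml ms].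
exists m; rewrite (mxrank_idem_add EE (EPQ l)) (mxrank_idem_add EE (EPQ m)).
rewrite -addSn leq_add //.
  rewrite !EPQ; apply: rank_ker_lt; last by exists u0; rewrite mulmxA ?u0m.
  by move=> u; rewrite !mulmxA; apply: ker_sub.
rewrite leqNgt; apply: contra ms => lt_ml; apply: (sP m l).
by rewrite !scalemxAr -!mulmxDr.
Qed.

End Pencils.

(** * Pencils acting on modules *)

Section PencilDrops.
Import GRing.Theory.
Local Open Scope ring_scope.
Variables (k : closedFieldType) (A : pzRingType) (iota : {rmorphism k -> A}).
Hypothesis iotaC : forall c a, iota c * a = a * iota c.
Local Notation fd N := (fin_dim (scal_restr iota N)).
Variables (r : nat) (P Q : 'M[A]_r).

Local Notation "N ^rk" := (scal_restr iota {ffun 'I_r -> N}) (at level 2, format "N ^rk").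

Definition mx_act (N : lmodType A) (M : 'M[A]_r) (x : {ffun 'I_r -> N}) : {ffun 'I_r -> N} :=
  [ffun i => \sum_j M i j *: x j].

(** A pencil P + l Q of square matrices over A presents a module whose
homomorphisms to N are the kernel of this map on N^r. *)
Definition pencil_act (N : lmodType A) (l : k) : {ffun 'I_r -> N} -> {ffun 'I_r -> N} :=
  mx_act (\matrix_(i, j) (P i j + iota l * Q i j)).

Definition ffun_map (N N' : lmodType A) (f : N -> N') (x : {ffun 'I_r -> N}) : {ffun 'I_r -> N'} :=
  [ffun i => f (x i)].

Lemma mx_act_map (N N' : lmodType A) (f : {linear N -> N'}) M x :
  mx_act M (ffun_map f x) = ffun_map f (mx_act M x).
Proof.
apply/ffunP => i; rewrite !ffunE linear_sum; apply: eq_bigr => j _.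
by rewrite ffunE linearZ.
Qed.

Lemma pencil_act_map (N N' : lmodType A) (f : {linear N -> N'}) l x :
  pencil_act l (ffun_map f x) = ffun_map f (pencil_act l x).
Proof. exact: mx_act_map. Qed.

Lemma ffun_map_linear (N N' : lmodType A) (f : {linear N -> N'}) :
  exists g : {linear N^rk -> N'^rk}, forall x, g x = ffun_map f x.
Proof.
apply: (@ex_linear k N^rk N'^rk (@ffun_map N N' f)) => c u v.
by apply/ffunP => i; rewrite !ffunE linearP.
Qed.

Lemma mx_act_linear (N : lmodType A) M :
  exists g : {linear N^rk -> N^rk}, forall x, g x = mx_act M x.
Proof.
apply: (@ex_linear k N^rk N^rk (@mx_act N M)) => c u v.
apply/ffunP => i; rewrite !ffunE scaler_sumr -big_split; apply: eq_bigr => j _ /=.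
by rewrite !ffunE scalerDr !scalerA iotaC.
Qed.

Lemma scal_restr_ffunE (N : lmodType A) (c : k) (x y : N^rk) i :
  ((x + c *: y : N^rk) : {ffun 'I_r -> N}) i = (x : {ffun 'I_r -> N}) i + iota c *: (y : {ffun 'I_r -> N}) i.
Proof. by rewrite !ffunE. Qed.

Lemma ffun_fin_dim (N : lmodType A) : fd N -> fin_dim N^rk.
Proof.
case=> n [t bt].
have /ex_linear[g gE] : linear (fun x : N^rk => mxvec (\matrix_(i < r) t (x i))).
  move=> c u v; rewrite -linearP; congr mxvec; apply/matrixP => i j.
  rewrite !mxE (_ : t _ = t (c *: (u i : scal_restr iota N) + v i)); last by congr (t _); rewrite !ffunE.
  by rewrite linearP !mxE.
apply: (@fin_dim_inj _ _ _ g) => u v; rewrite !gE => /(can_inj mxvecK) /row_matrixP uv.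
apply/ffunP => i; apply: (bij_inj bt).
by have := uv i; rewrite !rowK.
Qed.

Definition pencil_form (N : lmodType A) n (t : {linear N^rk -> 'rV[k]_n}) (MP MQ : 'M[k]_n) :=
  bijective t /\ forall l x, t (pencil_act l x) = t x *m (MP + l *: MQ).

Lemma pencil_form_exists (N : lmodType A) : fd N ->
  exists n (t : {linear N^rk -> 'rV[k]_n}) MP MQ, pencil_form t MP MQ.
Proof.
move=> /ffun_fin_dim[n [t bt]].
have [gP gPE] := mx_act_linear N P; have [MP MPE] := matrix_of_linear t gP bt.
have [gQ gQE] := mx_act_linear N Q; have [MQ MQE] := matrix_of_linear t gQ bt.
exists n, t, MP, MQ; split=> // l x.
rewrite mulmxDr -scalemxAr -MPE -MQE -linearZ -linearD gPE gQE; congr (t _).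
apply/ffunP => i; rewrite ffunE.
rewrite [RHS]scal_restr_ffunE !ffunE scaler_sumr -big_split; apply: eq_bigr => j _ /=.
by rewrite mxE scalerDl scalerA.
Qed.

Lemma pencil_form_rank_le (N N' : lmodType A) (f : {linear N -> N'})
    n (t : {linear N^rk -> 'rV[k]_n}) MP MQ n' (t' : {linear N'^rk -> 'rV[k]_n'}) MP' MQ' l :
  bijective f -> pencil_form t MP MQ -> pencil_form t' MP' MQ' ->
  (\rank (MP + l *: MQ)%R <= \rank (MP' + l *: MQ')%R)%N.
Proof.
move=> /linear_inverse[g fK gK] [bt tE] [bt' tE'].
have [F FE] := ffun_map_linear f; have [S SE] := matrix_of_linear t' F bt.
have [G GE] := ffun_map_linear g; have [S' SE'] := matrix_of_linear t G bt'.
have [s tK sK] := linear_inverse bt.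
have SS : S *m S' = 1%:M.
  apply: eq_mx_rV => u; rewrite mulmx1 -[u]sK mulmxA -SE -SE' GE FE; congr (t _).
  by apply/ffunP => i; rewrite !ffunE fK.
have MS : (MP + l *: MQ) *m S = S *m (MP' + l *: MQ').
  apply: eq_mx_rV => u; rewrite -[u]sK !mulmxA -tE -!SE -tE' !FE.
  by rewrite pencil_act_map.
rewrite -[X in \rank X]mulmx1 -SS mulmxA MS.
by apply: leq_trans (mxrankM_maxl _ _) (mxrankM_maxr _ _).
Qed.

(** The rank at l is not the generic one: the module presented by the pencil at
l has more homomorphisms to N than the generic member of the family. *)
Definition drops (N : lmodType A) (l : k) : Prop :=
  exists n (t : {linear N^rk -> 'rV[k]_n}) MP MQ, pencil_form t MP MQ /\
    exists m, (\rank (MP + l *: MQ)%R < \rank (MP + m *: MQ)%R)%N.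

Lemma drops_formP (N N' : lmodType A) l n' (t' : {linear N'^rk -> 'rV[k]_n'}) MP' MQ' :
  lmod_iso N N' -> drops N l -> pencil_form t' MP' MQ' ->
  exists m, (\rank (MP' + l *: MQ')%R < \rank (MP' + m *: MQ')%R)%N.
Proof.
move=> [f bf] [n [t [MP [MQ [tform [m lm]]]]]] tform'; exists m.
have [g fK gK] := linear_inverse bf; have bg : bijective g by exists f.
apply: leq_ltn_trans (pencil_form_rank_le _ bg tform' tform) _.
exact: leq_trans lm (pencil_form_rank_le _ bf tform tform').
Qed.

Lemma drops_iso (N N' : lmodType A) l : lmod_iso N N' -> fd N' -> drops N l -> drops N' l.
Proof.
move=> isoN /pencil_form_exists[n [t [MP [MQ tform]]]] dN.
by exists n, t, MP, MQ; split=> //; apply: drops_formP isoN dN tform.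
Qed.

Lemma drops_finite (N : lmodType A) : fd N -> exists s : seq k, forall l, drops N l -> l \in s.
Proof.
move=> /pencil_form_exists[n [t [MP [MQ tform]]]].
have [s sP] := pencil_drop_finite MP MQ; exists s => l dN.
have isoN : lmod_iso N N by exists idfun; exists id.
by have [m /sP] := drops_formP isoN dN tform.
Qed.

(** Ranks add up along a direct sum. *)
Lemma drops_prod (N U V : lmodType A) l : lmod_iso N (U * V)%type -> fd U -> fd V ->
  drops N l -> drops U l \/ drops V l.
Proof.
move=> isoN /pencil_form_exists[a [tU [UP [UQ formU]]]] /pencil_form_exists[b [tV [VP [VQ formV]]]] dN.
have [F FE] := @ffun_map_linear (U * V)%type U fst.
have [G GE] := @ffun_map_linear (U * V)%type V snd.
have /ex_linear[t tE] : linear (fun x : (U * V)%type^rk => row_mx (tU (F x)) (tV (G x))).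
  by move=> c u v; rewrite !linearP scale_row_mx add_row_mx.
have [[bU UE] [bV VE]] := (formU, formV).
have [sU tUK sUK] := linear_inverse bU; have [sV tVK sVK] := linear_inverse bV.
have form : pencil_form t (block_mx UP 0 0 VP) (block_mx UQ 0 0 VQ).
  split; last first.
    move=> m x; rewrite !tE !FE !GE -!(pencil_act_map fst) -!(pencil_act_map snd) UE VE.
    by rewrite scale_block_mx add_block_mx !scaler0 !addr0 mul_row_block !mulmx0 addr0 add0r.
  exists (fun w : 'rV_(a + b) => [ffun i => (sU (lsubmx w) i, sV (rsubmx w) i)]) => [x|w].
    rewrite tE row_mxKl row_mxKr tUK tVK FE GE; apply/ffunP => i; rewrite !ffunE.
    by case: (x i).
  rewrite tE -[RHS]hsubmxK; congr row_mx; rewrite ?FE ?GE.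
    by rewrite -[RHS]sUK; congr (tU _); apply/ffunP => i; rewrite !ffunE.
  by rewrite -[RHS]sVK; congr (tV _); apply/ffunP => i; rewrite !ffunE.
have [m] := drops_formP isoN dN form.
rewrite !scale_block_mx !add_block_mx !scaler0 !addr0 !rank_diag_block_mx => lt_lm.
have [ltU|geU] := ltnP (\rank (UP + l *: UQ)%R) (\rank (UP + m *: UQ)%R).
  by left; exists a, tU, UP, UQ; split=> //; exists m.
right; exists b, tV, VP, VQ; split=> //; exists m.
by rewrite -(ltn_add2l (\rank (UP + m *: UQ)%R)) (leq_ltn_trans _ lt_lm) // leq_add2r.
Qed.

Lemma drops_trivial (N : lmodType A) l : lmod_trivial N -> ~ drops N l.
Proof.
move=> N0 [n [t [MP [MQ [[[s tK sK] _] [m]]]]]].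
have n0 (M : 'M[k]_n) : M = 0.
  apply: eq_mx_rV => u; rewrite mulmx0 -[u *m M]sK -(linear0 t); congr (t _).
  by apply/ffunP => i; rewrite [RHS]ffunE; apply: N0.
by rewrite (n0 MQ) !scaler0 ltnn.
Qed.

Lemma drops_indec (N : lmodType A) l : fd N -> drops N l ->
  exists N' : lmodType A, [/\ fd N', lmod_indecomposable N' & drops N' l].
Proof.
case=> n; have [m le_nm] := ubnP n; elim: m => // m IH in N n le_nm *.
move=> [t bt] dN; have [N0|[indN|[U [V [isoN U0 V0]]]]] := indec_or_split N.
- by case: (drops_trivial N0 dN).
- by exists N; split=> //; exists n, t.
have [a [b [tU [tV [bU bV ab]]]]] := prod_fin_dim bt isoN.
have a0 := nontrivial_dim_gt0 bU U0; have b0 := nontrivial_dim_gt0 bV V0.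
have fU : fd U by exists a, tU.
have fV : fd V by exists b, tV.
have [dU|dV] := drops_prod isoN fU fV dN.
  apply: IH dU; last by exists tU.
  by rewrite -ltnS (leq_trans _ le_nm) // ltnS (leq_trans _ ab) // -addn1 leq_add2l.
apply: IH dV; last by exists tV.
by rewrite -ltnS (leq_trans _ le_nm) // ltnS (leq_trans _ ab) // -add1n leq_add2r.
Qed.

(** A module that drops at l has an indecomposable summand that does.  With
finitely many indecomposable modules, each dropping at finitely many values, not
every l could occur. *)
Theorem infinite_rep_type_of_drops :
  (forall l, exists2 N : lmodType A, fd N & drops N l) ->
  ~ finite_rep_type A.
Proof.
move=> dropN [n [M MP]].
have badM i : exists s : seq k, forall l,
    (exists N : lmodType A, [/\ fd N, lmod_iso N (M i) & drops N l]) -> l \in s.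
  have [fM|nfM] := classic (fd (M i)).
    have [s sP] := drops_finite fM; exists s => l [N [_ isoN dN]].
    exact: sP (drops_iso isoN fM dN).
  by exists [::] => l [N [fN isoN _]]; case: nfM; apply: iso_fin_dim isoN fN.
pose s i := epsilon (inhabits [::]) (fun s : seq k => forall l,
    (exists N : lmodType A, [/\ fd N, lmod_iso N (M i) & drops N l]) -> l \in s).
have sP i := epsilon_spec (inhabits [::]) (fun s : seq k => forall l,
    (exists N : lmodType A, [/\ fd N, lmod_iso N (M i) & drops N l]) -> l \in s) (badM i).
have [l ls] := closed_infinite (flatten [seq s i | i <- enum 'I_n]).
have [N fN dN] := dropN l.
have [N' [fN' indN' dN']] := drops_indec fN dN.
have [i isoN'] := MP N' (fin_dim_fg fN') indN'.
case/flattenP: ls; exists (s i); first by apply: map_f; rewrite mem_enum.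
by apply: sP; exists N'.
Qed.

(** A criterion on the image of pi alone: a projection commuting with the pencil
splits it, and the other part drops at finitely many values only. *)
Lemma drops_of_projection (N : lmodType A) l (pi : {linear scal_restr iota N -> scal_restr iota N}) :
  fd N -> (forall m, pi (pi m) = pi m) ->
  (forall m x, pencil_act m (ffun_map pi x) = ffun_map pi (pencil_act m x)) ->
  (forall m x, m != l -> (forall i, pi (pencil_act m x i) = 0) ->
     forall i, pi (pencil_act l x i) = 0) ->
  (exists2 x, forall i, pi (pencil_act l x i) = 0
     & forall m, m != l -> exists i, pi (pencil_act m x i) <> 0) ->
  drops N l.
Proof.
move=> /pencil_form_exists[n [t [MP [MQ tform]]]] pipi piact ker_sub [x0 x0l x0m].
exists n, t, MP, MQ; split=> //.
have [bt tE] := tform; have [s tK sK] := linear_inverse bt.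
have /ex_linear[F FE] : linear (@ffun_map N N pi : N^rk -> N^rk).
  by move=> c u v; apply/ffunP => i; rewrite !ffunE; apply: linearP.
have [E EE] := matrix_of_linear t F bt.
have Ecomm m : E *m (MP + m *: MQ) = (MP + m *: MQ) *m E.
  by apply: eq_mx_rV => u; rewrite -[u]sK !mulmxA -EE -!tE -EE !FE piact.
have EP : E *m MP = MP *m E by have := Ecomm 0; rewrite scale0r addr0.
have piP m x : t x *m (MP + m *: MQ) *m E = 0 <-> forall i, pi (pencil_act m x i) = 0.
  rewrite -tE -EE FE; split=> [tx i|pix].
    have /ffunP/(_ i) : ffun_map pi (pencil_act m x) = 0 :> N^rk.
      by apply: (can_inj tK); rewrite tx linear0.
    by rewrite !ffunE.
  rewrite -(linear0 t); congr (t _); apply/ffunP => i; rewrite [LHS]ffunE [RHS]ffunE.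
  exact: pix.
apply: (@pencil_drop_of_idem _ _ _ _ E) => //.
- by apply: eq_mx_rV => u; rewrite -[u]sK mulmxA -!EE !FE; congr (t _);
     apply/ffunP => i; rewrite !ffunE pipi.
- have := Ecomm 1; rewrite !scale1r mulmxDr mulmxDl EP.
  exact: addrI.
- by move=> m u ml; rewrite -[u]sK => /piP pix; apply/piP; apply: ker_sub pix.
exists (t x0); first exact/piP.
move=> m ml; apply/eqP => /piP pix; have [i] := x0m m ml; exact.
Qed.

End PencilDrops.

(** * Coinduced modules of the category algebra *)

Section CatAlgebra.
Import GRing.Theory.
Local Open Scope ring_scope.
Variables (k : fieldType) (C : finEICat).
Local Notation A := (cat_alg k C).

Definition cat_scal (c : k) : A := c *: (1 : A).

Fact cat_scal_zmod_morphism : zmod_morphism cat_scal.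
Proof. by move=> c d; rewrite /cat_scal scalerBl. Qed.
Fact cat_scal_monoid_morphism : monoid_morphism cat_scal.
Proof.
split=> [|c d]; first by rewrite /cat_scal scale1r.
by rewrite /cat_scal -cat_alg_scaleAl mul1r scalerA.
Qed.
HB.instance Definition _ := GRing.isZmodMorphism.Build k A cat_scal cat_scal_zmod_morphism.
HB.instance Definition _ := GRing.isMonoidMorphism.Build k A cat_scal cat_scal_monoid_morphism.

Lemma cat_scalM c (a : A) : cat_scal c * a = c *: a.
Proof. by rewrite /cat_scal -cat_alg_scaleAl mul1r. Qed.

Lemma cat_scal_central c (a : A) : cat_scal c * a = a * cat_scal c.
Proof. by rewrite cat_scalM /cat_scal -cat_alg_scaleAr mulr1. Qed.

Lemma cat_alg_expand (a : A) : a = \sum_m a m *: cat_alg_basis k m.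
Proof.
apply/ffunP => m; rewrite cat_alg_sumE (bigD1 m) //= big1 ?addr0.
  by rewrite !ffunE eqxx [RHS]mulr1.
by move=> m' mm'; rewrite !ffunE eq_sym (negPf mm') [LHS]mulr0.
Qed.

Lemma cat_alg_span : exists d (b : 'I_d -> A),
  forall a, exists c : 'I_d -> k, a = \sum_i cat_scal (c i) * b i.
Proof.
exists #|cat_mor C|, (fun i => cat_alg_basis k (enum_val i)) => a.
exists (fun i => a (enum_val i)); rewrite {1}(cat_alg_expand a).
rewrite (reindex (@enum_val _ (mem (cat_mor C)))) /=; last first.
  by apply: onW_bij; apply: enum_val_bij.
by apply: eq_bigr => i _; rewrite cat_scalM.
Qed.

Section Coinduction.
Variables (n : nat) (I : finType) (s : I -> A) (S : I -> 'M[k]_n).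
Local Notation FF := ({ffun cat_mor C -> 'rV[k]_n}).

Definition lin_ext (F : FF) (a : A) : 'rV[k]_n := \sum_m a m *: F m.

Lemma lin_ext_linear F : linear (lin_ext F).
Proof.
move=> c a b; rewrite /lin_ext scaler_sumr -big_split; apply: eq_bigr => m _ /=.
by rewrite !ffunE scalerDl scalerA.
Qed.
HB.instance Definition _ F := GRing.isLinear.Build k A 'rV[k]_n *:%R (lin_ext F) (lin_ext_linear F).

Lemma lin_ext_basis F m : lin_ext F (cat_alg_basis k m) = F m.
Proof.
rewrite /lin_ext (bigD1 m) //= big1 ?addr0; first by rewrite ffunE eqxx scale1r.
by move=> m' mm'; rewrite ffunE (negPf mm') scale0r.
Qed.

Lemma lin_ext_sub c F F' a : lin_ext (c *: F + F') a = c *: lin_ext F a + lin_ext F' a.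
Proof.
rewrite /lin_ext scaler_sumr -big_split; apply: eq_bigr => m _ /=.
by rewrite !ffunE scalerDr !scalerA mulrC.
Qed.

Lemma cat_alg_ind (X : lmodType k) (f g : {linear A -> X}) :
  (forall m, f (cat_alg_basis k m) = g (cat_alg_basis k m)) -> f =1 g.
Proof.
move=> fg a; rewrite (cat_alg_expand a) !linear_sum; apply: eq_bigr => m _.
by rewrite !linearZ /= fg.
Qed.

Definition equivariant : {pred FF} :=
  [pred F : FF | [forall i, forall m, lin_ext F (s i * cat_alg_basis k m) == F m *m S i]].

Lemma equivariantP F : reflect
  (forall i a, lin_ext F (s i * a) = lin_ext F a *m S i) (F \in equivariant).
Proof.
apply: (iffP forallP) => [eF i a|eF i]; last first.
  by apply/forallP => m; rewrite eF lin_ext_basis.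
rewrite (cat_alg_expand a) mulr_sumr !linear_sum mulmx_suml; apply: eq_bigr => m _.
rewrite -cat_alg_scaleAr !linearZ /= -scalemxAl lin_ext_basis.
by have /forallP/(_ m)/eqP-> := eF i.
Qed.

Fact equivariant_closed : submod_closed equivariant.
Proof.
split=> [|c F F' /equivariantP eF /equivariantP eF'].
  apply/equivariantP => i a; rewrite /lin_ext !big1 ?mul0mx // => m _;
  by rewrite [X in _ *: X]ffunE scaler0.
by apply/equivariantP => i a; rewrite !lin_ext_sub eF eF' mulmxDl scalemxAl.
Qed.

Definition translate (a : A) (F : FF) : FF := [ffun m => lin_ext F (cat_alg_basis k m * a)].

Lemma lin_ext_translate a F b : lin_ext (translate a F) b = lin_ext F (b * a).
Proof.
rewrite [in RHS](cat_alg_expand b) mulr_suml linear_sum; apply: eq_bigr => m _.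
by rewrite ffunE -cat_alg_scaleAl linearZ.
Qed.

Lemma translate_equivariant a F : F \in equivariant -> translate a F \in equivariant.
Proof.
move=> /equivariantP eF; apply/equivariantP => i b.
by rewrite !lin_ext_translate -mulrA eF.
Qed.

(** The module Hom_{A1}(A, k^n), for the subalgebra A1 generated by the elements
s_i acting on k^n through the matrices S_i; a acts by right translation.  Its
elements are stored as functions on the basis of morphisms. *)
Definition coind : Type := submod equivariant_closed.
HB.instance Definition _ := GRing.Zmodule.on coind.

Definition coind_act (a : A) (F : coind) : coind :=
  Sub (translate a (\val F)) (translate_equivariant a (valP F)).

Lemma coind_actE a F : \val (coind_act a F) = translate a (\val F).
Proof. exact: SubK. Qed.

Fact coind_actA a b F : coind_act a (coind_act b F) = coind_act (a * b) F.
Proof.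
apply: val_inj; apply/ffunP => m.
by rewrite !coind_actE !ffunE lin_ext_translate mulrA.
Qed.

Fact coind_act1 : left_id 1 coind_act.
Proof.
by move=> F; apply: val_inj; apply/ffunP => m; rewrite coind_actE ffunE mulr1 lin_ext_basis.
Qed.

Fact coind_actDr : right_distributive coind_act +%R.
Proof.
move=> a F F'; apply: val_inj; apply/ffunP => m; rewrite coind_actE ffunE.
have -> : \val (F + F') = 1 *: \val F + \val F' by rewrite scale1r.
by rewrite lin_ext_sub scale1r [RHS]ffunE !coind_actE !ffunE.
Qed.

Fact coind_actDl F : {morph coind_act^~ F : a b / a + b}.
Proof.
move=> a b; apply: val_inj; apply/ffunP => m.
by rewrite coind_actE ffunE mulrDr linearD [RHS]ffunE !coind_actE !ffunE.
Qed.

HB.instance Definition _ := GRing.Zmodule_isLmodule.Build A coind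
  coind_actA coind_act1 coind_actDr coind_actDl.

Definition coind_ev (a : A) (F : coind) : 'rV[k]_n := lin_ext (\val F) a.

Lemma coind_ev_act a b F : coind_ev a (b *: F : coind) = coind_ev (a * b) F.
Proof. by rewrite /coind_ev coind_actE lin_ext_translate. Qed.

Lemma coind_ev_equiv i a F : coind_ev (s i * a) F = coind_ev a F *m S i.
Proof. by have /equivariantP := valP F; apply. Qed.

Lemma coind_ev_inj F F' : (forall m, coind_ev (cat_alg_basis k m) F = coind_ev (cat_alg_basis k m) F') -> F = F'.
Proof.
by move=> FF; apply: val_inj; apply/ffunP => m; have := FF m; rewrite /coind_ev !lin_ext_basis.
Qed.

Lemma coind_evD a F F' : coind_ev a (F + F') = coind_ev a F + coind_ev a F'.
Proof. by rewrite /coind_ev -[in RHS](scale1r (lin_ext (\val F) a)) -lin_ext_sub scale1r. Qed.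

Lemma coind_ev0 a : coind_ev a 0 = 0.
Proof. by apply: (addrI (coind_ev a 0)); rewrite -coind_evD !addr0. Qed.

Lemma coind_evDl a b F : coind_ev (a + b) F = coind_ev a F + coind_ev b F.
Proof. exact: linearD. Qed.

Lemma coind_evZl c b F : coind_ev (c *: b) F = c *: coind_ev b F.
Proof. exact: linearZ. Qed.

Lemma coind_evZ a c (F : scal_restr cat_scal coind) : coind_ev a (c *: F) = c *: coind_ev a F.
Proof.
by rewrite scal_restr_scaleE coind_ev_act -cat_scal_central cat_scalM /coind_ev linearZ.
Qed.

Lemma coind_ex (f : A -> 'rV[k]_n) : linear f -> (forall i a, f (s i * a) = f a *m S i) ->
  exists F : coind, forall a, coind_ev a F = f a.
Proof.
move=> /ex_linear[g gf] fS.
pose F0 : FF := [ffun m => f (cat_alg_basis k m)].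
have F0E a : lin_ext F0 a = f a.
  rewrite -gf (cat_alg_expand a) !linear_sum; apply: eq_bigr => m _.
  by rewrite !linearZ /= lin_ext_basis ffunE gf.
have F0in : F0 \in equivariant by apply/equivariantP => i a; rewrite !F0E fS.
by exists (Sub F0 F0in : submod equivariant_closed) => a; rewrite /coind_ev SubK.
Qed.

Lemma coind_fin_dim : fin_dim (scal_restr cat_scal coind).
Proof.
have /ex_linear[g gE] : linear (fun F : scal_restr cat_scal coind =>
    mxvec (\matrix_(i < #|cat_mor C|) coind_ev (cat_alg_basis k (enum_val i)) F)).
  move=> c F F'; rewrite -linearP; congr mxvec; apply/row_matrixP => i.
  by rewrite linearP /= !rowK coind_evD coind_evZ.
apply: (@fin_dim_inj _ _ _ g) => F F'; rewrite !gE => /(can_inj mxvecK)/row_matrixP FF.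
apply: coind_ev_inj => m; have := FF (enum_rank m).
by rewrite !rowK enum_rankK.
Qed.

End Coinduction.
End CatAlgebra.

(** * Pairs of nilpotent operators glued by a map *)

Section LinearAlgebra.
Import GRing.Theory.
Local Open Scope ring_scope.
Variable k : fieldType.

Lemma ex_separating_form m n (u : 'rV[k]_n) (S : 'M[k]_(m, n)) :
  ~~ (u <= S)%MS -> exists l : 'cV[k]_n, S *m l = 0 /\ u *m l = 1%:M.
Proof.
rewrite submxE; have := mulmx_coker S; move: (cokermx S) => K SK.
case/matrix0Pn => i [j ij]; exists (((u *m K) i j)^-1 *: col j K); split.
  by rewrite -scalemxAr colE mulmxA SK mul0mx scaler0.
rewrite -scalemxAr colE mulmxA -colE; apply/matrixP => i' j'; rewrite !ord1 in ij *.
by rewrite mxE [col _ _ _ _]mxE mulVf // mxE.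
Qed.

Lemma ex_col_solution m n (B : 'M[k]_(m, n)) (c : 'cV[k]_m) :
  (forall u : 'rV_m, u *m B = 0 -> u *m c = 0) -> exists l, B *m l = c.
Proof.
move=> Bc; suff /submxP[l cE] : (c^T <= B^T)%MS.
  by exists l^T; rewrite -[c]trmxK cE trmx_mul trmxK.
rewrite submxE -trmx_eq0 trmx_mul trmxK; apply/eqP/row_matrixP => i.
rewrite row_mul row0; apply: Bc; rewrite -row_mul -[B]trmxK -trmx_mul trmxK.
by rewrite mulmx_coker trmx0 row0.
Qed.

Lemma unitriangular_unit n (M : 'M[k]_n) :
  (forall s t : 'I_n, (t < s)%N -> M s t = 0) -> (forall s, M s s = 1) -> M \in unitmx.
Proof.
move=> low diag; rewrite unitmxE -det_tr det_trig; last first.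
  by apply/is_trig_mxP => s t st; rewrite mxE low.
by rewrite big1 ?unitr1 // => s _; rewrite mxE diag.
Qed.

End LinearAlgebra.

(** Matrices act on row vectors from the right, so a relation ZX = 0 between
operators reads X *m Z = 0. *)
Section GluedJordan.
Import GRing.Theory.
Local Open Scope ring_scope.
Variable k : fieldType.

Definition shift_mx i : 'M[k]_i := \matrix_(s, t) (t == s.+1 :> nat)%:R.
Definition glue_mx i j : 'M[k]_(i, j) := \matrix_(s, t) ((s == 0 :> nat) && (t.+1 == j :> nat))%:R.

Definition quintuple n (Ex Ey X Y Z : 'M[k]_n) (i : 'I_5) : 'M[k]_n :=
  nth 0 [:: Ex; Ey; X; Y; Z] i.

(** The module with Jordan blocks k^i and k^j, the top vector of the first
being sent to the socle of the second.  For i = 0 or j = 0 a single Jordan block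
remains. *)
Definition glued_jordan i j : 'I_5 -> 'M[k]_(i + j) :=
  quintuple (block_mx 1%:M 0 0 0) (block_mx 0 0 0 1%:M)
    (block_mx (shift_mx i) 0 0 0) (block_mx 0 0 0 (shift_mx j)) (block_mx 0 (glue_mx i j) 0 0).

Lemma shift_rows i n (f : nat -> 'rV[k]_n) : f i = 0 ->
  shift_mx i *m \matrix_(t < i) f t = \matrix_(t < i) f t.+1.
Proof.
move=> fi; apply/row_matrixP => s; rewrite row_mul rowK mulmx_sum_row.
under eq_bigr => t _ do rewrite rowK !mxE.
have [lt_si|] := ltnP s.+1 i.
  rewrite (bigD1 (Ordinal lt_si)) //= eqxx scale1r big1 ?addr0 // => t.
  by rewrite -val_eqE /= => /negPf->; rewrite scale0r.
move=> le_is; have -> : s.+1 = i by apply/eqP; rewrite eqn_leq le_is ltn_ord.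
by rewrite fi big1 // => t _; rewrite ltn_eqF ?scale0r.
Qed.

Lemma shift_cols i n (g : nat -> 'cV[k]_n) :
  (\matrix_(r < n, t < i) g t r 0) *m shift_mx i = \matrix_(r < n, t < i) (if nat_of_ord t is t'.+1 then g t' else 0) r 0.
Proof.
apply/matrixP => r t; rewrite !mxE.
under eq_bigr => s _ do rewrite !mxE.
case: t => [[|t] ti] /=; first by rewrite big1 ?mxE // => s _; rewrite mulr0.
rewrite (bigD1 (Ordinal (ltnW ti))) //= eqxx mulr1 big1 ?addr0 // => s.
by rewrite -val_eqE /= eqSS eq_sym => /negPf->; rewrite mulr0.
Qed.

Lemma glue_rows i j n (f : nat -> 'rV[k]_n) (s : 'I_i) :
  row s (glue_mx i j *m \matrix_(t < j) f t) = if (s == 0 :> nat) && (0 < j)%N then f j.-1 else 0.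
Proof.
rewrite row_mul mulmx_sum_row; under eq_bigr => t _ do rewrite rowK !mxE.
case: eqP => [s0|s0] /=; last by rewrite big1 // => t _; rewrite scale0r.
case: j => [|j] /=; first by rewrite big_ord0.
rewrite (bigD1 ord_max) //= eqxx scale1r big1 ?addr0 // => t.
by rewrite -val_eqE /= eqSS => /negPf->; rewrite scale0r.
Qed.

Lemma glue_cols i j n (g : nat -> 'cV[k]_n) :
  (\matrix_(r < n, t < i) g t r 0) *m glue_mx i j
  = \matrix_(r < n, t < j) (if (t.+1 == j :> nat) && (0 < i)%N then g 0%N else 0) r 0.
Proof.
apply/matrixP => r t; rewrite !mxE; under eq_bigr => s _ do rewrite !mxE.
case: eqP => [tj|tj] /=; last first.
  by rewrite big1 ?mxE // => s _; rewrite andbF mulr0.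
case: i => [|i] /=; first by rewrite big_ord0 mxE.
rewrite (bigD1 ord0) //= mulr1 big1 ?addr0 // => s.
by rewrite -val_eqE /= => /negPf->; rewrite mulr0.
Qed.

Variables (n : nat) (Ex Ey X Y Z : 'M[k]_n) (a b : nat).
Hypotheses (E1 : Ex + Ey = 1%:M) (Exy : Ex *m Ey = 0) (Eyx : Ey *m Ex = 0).
Hypotheses (ExX : Ex *m X = X) (XEx : X *m Ex = X) (EyY : Ey *m Y = Y) (YEy : Y *m Ey = Y).
Hypotheses (ExZ : Ex *m Z = Z) (ZEy : Z *m Ey = Z) (XZ : X *m Z = 0) (ZY : Z *m Y = 0).
Hypotheses (Xa : X ^+ a = 0) (Yb : Y ^+ b = 0).

Let R : 'I_5 -> 'M_n := quintuple Ex Ey X Y Z.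

Lemma quintuple_ind (T : Type) m (f : 'M[k]_n -> T) (g : 'M[k]_m -> T) Fx Fy F G H :
  f Ex = g Fx -> f Ey = g Fy -> f X = g F -> f Y = g G -> f Z = g H ->
  forall i, f (R i) = g (quintuple Fx Fy F G H i).
Proof. by move=> ? ? ? ? ? [[|[|[|[|[|//]]]]] ?]. Qed.

Lemma mx_expS m (M : 'M[k]_m) t : M ^+ t.+1 = M *m M ^+ t.
Proof. exact: exprS. Qed.

Lemma mx_expSr m (M : 'M[k]_m) t : M ^+ t.+1 = M ^+ t *m M.
Proof. exact: exprSr. Qed.

Lemma mx_comm_exp m (M M' : 'M[k]_m) t : M *m M' = M' *m M -> M *m M' ^+ t = M' ^+ t *m M.
Proof. by move=> MM; apply: (@commrX _ M M' t). Qed.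

Section Splitting.
Variable e : 'M[k]_n.
Hypotheses (ee : e *m e = e) (eR : forall x, e *m R x = R x *m e).

Let eEx : e *m Ex = Ex *m e. Proof. exact: (eR (@Ordinal 5 0 isT)). Qed.
Let eEy : e *m Ey = Ey *m e. Proof. exact: (eR (@Ordinal 5 1 isT)). Qed.
Let eX : e *m X = X *m e. Proof. exact: (eR (@Ordinal 5 2 isT)). Qed.
Let eY : e *m Y = Y *m e. Proof. exact: (eR (@Ordinal 5 3 isT)). Qed.
Let eZ : e *m Z = Z *m e. Proof. exact: (eR (@Ordinal 5 4 isT)). Qed.
Let EyX : Ey *m X = 0. Proof. by rewrite -ExX mulmxA Eyx mul0mx. Qed.
Let XEy : X *m Ey = 0. Proof. by rewrite -XEx -mulmxA Exy mulmx0. Qed.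
Let ExY : Ex *m Y = 0. Proof. by rewrite -EyY mulmxA Exy mul0mx. Qed.
Let YEx : Y *m Ex = 0. Proof. by rewrite -YEy -mulmxA Eyx mulmx0. Qed.
Let EyZ : Ey *m Z = 0. Proof. by rewrite -ExZ mulmxA Eyx mul0mx. Qed.
Let ZEx : Z *m Ex = 0. Proof. by rewrite -ZEy -mulmxA Eyx mulmx0. Qed.
Let ExEx : Ex *m Ex = Ex. Proof. by rewrite -[RHS]mulmx1 -E1 mulmxDr Exy addr0. Qed.
Let EyEy : Ey *m Ey = Ey. Proof. by rewrite -[RHS]mulmx1 -E1 mulmxDr Eyx add0r. Qed.
Let ExXt t : Ex *m X ^+ t = X ^+ t *m Ex. Proof. by apply: mx_comm_exp; rewrite ExX XEx. Qed.
Let EyYt t : Ey *m Y ^+ t = Y ^+ t *m Ey. Proof. by apply: mx_comm_exp; rewrite EyY YEy. Qed.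
Let XeE : X *m e *m Ex = e *m Ex *m X.
Proof. by rewrite -eX -!mulmxA XEx ExX. Qed.
Let YeE : Y *m e *m Ey = e *m Ey *m Y.
Proof. by rewrite -eY -!mulmxA YEy EyY. Qed.
Let eXt t : e *m X ^+ t = X ^+ t *m e. Proof. exact: mx_comm_exp. Qed.
Let eYt t : e *m Y ^+ t = Y ^+ t *m e. Proof. exact: mx_comm_exp. Qed.

Lemma row_matrix_mul i m (f : nat -> 'rV[k]_n) (M : 'M_(n, m)) :
  (\matrix_(t < i) f t) *m M = \matrix_(t < i) (f t *m M).
Proof. by apply/row_matrixP => t; rewrite row_mul !rowK. Qed.

Lemma mul_col_matrix i m (g : nat -> 'cV[k]_n) (M : 'M_(m, n)) :
  M *m (\matrix_(r < n, t < i) g t r 0) = \matrix_(r < m, t < i) (M *m g t) r 0.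
Proof.
apply/matrixP => r t; rewrite !mxE; apply: eq_bigr => s _.
by rewrite mxE.
Qed.

Lemma row_col_mul i j (f : nat -> 'rV[k]_n) (g : nat -> 'cV[k]_n) :
  (\matrix_(t < i) f t) *m (\matrix_(r < n, t < j) g t r 0)
  = \matrix_(s < i, t < j) (f s *m g t) 0 0.
Proof.
apply/matrixP => s t; rewrite !mxE; apply: eq_bigr => r _.
by rewrite !mxE.
Qed.

(** Sufficient data for splitting off a glued pair of Jordan blocks.  The rows
v X^s and w Y^t define a map from the module [glued_jordan i j], and the linear
forms lV and lW define one to it, whose coordinates on a vector u of the image
of e are the lV (u Ex X^(i-1-s)) and the lW (u Ey Y^(j-1-t)).  The hypotheses
make both maps commute with all five operators; their composite on the small
module is unitriangular on each block. *)
Section Summand.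
Variables (i j : nat) (v w : 'rV[k]_n) (lV lW : 'cV[k]_n).
Hypotheses (ve : v *m e = v) (vx : v *m Ex = v) (we : w *m e = w) (wy : w *m Ey = w).
Hypotheses (vXi : v *m X ^+ i = 0) (wYj : w *m Y ^+ j = 0).
Hypothesis (vZ : (0 < i)%N -> v *m Z = if (0 < j)%N then w *m Y ^+ j.-1 else 0).
Hypotheses (lVi : e *m Ex *m X ^+ i *m lV = 0) (lWj : e *m Ey *m Y ^+ j *m lW = 0).
Hypothesis (ZlW : (0 < j)%N -> e *m Z *m lW = if (0 < i)%N then e *m Ex *m X ^+ i.-1 *m lV else 0).
Hypotheses (v1 : (0 < i)%N -> v *m X ^+ i.-1 *m lV = 1%:M).
Hypotheses (w1 : (0 < j)%N -> w *m Y ^+ j.-1 *m lW = 1%:M).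

Let f t := v *m X ^+ t.
Let h t := w *m Y ^+ t.
Let f' t := e *m Ex *m X ^+ (i - t.+1) *m lV.
Let h' t := e *m Ey *m Y ^+ (j - t.+1) *m lW.
Let bV : 'M_(i, n) := \matrix_t f t.
Let bW : 'M_(j, n) := \matrix_t h t.
Let aV : 'M_(n, i) := \matrix_(r < n, t < i) f' t r 0.
Let aW : 'M_(n, j) := \matrix_(r < n, t < j) h' t r 0.

Let al : 'M_(n, i + j) := row_mx aV aW.
Let be : 'M_(i + j, n) := col_mx bV bW.

Let fEx t : f t *m Ex = f t. Proof. by rewrite /f -mulmxA -ExXt mulmxA vx. Qed.
Let hEy t : h t *m Ey = h t. Proof. by rewrite /h -mulmxA -EyYt mulmxA wy. Qed.
Let fe t : f t *m e = f t. Proof. by rewrite /f -mulmxA -eXt mulmxA ve. Qed.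
Let he t : h t *m e = h t. Proof. by rewrite /h -mulmxA -eYt mulmxA we. Qed.
Let fEy t : f t *m Ey = 0. Proof. by rewrite -fEx -mulmxA Exy mulmx0. Qed.
Let hEx t : h t *m Ex = 0. Proof. by rewrite -hEy -mulmxA Eyx mulmx0. Qed.
Let Exf' t : Ex *m f' t = f' t. Proof. by rewrite /f' !mulmxA -eEx -(mulmxA e) ExEx. Qed.
Let Eyh' t : Ey *m h' t = h' t. Proof. by rewrite /h' !mulmxA -eEy -(mulmxA e) EyEy. Qed.
Let Eyf' t : Ey *m f' t = 0. Proof. by rewrite -Exf' mulmxA Eyx mul0mx. Qed.
Let Exh' t : Ex *m h' t = 0. Proof. by rewrite -Eyh' mulmxA Exy mul0mx. Qed.
Let ef' t : e *m f' t = f' t. Proof. by rewrite /f' !mulmxA ee. Qed.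
Let eh' t : e *m h' t = h' t. Proof. by rewrite /h' !mulmxA ee. Qed.

Let bM (M : 'M_n) fM hM : (forall t, (t < i)%N -> f t *m M = fM t) -> (forall t, (t < j)%N -> h t *m M = hM t) ->
  be *m M = col_mx (\matrix_(t < i) fM t) (\matrix_(t < j) hM t).
Proof.
move=> fE hE; rewrite mul_col_mx !row_matrix_mul.
by congr col_mx; apply/row_matrixP => t; rewrite !rowK ?fE ?hE.
Qed.

Let aM (M : 'M_n) fM hM : (forall t, (t < i)%N -> M *m f' t = fM t) -> (forall t, (t < j)%N -> M *m h' t = hM t) ->
  M *m al = row_mx (\matrix_(r < n, t < i) fM t r 0) (\matrix_(r < n, t < j) hM t r 0).
Proof.
move=> fE hE; rewrite mul_mx_row !mul_col_matrix.
by congr row_mx; apply/matrixP => r t; rewrite [LHS]mxE [RHS]mxE ?fE ?hE.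
Qed.

Let row_matrix0 m : (\matrix_(t < m) (0 : 'rV[k]_n)) = 0.
Proof. by apply/row_matrixP => t; rewrite rowK row0. Qed.
Let col_matrix0 m : (\matrix_(r < n, t < m) (0 : 'cV[k]_n) r 0) = 0.
Proof. by apply/matrixP => r t; rewrite !mxE. Qed.

Let beR x : glued_jordan i j x *m be = be *m R x.
Proof.
apply/esym; apply: (quintuple_ind (f := fun M => be *m M) (g := fun M => M *m be)).
- rewrite (bM (fM := f) (hM := fun=> 0)) // mul_block_col !mul0mx mul1mx !addr0.
  by rewrite row_matrix0.
- rewrite (bM (fM := fun=> 0) (hM := h)) // mul_block_col !mul0mx mul1mx !add0r.
  by rewrite row_matrix0.
- rewrite (bM (fM := fun t => f t.+1) (hM := fun=> 0)).
  + by rewrite mul_block_col !mul0mx !addr0 shift_rows // row_matrix0.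
  + by move=> t _; rewrite /f mx_expSr mulmxA.
  + by move=> t _; rewrite -hEy -mulmxA EyX mulmx0.
- rewrite (bM (fM := fun=> 0) (hM := fun t => h t.+1)).
  + by rewrite mul_block_col !mul0mx !add0r shift_rows // row_matrix0.
  + by move=> t _; rewrite -fEx -mulmxA ExY mulmx0.
  + by move=> t _; rewrite /h mx_expSr mulmxA.
- rewrite (bM (fM := fun t => if (t == 0)%N && (0 < j)%N then h j.-1 else 0) (hM := fun=> 0)).
  + rewrite mul_block_col !mul0mx add0r row_matrix0; congr col_mx; last by rewrite addr0.
    by apply/row_matrixP => t; rewrite glue_rows rowK.
  + move=> [|t] ti; rewrite /f /=; first by rewrite mulmx1 vZ.
    by rewrite mx_expSr -!mulmxA XZ !mulmx0.
  + by move=> t _; rewrite -hEy -mulmxA EyZ mulmx0.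
Qed.

Let alR x : R x *m al = al *m glued_jordan i j x.
Proof.
apply: (quintuple_ind (f := fun M => M *m al) (g := fun M => al *m M)).
- rewrite (aM (fM := f') (hM := fun=> 0)) // mul_row_block !mulmx0 mulmx1 !addr0.
  by rewrite col_matrix0.
- rewrite (aM (fM := fun=> 0) (hM := h')) // mul_row_block !mulmx0 mulmx1 !add0r.
  by rewrite col_matrix0.
- rewrite (aM (fM := fun t => if t is t'.+1 then f' t' else 0) (hM := fun=> 0)).
  + by rewrite mul_row_block !mulmx0 !addr0 shift_cols // col_matrix0.
  + move=> t ti; have -> : X *m f' t = e *m Ex *m X ^+ (i - t) *m lV.
      rewrite /f' !mulmxA XeE -(subnSK ti) mx_expS.
      by rewrite !mulmxA.
    by case: t ti => [|t] ti; rewrite ?subn0.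
  + by move=> t _; rewrite -Eyh' mulmxA XEy mul0mx.
- rewrite (aM (fM := fun=> 0) (hM := fun t => if t is t'.+1 then h' t' else 0)).
  + by rewrite mul_row_block !mulmx0 !add0r shift_cols // col_matrix0.
  + by move=> t _; rewrite -Exf' mulmxA YEx mul0mx.
  + move=> t tj; have -> : Y *m h' t = e *m Ey *m Y ^+ (j - t) *m lW.
      rewrite /h' !mulmxA YeE -(subnSK tj) mx_expS.
      by rewrite !mulmxA.
    by case: t tj => [|t] tj; rewrite ?subn0.
  - rewrite (aM (fM := fun=> 0) (hM := fun t => if (t.+1 == j)%N && (0 < i)%N then f' 0%N else 0)).
  + rewrite mul_row_block !mulmx0 !addr0 glue_cols col_matrix0.
    by [].
  + by move=> t _; rewrite -Exf' mulmxA ZEx mul0mx.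
  + move=> t tj; rewrite /h' !mulmxA -eZ -(mulmxA e) ZEy.
    have [tj'|ntj] := eqVneq t.+1 j.
      by rewrite tj' subnn mulmx1 ZlW ?(leq_ltn_trans _ tj) //= /f' subn1.
    have : (0 < j - t.+1)%N by rewrite subn_gt0 ltn_neqAle ntj.
    by case: (j - t.+1)%N => // d _; rewrite mx_expS -(mulmxA e) (mulmxA Z) ZY mul0mx mulmx0 mul0mx.
Qed.

Let be_al_unit : be *m al \in unitmx.
Proof.
have eEX t s : f t *m (e *m Ex *m X ^+ s *m lV) = v *m X ^+ (t + s) *m lV.
  by rewrite !mulmxA fe fEx /f -(mulmxA v) -[X ^+ t *m _]exprD.
have eEY t s : h t *m (e *m Ey *m Y ^+ s *m lW) = w *m Y ^+ (t + s) *m lW.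
  by rewrite !mulmxA he hEy /h -(mulmxA w) -[Y ^+ t *m _]exprD.
rewrite mul_col_row !row_col_mul.
have -> : (\matrix_(s < i, t < j) (f s *m h' t) 0 0) = 0.
  by apply/matrixP => s t; rewrite mxE -Eyh' mulmxA fEy mul0mx !mxE.
have -> : (\matrix_(s < j, t < i) (h s *m f' t) 0 0) = 0.
  by apply/matrixP => s t; rewrite mxE -Exf' mulmxA hEx mul0mx !mxE.
rewrite unitmxE det_ublock unitrM -!unitmxE; apply/andP; split.
  apply: unitriangular_unit => [s t ts|s]; rewrite mxE eEX.
    rewrite addnBA // addnC -addnBA; last by [].
    by rewrite exprD -[X ^+ i * _]/(_ *m _) mulmxA vXi mul0mx mul0mx mxE.
  have i0 : (0 < i)%N by apply: leq_ltn_trans (ltn_ord s).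
  by rewrite subnS -subn1 addnBA ?subn_gt0 // subnKC 1?ltnW // subn1 v1 // mxE eqxx.
apply: unitriangular_unit => [s t ts|s]; rewrite mxE eEY.
  rewrite addnBA // addnC -addnBA; last by [].
  by rewrite exprD -[Y ^+ j * _]/(_ *m _) mulmxA wYj mul0mx mul0mx mxE.
have j0 : (0 < j)%N by apply: leq_ltn_trans (ltn_ord s).
by rewrite subnS -subn1 addnBA ?subn_gt0 // subnKC 1?ltnW // subn1 w1 // mxE eqxx.
Qed.

Lemma glued_summand : exists (al : 'M_(n, i + j)) (be : 'M_(i + j, n)),
  [/\ forall x, R x *m al = al *m glued_jordan i j x,
      forall x, glued_jordan i j x *m be = be *m R x,
      e *m al = al, be *m e = be & be *m al \in unitmx].
Proof.
exists al, be; split=> //; first by rewrite (aM (fM := f') (hM := h')).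
by rewrite (bM (fM := f) (hM := h)).
Qed.

End Summand.

Lemma kill_exp (M : 'M[k]_n) (P : 'M[k]_n) c : M ^+ c = 0 -> P != 0 ->
  exists i, [/\ (0 < i <= c)%N, P *m M ^+ i = 0 & P *m M ^+ i.-1 != 0].
Proof.
move=> Mc P0; have [|i [Pi min_i]] := @ex_least (fun i => P *m M ^+ i = 0) c.
  by rewrite Mc mulmx0.
have i0 : (0 < i)%N.
  by case: i Pi {min_i} => // Pi; rewrite -[P]mulmx1 -[1%:M]/(M ^+ 0) Pi eqxx in P0.
exists i; split=> //; first by rewrite i0 min_i // Mc mulmx0.
by apply/eqP => /min_i; rewrite -ltnS prednK // ltnn.
Qed.

(** The main case is eZ != 0.  Take i least such that some v killed by X^i has
v Z != 0, and then, over all such v, the largest j with v Z in the image of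
Y^(j-1), say v Z = w Y^(j-1).  Maximality of j gives a form lW that kills the
image of Y^j but not v Z.  By minimality of i, Z kills all u with u X^(i-1) = 0,
so u Z lW depends only on u X^(i-1), and equals lV (u X^(i-1)) for some form
lV. *)
Lemma ex_glued_summand : e != 0 -> exists i j,
  [/\ (i <= a)%N, (j <= b)%N, (0 < i + j)%N &
  exists (al : 'M_(n, i + j)) (be : 'M_(i + j, n)),
  [/\ forall x, R x *m al = al *m glued_jordan i j x,
      forall x, glued_jordan i j x *m be = be *m R x,
      e *m al = al, be *m e = be & be *m al \in unitmx]].
Proof.
move=> e0.
have eExe : e *m Ex *m e = e *m Ex by rewrite -mulmxA -eEx mulmxA ee.
have eEye : e *m Ey *m e = e *m Ey by rewrite -mulmxA -eEy mulmxA ee.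
have eExEx : e *m Ex *m Ex = e *m Ex by rewrite -mulmxA ExEx.
have eEyEy : e *m Ey *m Ey = e *m Ey by rewrite -mulmxA EyEy.
have [eZ0|eZ0] := eqVneq (e *m Z) 0.
  have [Ex0|Ex0] := eqVneq (e *m Ex) 0.
    have Ey0 : e *m Ey != 0.
      by apply: contraNneq e0 => Ey0; rewrite -[e]mulmx1 -E1 mulmxDr Ex0 Ey0 addr0.
    have [j [/andP[j0 jb] Yj Yj1]] := kill_exp Yb Ey0.
    have /rowV0Pn[u] : e *m Ey *m Y ^+ j.-1 != 0 by [].
    move=> /submxP[c uE] u0.
    have [|l [_ ul]] := @ex_separating_form _ n _ u 0; first by rewrite submx0.
    exists 0%N, j; split=> //.
    apply: (@glued_summand 0 j 0 (c *m (e *m Ey)) 0 l).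
    - by rewrite mul0mx.
    - by rewrite mul0mx.
    - by rewrite -mulmxA eEye.
    - by rewrite -mulmxA eEyEy.
    - by rewrite mul0mx.
    - by rewrite -mulmxA Yj mulmx0.
    - by [].
    - by rewrite mulmx0.
    - by rewrite Yj mul0mx.
    - by move=> _; rewrite eZ0 mul0mx.
    - by [].
    - by move=> _; rewrite -(mulmxA c) -uE ul.
  have [i [/andP[i0 ia] Xi Xi1]] := kill_exp Xa Ex0.
  have /rowV0Pn[u] : e *m Ex *m X ^+ i.-1 != 0 by [].
  move=> /submxP[c uE] u0.
  have [|l [_ ul]] := @ex_separating_form _ n _ u 0; first by rewrite submx0.
  exists i, 0%N; split; rewrite ?addn0 //.
  have := @glued_summand i 0 (c *m (e *m Ex)) 0 l 0; apply.
  - by rewrite -mulmxA eExe.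
  - by rewrite -mulmxA eExEx.
  - by rewrite mul0mx.
  - by rewrite mul0mx.
  - by rewrite -mulmxA Xi mulmx0.
  - by rewrite mul0mx.
  - by move=> _; rewrite -mulmxA -(mulmxA e) ExZ eZ0 mulmx0.
  - by rewrite Xi mul0mx.
  - by rewrite mulmx0.
  - by [].
  - by move=> _; rewrite -(mulmxA c) -uE ul.
  - by [].
pose Pi i := exists u : 'rV[k]_n, u *m (e *m Ex) *m X ^+ i = 0 /\ u *m (e *m Ex) *m Z != 0.
have Pa : Pi a.
  have /rowV0Pn[u /submxP[c uE] u0] := eZ0.
  by exists c; rewrite Xa mulmx0 -mulmxA -(mulmxA e) ExZ -uE.
have [i [[u0 [u0i u0Z]] min_i]] := ex_least Pa.
have i0 : (0 < i)%N.
  case: i u0i {min_i} => // u0i; rewrite -[u0 *m _]mulmx1 -[1%:M]/(X ^+ 0) u0i in u0Z.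
  by rewrite mul0mx eqxx in u0Z.
pose Qj j := exists2 v : 'rV[k]_n, [/\ v *m e = v, v *m Ex = v, v *m X ^+ i = 0 & v *m Z != 0]
  & (v *m Z <= e *m Ey *m Y ^+ j)%MS.
have Qj_bnd j : Qj j -> (j <= b)%N.
  case=> v [_ _ _ vZ0] vZ; rewrite leqNgt; apply/negP => bj.
  by move: vZ0; rewrite -submx0 (submx_trans vZ) // -(subnKC (ltnW bj)) exprD Yb mul0r mulmx0 sub0mx.
have Q0 : Qj 0%N.
  exists (u0 *m (e *m Ex)); first by split; rewrite // -mulmxA ?eExe ?eExEx.
  rewrite mulmx1; apply/submxP; exists (u0 *m (e *m Ex) *m Z).
  have u0e : u0 *m (e *m Ex) *m e = u0 *m (e *m Ex) by rewrite -mulmxA eExe.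
  move: (u0 *m _) u0e => v0 u0e.
  by rewrite mulmxA -(mulmxA _ Z) -eZ (mulmxA _ e) u0e -mulmxA ZEy.
have [j [[v [ve vx vXi vZ0] /submxP[c vZ]] max_j]] := ex_greatest Q0 Qj_bnd.
have [|lW [lWj vlW]] := @ex_separating_form _ _ _ (v *m Z) (e *m Ey *m Y ^+ j.+1).
  by apply/negP => vZj; suff /max_j : Qj j.+1; [rewrite ltnn | exists v].
have [|lV ZlV] := @ex_col_solution _ _ _ (e *m Ex *m X ^+ i.-1) (e *m Z *m lW).
  move=> u uX; rewrite mulmxA; suff -> : u *m (e *m Z) = 0 by rewrite mul0mx.
  apply/eqP; apply: contraT => uZ0.
  have : Pi i.-1.
    by exists u; split; [rewrite -mulmxA | rewrite -mulmxA -(mulmxA e) ExZ].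
  by move/min_i; rewrite -ltnS prednK // ltnn.
have jb : (j < b)%N.
  rewrite ltn_neqAle Qj_bnd ?andbT; last first.
    by exists v => //; rewrite vZ submxMl.
  apply: contraNneq vZ0 => jb; by rewrite vZ jb Yb !mulmx0.
exists i, j.+1; split; rewrite ?min_i ?addnS //.
have Xi1 : X ^+ i = X ^+ i.-1 *m X by rewrite -mx_expSr prednK.
have XeEx : e *m Ex *m X ^+ i = X *m (e *m Ex *m X ^+ i.-1).
  by rewrite !mulmxA XeE -(mulmxA _ X) -mx_expS prednK.
have vlW' : v *m (e *m Ex *m X ^+ i.-1) *m lV = 1%:M.
  by rewrite -mulmxA ZlV !mulmxA ve vlW.
apply: (@glued_summand i j.+1 v (c *m (e *m Ey)) lV lW) => //=.
- by rewrite -mulmxA eEye.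
- by rewrite -mulmxA eEyEy.
- rewrite -mulmxA mx_expSr (mulmxA _ (Y ^+ j)) mulmxA -vZ.
  by rewrite -mulmxA ZY mulmx0.
- by rewrite -mulmxA -vZ.
- by rewrite XeEx -mulmxA ZlV !mulmxA -eX -(mulmxA e) XZ mulmx0 mul0mx.
- by rewrite i0 ZlV.
- by move=> _; rewrite -vlW' !mulmxA ve vx.
- by move=> _; rewrite -(mulmxA c) -vZ.
Qed.

End Splitting.

(** The analogue of [sum_through] for the five operators: sums of endomorphisms
that factor through some [glued_jordan i j] with i <= a and j <= b. *)
Inductive glued_sum : 'M[k]_n -> Prop :=
| GluedSum0 : glued_sum 0
| GluedSumS i j (al : 'M_(n, i + j)) (be : 'M_(i + j, n)) M :
    (i <= a)%N -> (j <= b)%N ->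
    (forall x, R x *m al = al *m glued_jordan i j x) ->
    (forall x, glued_jordan i j x *m be = be *m R x) ->
    glued_sum M -> glued_sum (al *m be + M).

(** Split off one summand of the image of e and continue with the rest. *)
Lemma idem_glued_sum e : e *m e = e -> (forall x, e *m R x = R x *m e) -> glued_sum e.
Proof.
have [m] := ubnP (\rank e); elim: m e => // m IH e le_em ee eR.
have [->|e0] := eqVneq e 0; first exact: GluedSum0.
have [i [j [ia jb ij0 [al [be [alR beR eal bee U]]]]]] := ex_glued_summand ee eR e0.
pose al' := al *m invmx (be *m al).
have be1 : be *m al' = 1%:M by rewrite mulmxA mulmxV.
have alR' x : R x *m al' = al' *m glued_jordan i j x.
  have UR : be *m al *m glued_jordan i j x = glued_jordan i j x *m (be *m al).
    by rewrite -mulmxA -alR !mulmxA beR.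
  rewrite mulmxA alR -!mulmxA; congr (_ *m _).
  by rewrite -[LHS](mulKmx U) (mulmxA (be *m al)) UR -(mulmxA _ (be *m al)) mulmxV // mulmx1.
have eal' : e *m al' = al' by rewrite mulmxA eal.
clearbody al'.
have -> : e = al' *m be + (e - al' *m be) by rewrite addrC subrK.
set g := e - al' *m be.
have eg : e *m g = g by rewrite mulmxBr ee mulmxA eal'.
have beg : be *m g = 0 by rewrite mulmxBr bee mulmxA be1 mul1mx subrr.
have gg : g *m g = g by rewrite {1}/g mulmxBl eg -mulmxA beg mulmx0 subr0.
apply: GluedSumS => //; apply: IH => //.
- rewrite -ltnS (leq_trans _ le_em) // ltnS; apply: rank_ltmx; apply/andP; split.
    have -> : g = (1%:M - al' *m be) *m e by rewrite mulmxBl mul1mx -mulmxA bee.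
    exact: submxMl.
  apply/negP => /submxP[c ec].
  have be0 : be = 0 by rewrite -bee -(_ : g = e) // -eg {1}ec -mulmxA gg -ec.
  have /eqP : (1%:M : 'M[k]_(i + j)) = 0 by rewrite -be1 be0 mul0mx.
  by rewrite -mxrank_eq0 mxrank1 eqn0Ngt ij0.
- by move=> x; rewrite mulmxBl mulmxBr eR -!mulmxA -beR !mulmxA alR'.
Qed.

End GluedJordan.

(** * Sums over cosets *)

Section CosetSums.
Import GRing.Theory.
Local Open Scope ring_scope.
Variables (gT : finGroupType) (P : {group gT}).
Local Notation cosets := (rcosets P [set: gT]).

(** Right translation permutes the cosets P u. *)
Lemma coset_sum_translate (V : nmodType) (phi : gT -> V) (g : gT) :
  (forall s u, s \in P -> phi (s * u)%g = phi u) ->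
  \sum_(c in cosets) phi (repr c) = \sum_(c in cosets) phi (repr c * g)%g.
Proof.
move=> phiP.
rewrite (reindex_onto (fun c => c :* g)%g (fun c => c :* g^-1)%g) /=; last first.
  by move=> c _; rewrite -rcosetM mulVg rcoset1.
apply: eq_big => [c|c cP].
  rewrite -rcosetM mulgV rcoset1 eqxx andbT.
  apply/rcosetsP/rcosetsP => [[u _ cu]|[u _ cu]].
    by exists (u * g^-1)%g; rewrite ?inE // rcosetM -cu -rcosetM mulgV rcoset1.
  by exists (u * g)%g; rewrite ?inE // rcosetM -cu.
have /andP[/rcosetsP[u _ cgu] _] := cP.
have cE : c = (P :* (u * g^-1))%g by rewrite rcosetM -cgu -rcosetM mulgV rcoset1.
have /rcosetP[s sP ->] : repr (c :* g)%g \in (P :* u)%g by rewrite cgu mem_repr_rcoset.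
have /rcosetP[s' sP' ->] : repr c \in (P :* (u * g^-1))%g by rewrite cE mem_repr_rcoset.
by rewrite phiP // -!mulgA mulVg mulg1 phiP.
Qed.

(** Right translations permute the fibres of the map from cosets to B, so all
fibres have the same size and the average over cosets is the average over B. *)
Lemma coset_sum_average (k : fieldType) (V : lmodType k) (B : finType) (pi : gT -> B) (T : B -> V) :
  (forall s u, s \in P -> pi (s * u)%g = pi u) ->
  (forall b b', exists g, forall u, (pi (u * g)%g == b') = (pi u == b)) ->
  #|[set: gT] : P|%g%:R != 0 :> k ->
  (#|[set: gT] : P|%g%:R^-1 : k) *: \sum_(c in cosets) T (pi (repr c))
    = (#|B|%:R^-1 : k) *: \sum_b T b.
Proof.
move=> piP pi_trans idx0.
pose n b := (\sum_(c in cosets) (pi (repr c) == b))%N.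
have nE b b' : n b = n b'.
  have [g gE] := pi_trans b b'.
  rewrite [RHS](@coset_sum_translate _ (fun u => nat_of_bool (pi u == b')) g).
    by apply: eq_bigr => c _; rewrite gE.
  by move=> s u sP; rewrite piP.
have sumT : \sum_(c in cosets) T (pi (repr c)) = \sum_b T b *+ n b.
  rewrite (partition_big (fun c => pi (repr c)) xpredT) //=; apply: eq_bigr => b _.
  rewrite (eq_bigr (fun=> T b)) => [|c /andP[_ /eqP-> //]].
  rewrite /n -sumrMnr big_mkcondr; apply: eq_bigr => c _.
  by case: (_ == b).
have idxE : #|[set: gT] : P|%g = (\sum_b n b)%N.
  rewrite /n exchange_big /= /indexg -sum1_card; apply: eq_bigr => c _.
  by rewrite (bigD1 (pi (repr c))) //= eqxx big1 ?addn0 // => b; rewrite eq_sym => /negPf->.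
pose b0 := pi 1%g.
have idxE' : #|[set: gT] : P|%g = (#|B| * n b0)%N.
  by rewrite idxE (eq_bigr (fun=> n b0)) ?sum_nat_const // => b _; apply: nE.
rewrite sumT (eq_bigr (fun b => (n b0)%:R *: T b)) => [|b _]; last first.
  by rewrite (nE b b0) scaler_nat.
rewrite -scaler_sumr scalerA; congr (_ *: _).
move: idx0; rewrite idxE' natrM mulf_eq0 negb_or => /andP[B0 n0].
by rewrite invfM -mulrA mulVf ?mulr1.
Qed.

End CosetSums.

(** * Separability over the Sylow subalgebra *)

Section TwoObjects.
Import GRing.Theory.
Local Open Scope ring_scope.
Variables (k : fieldType) (C : finEICat) (x y : C).
Hypotheses (xy_neq : x <> y) (xy_all : forall z : C, z = x \/ z = y).
Hypotheses (hom_yx : #|cat_hom y x| = 0%N).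

Definition mor_basis (a b : C) (m : cat_hom a b) : cat_alg k C := cat_alg_basis k (Mor m).

Lemma mor_basisM a b c (g : @cat_hom C b c) (f : cat_hom a b) :
  mor_basis g * mor_basis f = mor_basis (cat_comp g f).
Proof. exact: cat_alg_basisM. Qed.

Lemma mor_basisM0 a b b' c (g : @cat_hom C b' c) (f : cat_hom a b) :
  b' <> b -> mor_basis g * mor_basis f = 0.
Proof. by move=> /eqP; apply: cat_alg_basisM0. Qed.

Lemma mor_cases (m : cat_mor C) :
  [\/ exists g : cat_hom x x, m = Mor g, exists h : cat_hom y y, m = Mor h
    | exists f : cat_hom x y, m = Mor f].
Proof.
case: m => [[a b] /= f].
case: (xy_all a) f => ->; case: (xy_all b) => -> f.
- by apply: Or31; exists f.
- by apply: Or33; exists f.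
- by have := card0_eq hom_yx f; rewrite inE.
- by apply: Or32; exists f.
Qed.

Lemma cat_alg_1E : (1 : cat_alg k C) = mor_basis (cat_id x) + mor_basis (cat_id y).
Proof.
rewrite -[LHS]/(\sum_(a : C) mor_basis (cat_id a)) (bigD1 x) //= (bigD1 y) /=; last first.
  by apply/eqP => yx; apply: xy_neq.
rewrite big1 ?addr0 // => a /andP[/eqP ax /eqP ay].
by case: (xy_all a).
Qed.

Lemma aut_mulE (a : C) (g h : cat_aut a) : (g * h)%g = cat_comp g h.
Proof. by []. Qed.

Lemma aut_mulVE (a : C) (g : cat_aut a) : cat_comp (g^-1)%g g = cat_id a.
Proof. by rewrite -aut_mulE mulVg. Qed.

Lemma aut_mulEV (a : C) (g : cat_aut a) : cat_comp g (g^-1)%g = cat_id a.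
Proof. by rewrite -aut_mulE mulgV. Qed.

Section Separability.
Hypotheses (G_trans : forall f f' : cat_hom x y, exists g : cat_aut x, cat_comp f g = f').
Hypotheses (H_trans : forall f f' : cat_hom x y, exists h : cat_aut y, cat_comp h f = f').
Variables (P : {group cat_aut x}) (R : {group cat_aut y}) (z : cat_hom x y).
Hypothesis P_fix : forall s : cat_aut x, s \in P -> forall f : cat_hom x y, cat_comp f s = f.
Hypothesis R_fix : forall s : cat_aut y, s \in R -> forall f : cat_hom x y, cat_comp s f = f.
Hypothesis P_index : #|[set: cat_aut x] : P|%g%:R != 0 :> k.
Hypothesis R_index : #|[set: cat_aut y] : R|%g%:R != 0 :> k.

(** The element with components sum g^-1 (x) g / [G : P] and
sum h^-1 (x) h / [H : R] of A (x) A, over coset representatives, paired with a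
bilinear map b. *)
Definition sep_sum (V : lmodType k) (b : cat_alg k C -> cat_alg k C -> V) : V :=
  #|[set: cat_aut x] : P|%g%:R^-1 *: (\sum_(c in rcosets P [set: cat_aut x])
     b (mor_basis (repr c)^-1%g) (mor_basis (repr c)))
  + #|[set: cat_aut y] : R|%g%:R^-1 *: (\sum_(c in rcosets R [set: cat_aut y])
     b (mor_basis (repr c)^-1%g) (mor_basis (repr c))).

Lemma sep_sum_mul : sep_sum (V := cat_alg k C) (fun q p => q * p) = 1.
Proof.
rewrite /sep_sum cat_alg_1E; congr (_ + _).
  rewrite (eq_bigr (fun=> mor_basis (cat_id x))) => [|c _]; last first.
    by rewrite mor_basisM aut_mulVE.
  by rewrite sumr_const -/(indexg _ _) -scaler_nat scalerA mulVf // scale1r.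
rewrite (eq_bigr (fun=> mor_basis (cat_id y))) => [|c _]; last first.
  by rewrite mor_basisM aut_mulVE.
by rewrite sumr_const -/(indexg _ _) -scaler_nat scalerA mulVf // scale1r.
Qed.

Lemma eq_sep_sum (V : lmodType k) (b b' : cat_alg k C -> cat_alg k C -> V) :
  (forall q p, b q p = b' q p) -> sep_sum b = sep_sum b'.
Proof. by move=> bb; rewrite /sep_sum; congr (_ *: _ + _ *: _); apply: eq_bigr. Qed.

Lemma sep_sum_linear (V W : lmodType k) (h : {linear V -> W}) b :
  h (sep_sum (V := V) b) = sep_sum (fun q p => h (b q p)).
Proof. by rewrite /sep_sum linearD !linearZ /= !linear_sum. Qed.

Lemma sep_sumP (V : lmodType k) c (b b' : cat_alg k C -> cat_alg k C -> V) :
  sep_sum (fun q p => c *: b q p + b' q p) = c *: sep_sum b + sep_sum b'.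
Proof.
rewrite /sep_sum !big_split /= -!scaler_sumr !scalerDr !scalerA.
by rewrite ![_ * c]mulrC -!scalerA addrACA.
Qed.

Variables (V : lmodType k) (b : cat_alg k C -> cat_alg k C -> V).
Hypotheses (b_linl : forall p, linear (b^~ p)) (b_linr : forall q, linear (b q)).
Hypothesis bP : forall q p (s : cat_aut x), s \in P -> b (q * mor_basis s) p = b q (mor_basis s * p).
Hypothesis bR : forall q p (s : cat_aut y), s \in R -> b (q * mor_basis s) p = b q (mor_basis s * p).
Hypothesis bz : forall q p, b (q * mor_basis z) p = b q (mor_basis z * p).

Let b0l p : b 0 p = 0.
Proof. by have := b_linl p (-1) 0 0; rewrite scaler0 addr0 scaleN1r addNr. Qed.
Let b0r q : b q 0 = 0.
Proof. by have := b_linr q (-1) 0 0; rewrite scaler0 addr0 scaleN1r addNr. Qed.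

Let sep_aut_x (g : cat_aut x) :
  \sum_(c in rcosets P [set: cat_aut x]) b (mor_basis (repr c)^-1%g) (mor_basis (repr c) * mor_basis g)
  = \sum_(c in rcosets P [set: cat_aut x]) b (mor_basis g * mor_basis (repr c)^-1%g) (mor_basis (repr c)).
Proof.
pose phi (u : cat_aut x) := b (mor_basis u^-1%g) (mor_basis (u * g)%g).
under eq_bigr do rewrite mor_basisM -aut_mulE -/(phi _).
rewrite (@coset_sum_translate _ P _ phi g^-1%g) => [|s u sP].
  by apply: eq_bigr => c _; rewrite /phi mulgKV invMg invgK mor_basisM.
by rewrite /phi invMg (aut_mulE u^-1%g) -mor_basisM bP ?groupV // mor_basisM -aut_mulE mulgA mulKg.
Qed.

Let sep_aut_y (g : cat_aut y) :
  \sum_(c in rcosets R [set: cat_aut y]) b (mor_basis (repr c)^-1%g) (mor_basis (repr c) * mor_basis g)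
  = \sum_(c in rcosets R [set: cat_aut y]) b (mor_basis g * mor_basis (repr c)^-1%g) (mor_basis (repr c)).
Proof.
pose phi (u : cat_aut y) := b (mor_basis u^-1%g) (mor_basis (u * g)%g).
under eq_bigr do rewrite mor_basisM -aut_mulE -/(phi _).
rewrite (@coset_sum_translate _ R _ phi g^-1%g) => [|s u sR].
  by apply: eq_bigr => c _; rewrite /phi mulgKV invMg invgK mor_basisM.
by rewrite /phi invMg (aut_mulE u^-1%g) -mor_basisM bR ?groupV // mor_basisM -aut_mulE mulgA mulKg.
Qed.

(** For hf = zg, the terms b(h^-1, hf) and b(f g^-1, g) agree because z can be
moved across b.  Both sides are therefore averages of one function on C(x,y). *)
Let sep_hom (f : cat_hom x y) :
  #|[set: cat_aut y] : R|%g%:R^-1 *: (\sum_(c in rcosets R [set: cat_aut y])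
     b (mor_basis (repr c)^-1%g) (mor_basis (repr c) * mor_basis f))
  = #|[set: cat_aut x] : P|%g%:R^-1 *: (\sum_(c in rcosets P [set: cat_aut x])
     b (mor_basis f * mor_basis (repr c)^-1%g) (mor_basis (repr c))).
Proof.
have exg f' : exists g : cat_aut x, cat_comp z g == f'.
  by have [g <-] := G_trans z f'; exists g.
pose T f' := b (mor_basis (cat_comp f ((xchoose (exg f'))^-1)%g)) (mor_basis (xchoose (exg f'))).
(* T f' does not depend on the choice of g with zg = f'. *)
have bfg (h : cat_aut y) (g : cat_aut x) : cat_comp h f = cat_comp z g ->
    b (mor_basis h^-1%g) (mor_basis (cat_comp h f)) = b (mor_basis (cat_comp f g^-1%g)) (mor_basis g).
  move=> hfg; rewrite hfg -mor_basisM -bz mor_basisM; congr (b (mor_basis _) _).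
  have -> : f = cat_comp (h^-1)%g (cat_comp h f) by rewrite cat_compA aut_mulVE cat_comp1m.
  by rewrite hfg -!cat_compA aut_mulEV cat_compm1.
have TE (g : cat_aut x) : b (mor_basis (cat_comp f g^-1%g)) (mor_basis g) = T (cat_comp z g).
  have [h hf] := H_trans f (cat_comp z g).
  rewrite -(bfg h g) //; apply: bfg.
  by rewrite (eqP (xchooseP (exg _))).
have TE' (h : cat_aut y) : b (mor_basis h^-1%g) (mor_basis (cat_comp h f)) = T (cat_comp h f).
  have [g gf] := G_trans z (cat_comp h f).
  by rewrite (bfg h g) // TE gf.
under eq_bigr do rewrite mor_basisM TE'.
under [in RHS]eq_bigr do rewrite mor_basisM TE.
rewrite (@coset_sum_average _ R k V _ (fun h => cat_comp h f) T) //; last 2 first.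
- by move=> s u sR; rewrite aut_mulE -cat_compA R_fix.
- move=> f1 f2; have [g gf] := G_trans f1 f2; have [h hf] := H_trans f (cat_comp f g).
  exists h => u; rewrite aut_mulE -cat_compA hf cat_compA.
  apply/eqP/eqP => [ufg|->//].
  have /(congr1 (cat_comp^~ (g^-1)%g)) := ufg.
  by rewrite -gf -!cat_compA aut_mulEV !cat_compm1.
rewrite (@coset_sum_average _ P k V _ (fun g => cat_comp z g) T) //.
- by move=> s u sP; rewrite (aut_mulE s u) cat_compA (P_fix sP).
- move=> f1 f2; have [g gf] := G_trans f1 f2.
  exists g => u; rewrite aut_mulE cat_compA; apply/eqP/eqP => [ufg|->//].
  have /(congr1 (cat_comp^~ (g^-1)%g)) := ufg.
  by rewrite -gf -!cat_compA aut_mulEV !cat_compm1.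
Qed.

(** The separability element commutes with A, once tensors are taken over the
subalgebra generated by P, R and z.  The only substantial case is that of a
morphism from x to y. *)
Lemma sep_sum_central a : sep_sum (fun q p => b q (p * a)) = sep_sum (fun q p => b (a * q) p).
Proof.
have [L LE] : exists L : {linear cat_alg k C -> V}, forall a, L a = sep_sum (fun q p => b q (p * a)).
  apply: (@ex_linear k (cat_alg k C) V) => c u v; rewrite -sep_sumP; apply: eq_sep_sum => q p.
  by rewrite mulrDr -cat_alg_scaleAr b_linr.
have [M ME] : exists M : {linear cat_alg k C -> V}, forall a, M a = sep_sum (fun q p => b (a * q) p).
  apply: (@ex_linear k (cat_alg k C) V) => c u v; rewrite -sep_sumP; apply: eq_sep_sum => q p.
  by rewrite mulrDl -cat_alg_scaleAl b_linl.
rewrite -LE -ME; apply: cat_alg_ind => m; rewrite LE ME /sep_sum.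
have yx : y <> x by move=> yx; apply: xy_neq.
case: (mor_cases m) => -[g ->]; rewrite -/(mor_basis g).
- congr (_ *: _ + _); first exact: sep_aut_x.
  rewrite !big1 // => c _; first by rewrite mor_basisM0 // b0l.
  by rewrite mor_basisM0 // b0r.
- congr (_ + _ *: _); last exact: sep_aut_y.
  rewrite !big1 // => c _; first by rewrite mor_basisM0 // b0l.
  by rewrite mor_basisM0 // b0r.
rewrite sep_hom addrC; congr (_ + _).
rewrite !big1 ?scaler0 // => c _; first by rewrite mor_basisM0 // b0l.
by rewrite mor_basisM0 // b0r.
Qed.

End Separability.
End TwoObjects.

(** * Finite type when the Sylow subgroups act trivially *)

Section Unipotent.
Import GRing.Theory.
Local Open Scope ring_scope.

(** Frobenius in k[X]: (X - 1)^c = X^c - 1 when c is a power of the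
characteristic. *)
Lemma unipotent_sub1_nilpotent (k : fieldType) n (U : 'M[k]_n) c :
  [pchar k].-nat c -> U ^+ c = 1 -> (U - 1) ^+ c = 0.
Proof.
case: n U => [|n] U pc Uc; first by apply/matrixP => [[]].
have pc' : [pchar {poly k}].-nat c.
  by apply: sub_in_pnat pc => p _; rewrite pchar_poly.
have Xc : ('X - 1) ^+ c = 'X^c - 1 :> {poly k}.
  have := exprDn_pchar ('X - 1 : {poly k}) 1 pc'.
  by rewrite subrK expr1n => ->; rewrite addrK.
have := congr1 (horner_mx U) Xc.
by rewrite !rmorphXn !rmorphB /= rmorphXn /= !rmorph1 /= horner_mx_X Uc subrr.
Qed.

Lemma In_map (T : Type) (I : eqType) (f : I -> T) (s : seq I) x : x \in s -> List.In (f x) (map f s).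
Proof.
by elim: s => //= x' s IH; rewrite inE => /orP[/eqP->|/IH]; [left|right].
Qed.

Lemma In_flatten (T : Type) (s : seq T) (ss : seq (seq T)) x :
  List.In s ss -> List.In x s -> List.In x (flatten ss).
Proof.
elim: ss => //= s' ss IH [->|/IH xss] xs; apply: List.in_or_app; first by left.
by right; apply: xss.
Qed.

End Unipotent.

Section FiniteType.
Import GRing.Theory.
Local Open Scope ring_scope.
Variables (k : fieldType) (C : finEICat) (x y : C).
Hypotheses (xy_neq : x <> y) (xy_all : forall z : C, z = x \/ z = y).
Hypotheses (hom_yx : #|cat_hom y x| = 0%N).
Hypotheses (G_trans : forall f f' : cat_hom x y, exists g : cat_aut x, cat_comp f g = f').
Hypotheses (H_trans : forall f f' : cat_hom x y, exists h : cat_aut y, cat_comp h f = f').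
Variables (sg : cat_aut x) (tu : cat_aut y) (z : cat_hom x y).
Hypothesis sg_fix : forall f : cat_hom x y, cat_comp f sg = f.
Hypothesis tu_fix : forall f : cat_hom x y, cat_comp tu f = f.
Hypothesis sg_index : #|[set: cat_aut x] : <[sg]>|%g%:R != 0 :> k.
Hypothesis tu_index : #|[set: cat_aut y] : <[tu]>|%g%:R != 0 :> k.
Hypotheses (sg_nat : [pchar k].-nat #[sg]%g) (tu_nat : [pchar k].-nat #[tu]%g).

Local Notation A := (cat_alg k C).
Local Notation B := (@mor_basis k C _ _).

Let ex : A := B (cat_id x).
Let ey : A := B (cat_id y).

Definition glue_gens (i : 'I_5) : A :=
  nth 0 [:: ex; ey; B sg - ex; B tu - ey; B z] i.

Definition glued_coind (i j : nat) : lmodType A := coind glue_gens (glued_jordan k i j).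

Let yx_neq : y <> x. Proof. by move=> yx; apply: xy_neq. Qed.

Section Module.
Variables (N : lmodType A) (n : nat) (t : {linear scal_restr (@cat_scal k C) N -> 'rV[k]_n}).
Variables (rho : A -> 'M[k]_n).
Hypothesis bt : bijective t.
Hypothesis rhoE : forall a (m : N), t (a *: m) = t m *m rho a.

Let rho_eq a b : (forall m : N, t (a *: m) = t m *m b) -> rho a = b.
Proof.
by case: bt => s tK sK ab; apply: eq_mx_rV => u; rewrite -[u]sK -rhoE ab.
Qed.

Let tD (m m' : N) : t (m + m') = t m + t m'. Proof. exact: linearD. Qed.
Let tN (m : N) : t (- m) = - t m. Proof. exact: (linearN t). Qed.
Let t0 : t (0 : N) = 0. Proof. exact: (linear0 t). Qed.

Let rhoM a b : rho (a * b) = rho b *m rho a.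
Proof. by apply: rho_eq => m; rewrite -scalerA !rhoE mulmxA. Qed.
Let rhoD a b : rho (a + b) = rho a + rho b.
Proof. by apply: rho_eq => m; rewrite scalerDl tD !rhoE mulmxDr. Qed.
Let rhoN a : rho (- a) = - rho a.
Proof. by apply: rho_eq => m; rewrite scaleNr tN rhoE mulmxN. Qed.
Let rho0 : rho 0 = 0.
Proof. by apply: rho_eq => m; rewrite scale0r t0 mulmx0. Qed.
Let rho1 : rho 1 = 1%:M.
Proof. by apply: rho_eq => m; rewrite scale1r mulmx1. Qed.

Let rho_mul0 a b : a * b = 0 -> rho b *m rho a = 0.
Proof. by rewrite -rhoM => ->. Qed.
Let rho_mul a b c : a * b = c -> rho b *m rho a = rho c.
Proof. by rewrite -rhoM => ->. Qed.

Let exx : ex * ex = ex. Proof. by rewrite /ex mor_basisM cat_comp1m. Qed.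
Let eyy : ey * ey = ey. Proof. by rewrite /ey mor_basisM cat_comp1m. Qed.
Let exy : ex * ey = 0. Proof. by rewrite /ex /ey mor_basisM0. Qed.
Let eyx : ey * ex = 0. Proof. by rewrite /ex /ey mor_basisM0. Qed.
Let exsg : ex * B sg = B sg. Proof. by rewrite mor_basisM cat_comp1m. Qed.
Let sgex : B sg * ex = B sg. Proof. by rewrite mor_basisM cat_compm1. Qed.
Let eytu : ey * B tu = B tu. Proof. by rewrite mor_basisM cat_comp1m. Qed.
Let tuey : B tu * ey = B tu. Proof. by rewrite mor_basisM cat_compm1. Qed.
Let zex : B z * ex = B z. Proof. by rewrite mor_basisM cat_compm1. Qed.
Let eyz : ey * B z = B z. Proof. by rewrite mor_basisM cat_comp1m. Qed.
Let zsg : B z * B sg = B z. Proof. by rewrite mor_basisM sg_fix. Qed.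
Let tuz : B tu * B z = B z. Proof. by rewrite mor_basisM tu_fix. Qed.

Let rho_unipotent (a : C) (g : cat_aut a) (E E' : 'M[k]_n) : E = rho (B (cat_id a)) ->
  E + E' = 1%:M -> E *m E' = 0 -> E' *m E = 0 ->
  [pchar k].-nat #[g]%g -> (rho (B g) - E) ^+ #[g]%g = 0.
Proof.
move=> EE E1 EE' E'E gnat.
have E'E' : E' *m E' = E' by rewrite -[RHS]mulmx1 -E1 mulmxDr E'E add0r.
have gE : rho (B g) *m E = rho (B g) by rewrite EE -rhoM mor_basisM cat_comp1m.
have Eg i : E *m rho (B (g ^+ i)%g) = rho (B (g ^+ i)%g).
  by rewrite EE -rhoM mor_basisM cat_compm1.
(* Adding the identity on the other object makes the operator unipotent. *)
have -> : rho (B g) - E = rho (B g) + E' - 1.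
  by rewrite -[1]/(1%:M) -E1 opprD addrACA subrr addr0.
apply: unipotent_sub1_nilpotent => //.
have pow i : (rho (B g) + E') ^+ i = rho (B (g ^+ i)%g) + E'.
  elim: i => [|i IH]; first by rewrite expr0 expg0 -EE E1.
  rewrite exprS IH -[_ * _]/(_ *m _) mulmxDl !mulmxDr E'E'.
  have -> : rho (B g) *m E' = 0 by rewrite -gE -mulmxA EE' mulmx0.
  have -> : E' *m rho (B (g ^+ i)%g) = 0 by rewrite -Eg mulmxA E'E mul0mx.
  by rewrite addr0 add0r -rhoM mor_basisM expgSr.
by rewrite pow expg_order -EE E1.
Qed.

Lemma rho_glued_sum : glued_sum (rho ex) (rho ey) (rho (B sg - ex)) (rho (B tu - ey)) (rho (B z))
  #[sg]%g #[tu]%g 1%:M.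
Proof.
have E1 : rho ex + rho ey = 1%:M by rewrite -rhoD -rho1 (cat_alg_1E k xy_neq xy_all).
apply: idem_glued_sum; rewrite ?mulmx1 //.
- exact: rho_mul0.
- exact: rho_mul0.
- by apply: rho_mul; rewrite mulrBl sgex exx.
- by apply: rho_mul; rewrite mulrBr exsg exx.
- by apply: rho_mul; rewrite mulrBl tuey eyy.
- by apply: rho_mul; rewrite mulrBr eytu eyy.
- exact: rho_mul.
- exact: rho_mul.
- by apply: rho_mul0; rewrite mulrBr zsg zex subrr.
- by apply: rho_mul0; rewrite mulrBl tuz eyz subrr.
- rewrite rhoD rhoN; apply: (rho_unipotent (E' := rho ey)) => //; exact: rho_mul0.
- rewrite rhoD rhoN; apply: (rho_unipotent (E' := rho ex)) => //; try exact: rho_mul0.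
  by rewrite addrC.
- by move=> i; rewrite mul1mx mulmx1.
Qed.

Variable s : {linear 'rV[k]_n -> scal_restr (@cat_scal k C) N}.
Hypotheses (tK : cancel t s) (sK : cancel s t).
Local Notation N_k := (scal_restr (@cat_scal k C) N).
Local Notation sep := (@sep_sum k C x y <[sg]>%G <[tu]>%G).

Definition act_vec (a : A) (u : 'rV[k]_n) : N_k := a *: (s u : N).

Let sact a (u : 'rV[k]_n) : act_vec a u = s (u *m rho a).
Proof. by apply: (can_inj tK); rewrite rhoE !sK. Qed.
Let act_vecM a b u : act_vec (a * b) u = act_vec a (u *m rho b).
Proof. by rewrite /act_vec -scalerA -[b *: _]/(act_vec b u) sact. Qed.
Let act_vecDl a b u : act_vec (a + b) u = act_vec a u + act_vec b u.
Proof. by rewrite /act_vec scalerDl. Qed.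
Let act_vecDr a u v : act_vec a (u + v) = act_vec a u + act_vec a v.
Proof. by rewrite /act_vec linearD scalerDr. Qed.
Let act_vecZl a c u : act_vec (c *: a) u = c *: act_vec a u.
Proof. by rewrite scal_restr_scaleE /act_vec scalerA cat_scalM. Qed.
Let act_vecZr a c u : act_vec a (c *: u) = c *: act_vec a u.
Proof. by rewrite scal_restr_scaleE /act_vec linearZ /= scal_restr_scaleE !scalerA cat_scal_central. Qed.

Lemma sep_sum_act (b : A -> A -> N_k) (a : A) :
  a *: (sep b : N) = sep (fun q p => a *: (b q p : N) : N_k).
Proof.
have [h hE] := scal_restr_act (@cat_scal_central k C) N a.
rewrite -hE sep_sum_linear.
by apply: (eq_sep_sum _ _ (V := N_k)) => q p; rewrite hE.
Qed.

(** An A1-linear map out of N induces an A-linear one into the coinduced module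
(Frobenius reciprocity). *)
Lemma coind_to i j (al : 'M[k]_(n, i + j)) :
  (forall l, quintuple (rho ex) (rho ey) (rho (B sg - ex)) (rho (B tu - ey)) (rho (B z)) l *m al
    = al *m glued_jordan k i j l) ->
  exists f : {linear N -> glued_coind i j}, forall (m : N) a, coind_ev a (f m) = t (a *: m) *m al.
Proof.
move=> alP.
have exF (m : N) : exists F : glued_coind i j, forall a, coind_ev a F = t (a *: m) *m al.
  apply: coind_ex => [c a b|l a].
    rewrite scalerDl tD -cat_scalM -scalerA mulmxDl; congr (_ + _).
    by rewrite -scal_restr_scaleE linearZ scalemxAl.
  rewrite -[LHS]/(t ((glue_gens l * a) *: m) *m al) -scalerA rhoE -!mulmxA -alP; congr (_ *m (_ *m _)).
  by case: l => [[|[|[|[|[|//]]]]] ?].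
pose f m := epsilon (inhabits 0) (fun F : glued_coind i j => forall a, coind_ev a F = t (a *: m) *m al).
have fE m : forall a, coind_ev a (f m) = t (a *: m) *m al.
  exact: (epsilon_spec (inhabits 0) _ (exF m)).
have /ex_linear[g gE] : linear f.
  move=> a m m'; apply: coind_ev_inj => q.
  by rewrite coind_evD coind_ev_act !fE scalerDr scalerA tD mulmxDl.
by exists g => m a; rewrite gE fE.
Qed.

(** In the other direction the A1-linear map is averaged with the separability
element, whose centrality is what makes the average A-linear. *)
Lemma coind_from i j (be : 'M[k]_(i + j, n)) :
  (forall l, glued_jordan k i j l *m be
    = be *m quintuple (rho ex) (rho ey) (rho (B sg - ex)) (rho (B tu - ey)) (rho (B z)) l) ->
  exists f : {linear glued_coind i j -> N}, forall F,
    f F = sep (fun q p => act_vec q (coind_ev p F *m be)).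
Proof.
move=> beP.
have balanced l (F : glued_coind i j) q p : act_vec (q * glue_gens l) (coind_ev p F *m be)
    = act_vec q (coind_ev (glue_gens l * p) F *m be).
  rewrite act_vecM coind_ev_equiv -!mulmxA beP; congr (act_vec _ (_ *m (_ *m _))).
  by case: l => [[|[|[|[|[|//]]]]] ?].
apply: ex_linear => a F F'.
have -> : sep (fun q p => act_vec q (coind_ev p (a *: F + F') *m be))
  = sep (fun q p => (1 : k) *: act_vec q (coind_ev (p * a) F *m be) + act_vec q (coind_ev p F' *m be)).
  apply: (eq_sep_sum _ _ (V := N_k)) => q p.
  by rewrite scale1r coind_evD coind_ev_act mulmxDl act_vecDr.
rewrite sep_sumP scale1r; congr (_ + _).
pose b (F : glued_coind i j) q p : N_k := act_vec q (coind_ev p F *m be).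
rewrite sep_sum_act -[LHS]/(sep (fun q p => b F q (p * a))).
have bal l q p : b F (q * glue_gens l) p = b F q (glue_gens l * p) by apply: balanced.
have bDl q q' p : b F (q + q') p = b F q p + b F q' p by apply: act_vecDl.
have bDr q p p' : b F q (p + p') = b F q p + b F q p'.
  by rewrite /b coind_evDl mulmxDl act_vecDr.
have bal_ex q p : b F (q * ex) p = b F q (ex * p) := bal (@Ordinal 5 0 isT) q p.
have bal_ey q p : b F (q * ey) p = b F q (ey * p) := bal (@Ordinal 5 1 isT) q p.
have bal_sg q p : b F (q * B sg) p = b F q (B sg * p).
  have := bal (@Ordinal 5 2 isT) q p; rewrite /= -/ex => e.
  by rewrite -[B sg](subrK ex) mulrDr mulrDl bDl bDr bal_ex e.
have bal_tu q p : b F (q * B tu) p = b F q (B tu * p).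
  have := bal (@Ordinal 5 3 isT) q p; rewrite /= -/ey => e.
  by rewrite -[B tu](subrK ey) mulrDr mulrDl bDl bDr bal_ey e.
have bal_cycle (o : C) (g : cat_aut o) :
    (forall q p, b F (q * B (cat_id o)) p = b F q (B (cat_id o) * p)) ->
    (forall q p, b F (q * B g) p = b F q (B g * p)) ->
    forall q p u, u \in <[g]>%g -> b F (q * B u) p = b F q (B u * p).
  move=> bal1 balg q p _ /cycleP[r ->]; elim: r q => [|r IH] q; first exact: bal1.
  by rewrite expgS -[B _]/(B (cat_comp g (g ^+ r)%g)) -mor_basisM mulrA IH balg mulrA.
rewrite (sep_sum_central xy_neq xy_all hom_yx G_trans H_trans (z := z)) //.
- by apply: (eq_sep_sum _ _ (V := N_k)) => q p; rewrite /b /act_vec scalerA.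
- move=> u /cycleP[r ->] f; elim: r => [|r IH]; first exact: cat_compm1.
  by rewrite expgS aut_mulE cat_compA sg_fix.
- move=> u /cycleP[r ->] f; elim: r => [|r IH]; first exact: cat_comp1m.
  by rewrite expgS aut_mulE -cat_compA IH tu_fix.
- move=> p c q q'; rewrite bDl; congr (_ + _).
  exact: act_vecZl.
- move=> q c p p'; rewrite bDr; congr (_ + _).
  by rewrite /b coind_evZl -scalemxAl act_vecZr.
- by move=> q p u; apply: bal_cycle.
- by move=> q p u; apply: bal_cycle.
- exact: (bal (@Ordinal 5 4 isT)).
Qed.

Definition glued_coinds : seq (lmodType A) :=
  flatten [seq [seq glued_coind i j | j <- iota 0 #[tu]%g.+1] | i <- iota 0 #[sg]%g.+1].

(** Averaging the decomposition of the identity of N over A1 gives one over A,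
and the average of the identity is the identity. *)
Lemma sum_through_glued_coinds : sum_through (fun T => List.In T glued_coinds) (id : N -> N).
Proof.
pose tr M (m : N) : N := sep (fun q p => act_vec q (t (p *: m) *m M)).
suff trP M : glued_sum (rho ex) (rho ey) (rho (B sg - ex)) (rho (B tu - ey)) (rho (B z))
    #[sg]%g #[tu]%g M -> sum_through (fun T => List.In T glued_coinds) (tr M).
  have := trP _ rho_glued_sum.
  have tr1 m : tr 1%:M m = m.
    rewrite -[RHS]scale1r -(sep_sum_mul xy_neq xy_all sg_index tu_index).
    have /ex_linear[h hE] : linear (fun a : A => a *: m : N_k).
      by move=> c a b; rewrite scalerDl -cat_scalM -scalerA.
    rewrite -hE sep_sum_linear; apply: (eq_sep_sum _ _ (V := N_k)) => q p.
    by rewrite hE mulmx1 /act_vec tK scalerA.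
  by move=> H; apply: (sum_through_add H (SumThrough0 _ (f := fun=> 0) _)) => // m; rewrite tr1 addr0.
elim=> [|i j al be M' ia jb alP beP _ IH].
  apply: SumThrough0 => m; rewrite /tr.
  rewrite (@eq_sep_sum _ _ _ _ _ _ N_k _ (fun _ _ => 0)) => [|q p]; last by rewrite mulmx0 /act_vec linear0 scaler0.
  by rewrite /sep_sum !big1 ?scaler0 ?addr0.
have [f fE] := coind_to alP; have [g gE] := coind_from beP.
apply: (SumThroughS (a := f) (b := g) _ IH) => [|m].
  apply: (In_flatten (s := [seq glued_coind i j | j <- iota 0 #[tu]%g.+1])).
    by apply: (In_map (fun i => [seq glued_coind i j | j <- iota 0 #[tu]%g.+1])); rewrite mem_iota.
  by apply: (In_map (glued_coind i)); rewrite mem_iota.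
pose b1 q p : N_k := act_vec q (coind_ev p (f m) *m be).
pose b2 q p : N_k := act_vec q (t (p *: m) *m M').
transitivity (sep (fun q p => 1 *: b1 q p + b2 q p)); last by rewrite sep_sumP scale1r gE.
apply: (eq_sep_sum _ _ (V := N_k)) => q p.
by rewrite scale1r /b1 /b2 fE mulmxDr act_vecDr mulmxA.
Qed.

End Module.

Theorem finite_rep_type_of_trivial_action : finite_rep_type A.
Proof.
apply: (finite_rep_type_criterion (@cat_scal_central k C) (@cat_alg_span k C) (Ts := glued_coinds)).
  move=> T; have : forall ss : seq (seq (lmodType A)),
      (forall s, List.In s ss -> forall T, List.In T s -> fin_dim (scal_restr (@cat_scal k C) T)) ->
      List.In T (flatten ss) -> fin_dim (scal_restr (@cat_scal k C) T).
    elim=> //= s' ss IH fds /(@List.in_app_or _ _ _ _)[Ts|]; first by apply: fds Ts; left.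
    by apply: IH => s ss' T'; apply: fds; right.
  apply=> s; elim: (iota 0 #[sg]%g.+1) => [//|i I IH] [<- {}T|/IH //].
  elim: (iota 0 #[tu]%g.+1) => [//|j J IHJ] [<-|/IHJ //].
  exact: coind_fin_dim.
move=> N [n [t bt]] _.
have [s tK sK] := linear_inverse bt.
have ex_rho a : exists M : 'M_n, forall m : N, t (a *: m) = t m *m M.
  have [h hE] := scal_restr_act (@cat_scal_central k C) N a.
  by have [M ME] := matrix_of_linear t h bt; exists M => m; rewrite -ME hE.
pose rho a := epsilon (inhabits 0) (fun M : 'M_n => forall m : N, t (a *: m) = t m *m M).
apply: (@sum_through_glued_coinds N n t rho bt _ s) => // a.
exact: (epsilon_spec (inhabits 0) _ (ex_rho a)).
Qed.

End FiniteType.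

(** * Four lines in a plane *)

Section FourLines.
Import GRing.Theory.
Local Open Scope ring_scope.
Variable k : fieldType.

(** The module of four lines has the basis v, a1, a2, b1, b2, c of its part at x
and w, d1, d2, e1, e2, g of its part at y, numbered from 0 to 11.  The planes
spanned by the a_i, b_i, d_i and e_i are identified.  The four lines in this
plane are spanned by its first basis vector, the image of v, and by its second,
the image of w, and are the kernels of the maps to c and to g, which send a
vector with coordinates (s, t) to (s - t) c and to (l s - t) g. *)
Definition vec12 (s : seq k) : 'rV[k]_12 := \row_j s`_j.
Definition coor (u : 'rV[k]_12) (i : nat) : k := u 0 (inord i).

Lemma coor_vec12 s i : (i < 12)%N -> coor (vec12 s) i = s`_i.
Proof. by move=> i12; rewrite /coor mxE inordK. Qed.

Lemma eq_vec12 u v : (forall i, (i < 12)%N -> coor u i = coor v i) -> u = v.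
Proof. by move=> uv; apply/rowP => j; have := uv j (ltn_ord j); rewrite /coor inord_val. Qed.

Lemma coorD u v i : coor (u + v) i = coor u i + coor v i. Proof. by rewrite /coor mxE. Qed.
Lemma coorN u i : coor (- u) i = - coor u i. Proof. by rewrite /coor mxE. Qed.
Lemma coorZ c u i : coor (c *: u) i = c * coor u i. Proof. by rewrite /coor mxE. Qed.
Lemma coor0 i : coor 0 i = 0. Proof. by rewrite /coor mxE. Qed.

Variable l : k.

Definition x_seq u := [:: coor u 0; coor u 1; coor u 2; coor u 3; coor u 4; coor u 5; 0; 0; 0; 0; 0; 0].
Definition y_seq u := [:: 0; 0; 0; 0; 0; 0; coor u 6; coor u 7; coor u 8; coor u 9; coor u 10; coor u 11].
Definition nil_seq u := [:: 0; coor u 0; 0; coor u 1; coor u 2; coor u 3 - coor u 4;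
  0; 0; coor u 6; coor u 7; coor u 8; l * coor u 9 - coor u 10].
Definition map_seq u := [:: 0; 0; 0; 0; 0; 0; 0; coor u 0; 0; coor u 1; coor u 2; l * coor u 3 - coor u 4].

Definition proj_x u := vec12 (x_seq u).
Definition proj_y u := vec12 (y_seq u).
Definition nil_op u := vec12 (nil_seq u).
Definition map_op u := vec12 (map_seq u).

Lemma coor_proj_x u i : (i < 12)%N -> coor (proj_x u) i = nth 0 (x_seq u) i. Proof. exact: coor_vec12. Qed.
Lemma coor_proj_y u i : (i < 12)%N -> coor (proj_y u) i = nth 0 (y_seq u) i. Proof. exact: coor_vec12. Qed.
Lemma coor_nil_op u i : (i < 12)%N -> coor (nil_op u) i = nth 0 (nil_seq u) i. Proof. exact: coor_vec12. Qed.
Lemma coor_map_op u i : (i < 12)%N -> coor (map_op u) i = nth 0 (map_seq u) i. Proof. exact: coor_vec12. Qed.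

Ltac expand1 lem s u i :=
  rewrite (lem u i isT);
  let v := eval cbv beta iota delta [nth x_seq y_seq nil_seq map_seq] in (nth 0 (s u) i) in
  change (nth 0 (s u) i) with v.
Ltac expand_co := repeat (rewrite ?(coorD, coorN, coorZ, coor0); match goal with
  | |- context [coor (proj_x ?u) ?i] => expand1 coor_proj_x x_seq u i
  | |- context [coor (proj_y ?u) ?i] => expand1 coor_proj_y y_seq u i
  | |- context [coor (nil_op ?u) ?i] => expand1 coor_nil_op nil_seq u i
  | |- context [coor (map_op ?u) ?i] => expand1 coor_map_op map_seq u i
  end); rewrite ?(coorD, coorN, coorZ, coor0).
Ltac coords := apply: eq_vec12; do 12!(case=> [_|]; first by (expand_co; ring)); by [].

Fact proj_x_linear : linear proj_x. Proof. move=> c u v; coords. Qed.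
Fact proj_y_linear : linear proj_y. Proof. move=> c u v; coords. Qed.
Fact nil_op_linear : linear nil_op. Proof. move=> c u v; coords. Qed.
Fact map_op_linear : linear map_op. Proof. move=> c u v; coords. Qed.
HB.instance Definition _ := GRing.isLinear.Build k 'rV[k]_12 'rV[k]_12 *:%R proj_x proj_x_linear.
HB.instance Definition _ := GRing.isLinear.Build k 'rV[k]_12 'rV[k]_12 *:%R proj_y proj_y_linear.
HB.instance Definition _ := GRing.isLinear.Build k 'rV[k]_12 'rV[k]_12 *:%R nil_op nil_op_linear.
HB.instance Definition _ := GRing.isLinear.Build k 'rV[k]_12 'rV[k]_12 *:%R map_op map_op_linear.

Definition Ex12 := lin1_mx proj_x.
Definition Ey12 := lin1_mx proj_y.
Definition N12 := lin1_mx nil_op.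
Definition F12 := lin1_mx map_op.

Lemma Ex12E u : u *m Ex12 = proj_x u. Proof. exact: mul_rV_lin1. Qed.
Lemma Ey12E u : u *m Ey12 = proj_y u. Proof. exact: mul_rV_lin1. Qed.
Lemma N12E u : u *m N12 = nil_op u. Proof. exact: mul_rV_lin1. Qed.
Lemma F12E u : u *m F12 = map_op u. Proof. exact: mul_rV_lin1. Qed.
Definition mx12E := (Ex12E, Ey12E, N12E, F12E).

Ltac mcoords := apply: eq_mx_rV => u; rewrite ?mulmxDr ?mulmx1 ?mulmx0 ?mulmxA ?mx12E; coords.

Lemma E12_sum : Ex12 + Ey12 = 1%:M. Proof. mcoords. Qed.
Lemma Exy12 : Ex12 *m Ey12 = 0. Proof. mcoords. Qed.
Lemma Eyx12 : Ey12 *m Ex12 = 0. Proof. mcoords. Qed.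
Lemma Exx12 : Ex12 *m Ex12 = Ex12. Proof. mcoords. Qed.
Lemma Eyy12 : Ey12 *m Ey12 = Ey12. Proof. mcoords. Qed.
Lemma ExN12 : Ex12 *m N12 = N12 *m Ex12. Proof. mcoords. Qed.
Lemma EyN12 : Ey12 *m N12 = N12 *m Ey12. Proof. mcoords. Qed.
Lemma ExF12 : Ex12 *m F12 = F12. Proof. mcoords. Qed.
Lemma FEy12 : F12 *m Ey12 = F12. Proof. mcoords. Qed.
Lemma NF12 : N12 *m F12 = F12 *m N12. Proof. mcoords. Qed.
Lemma N12_nilpotent : N12 *m N12 *m N12 *m N12 = 0. Proof. mcoords. Qed.

Local Notation X := (N12 *m Ex12).
Local Notation Y := (N12 *m Ey12).

(** The hypotheses say that (v, a, w) lies in the kernel of the pencil at m.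
Comparing a few coordinates gives v_0 = a_2 - a_1 = a_2 = w_6 and l v_0 = m w_6,
so the terms in which the parameter occurs vanish when m != l. *)
Lemma four_lines_rigid m (v a w : 'rV[k]_12) : m != l ->
  v *m (X *m X *m X) + a *m (X *m X) = 0 ->
  a *m F12 - w *m (Y *m Y) = 0 ->
  v *m (F12 *m Y *m Y) + m *: (w *m (Y *m Y *m Y)) = 0 ->
  v *m (F12 *m Y *m Y) + l *: (w *m (Y *m Y *m Y)) = 0.
Proof.
move=> ml; rewrite !mulmxA !mx12E => e1 e2 e3.
have q1 := congr1 (coor^~ 5%N) e1; have q2 := congr1 (coor^~ 9%N) e2.
have q3 := congr1 (coor^~ 10%N) e2; have q4 := congr1 (coor^~ 11%N) e3.
move: q1 q2 q3 q4 => /=; expand_co => q1 q2 q3 q4.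
have v0E : coor v 0 = coor w 6.
  have -> : coor v 0 = (coor v 0 - 0 + (coor a 1 - coor a 2)) - (coor a 1 - 0)
      + (coor a 2 - coor w 6) + coor w 6 by ring.
  by rewrite q1 q2 q3; ring.
have w6 : coor w 6 = 0.
  have /eqP : (l - m) * coor w 6 = 0 by rewrite -[RHS]q4 v0E; ring.
  by rewrite mulf_eq0 subr_eq0 eq_sym (negPf ml) => /eqP.
have v0 : coor v 0 = 0 by rewrite v0E.
apply: eq_vec12; do 12!(case=> [_|]; first by (expand_co; rewrite ?w6 ?v0; ring)); by [].
Qed.

Definition delta12 i : 'rV[k]_12 := vec12 (set_nth 0 (nseq 12 0) i 1).

Lemma coor_delta12 i j : (j < 12)%N -> coor (delta12 i) j = nth 0 (set_nth 0 (nseq 12 0) i 1) j.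
Proof. exact: coor_vec12. Qed.

Lemma delta12_neq0 : delta12 11 != 0.
Proof.
apply/eqP => /(congr1 (coor^~ 11%N)) /eqP.
by rewrite coor_delta12 // coor0 oner_eq0.
Qed.

(** The generators v, a2 and w satisfy the defining relations of the module, the
last one only at the parameter l. *)
Lemma four_lines_solution m :
  [/\ delta12 0 *m (X *m X *m X) + delta12 2 *m (X *m X) = 0,
      delta12 2 *m F12 - delta12 6 *m (Y *m Y) = 0 &
      delta12 0 *m (F12 *m Y *m Y) + m *: (delta12 6 *m (Y *m Y *m Y)) = (l - m) *: delta12 11].
Proof.
have dE i j : (i < 12)%N -> (j < 12)%N -> coor (delta12 i) j = if i == j then 1 else 0.
  move=> i12 j12; rewrite coor_delta12 // nth_set_nth /= eq_sym; case: eqP => // _.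
  by rewrite (nth_nseq 0 12) j12.
split; rewrite !mulmxA !mx12E; apply: eq_vec12;
  do 12!(case=> [_|]; first by (expand_co;
    repeat match goal with |- context [coor (delta12 ?i) ?j] => rewrite (dE i j isT isT) end;
    simpl; ring)); by [].
Qed.
End FourLines.

(** * Infinite type when an element of order p acts *)

Section InfiniteType.
Import GRing.Theory.
Local Open Scope ring_scope.
Variables (k : closedFieldType) (C : finEICat) (x y : C).
Hypotheses (xy_neq : x <> y) (xy_all : forall z : C, z = x \/ z = y).
Hypotheses (hom_yx : #|cat_hom y x| = 0%N).
Local Notation A := (cat_alg k C).
Local Notation B := (@mor_basis k C _ _).

Lemma Mor_inj a b : injective (@Mor C a b).
Proof. by move=> f g /eqP; rewrite /Mor eq_Tagged => /eqP. Qed.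

Lemma mor_function (T : Type) (t : T) (fx : cat_hom x x -> T) (fy : cat_hom y y -> T) (fxy : cat_hom x y -> T) :
  exists w : cat_mor C -> T, [/\ forall g, w (Mor g) = fx g, forall h, w (Mor h) = fy h
    & forall f, w (Mor f) = fxy f].
Proof.
pose P (m : cat_mor C) u := [/\ forall g, m = Mor g -> u = fx g, forall h, m = Mor h -> u = fy h
    & forall f, m = Mor f -> u = fxy f].
have exP m : exists u, P m u.
  case: (mor_cases xy_all hom_yx m) => -[g ->]; [exists (fx g)|exists (fy g)|exists (fxy g)];
  by split=> g'; try (by move/(congr1 tag) => -[]; do ?[move=> E; case: xy_neq]); move/Mor_inj ->.
pose w m := epsilon (inhabits t) (P m).
have wP m : P m (w m) by apply: epsilon_spec (exP m).
by exists w; split=> g; have [w1 w2 w3] := wP (Mor g); auto.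
Qed.

Variables (p : nat) (p_pr : prime p) (p_char : p \in [pchar k]) (p_ge4 : (4 <= p)%N).
Variables (f0 : cat_hom x y) (g0 : cat_aut x) (h0 : cat_aut y).
Hypothesis gh0 : cat_comp f0 g0 = cat_comp h0 f0.
Hypothesis h0p : cat_comp (h0 ^+ p)%g f0 = f0.
Hypothesis h0_neq : cat_comp h0 f0 <> f0.

Local Notation pt i := (cat_comp (h0 ^+ i)%g f0).

Let ptD i j : pt (i + j) = cat_comp (h0 ^+ i)%g (pt j).
Proof. by rewrite cat_compA -aut_mulE -expgD. Qed.

Let pt_mul i j : pt i = f0 -> pt (j * i) = f0.
Proof.
move=> fi; elim: j => [|j IH]; first by rewrite mul0n expg0 cat_comp1m.
by rewrite mulSn ptD IH.
Qed.

Let pt_dvd i : pt i = f0 -> (p %| i)%N.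
Proof.
move=> fi; apply: contraT => np; case: h0_neq.
have co : coprime i p by rewrite coprime_sym prime_coprime.
have i0 : (0 < i)%N by case: i np {fi co} => //; rewrite dvdn0.
case: (egcdnP p i0) => u v e _; rewrite (eqP co) in e.
have := pt_mul u fi; rewrite e addnC ptD pt_mul //.
Qed.

Let pt_modn i : pt i = pt (i %% p).
Proof. by rewrite {1}(divn_eq i p) addnC ptD pt_mul. Qed.

Let pt_inj i j : pt i = pt j -> (i = j %[mod p])%N.
Proof.
wlog le_ij : i j / (i <= j)%N.
  by move=> W ij; case: (leqP i j) => [/W->//|/ltnW/W e]; apply: esym; apply: e.
move=> ij; apply/eqP; rewrite eq_sym eqn_mod_dvd //; apply: pt_dvd.
have := congr1 (cat_comp ((h0 ^+ i)^-1)%g) ij.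
rewrite -{1}(subnKC le_ij) ptD !cat_compA aut_mulVE !cat_comp1m => <- //.
Qed.

Let pt_g0 i : cat_comp (pt i) g0 = pt i.+1.
Proof. by rewrite -cat_compA gh0 cat_compA -aut_mulE -expgSr. Qed.

Variable l : k.
Local Notation Ex := (Ex12 k).
Local Notation Ey := (Ey12 k).
Local Notation N := (N12 l).
Local Notation F := (F12 l).
Let U : 'M[k]_12 := N12 l + 1.

Let U_exp : U ^+ p = 1.
Proof.
have pc' : [pchar {poly k}].-nat p.
  by rewrite pnatE // pchar_poly.
have Xc : ('X + 1) ^+ p = 'X^p + 1 :> {poly k} by rewrite exprDn_pchar // expr1n.
have := congr1 (horner_mx (N12 l)) Xc.
rewrite rmorphXn !rmorphD /= rmorphXn /= !rmorph1 /= horner_mx_X => ->.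
(* X^4 = 0 gives (1 + X)^p = 1 as p > 3. *)
rewrite -(subnKC p_ge4) exprD.
have -> : N12 l ^+ 4 = 0.
  by rewrite -[RHS](N12_nilpotent l) !exprS expr0 mulr1 -[RHS]/(N * N * N * N) !mulrA.
by rewrite mul0r add0r.
Qed.

Let U_exp_mod i j : (i = j %[mod p])%N -> U ^+ i = U ^+ j.
Proof.
have Ump n : U ^+ n = U ^+ (n %% p).
  by rewrite {1}(divn_eq n p) exprD mulnC exprM U_exp expr1n mul1r.
by move=> ij; rewrite Ump ij -Ump.
Qed.

(** The action of Q on the module of four lines is defined on the cyclic group
generated by h0, which corresponds to the orbit of f0; the weight is the
extension by zero to the other points of the torsor C(x,y). *)
Definition orbit_weight (b : cat_hom x y) : 'M[k]_12 :=
  if [pick i : 'I_p | pt i == b] is Some i then U ^+ i else 0.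
Local Notation W := orbit_weight.

Let W_pt i : W (pt i) = U ^+ i.
Proof.
rewrite /W; case: pickP => [j /eqP/pt_inj/U_exp_mod //|no].
have p0 := prime_gt0 p_pr.
by have := no (Ordinal (ltn_pmod i p0)); rewrite /= -pt_modn eqxx.
Qed.

Let W_cases b : (exists i, b = pt i) \/ ((forall i, b <> pt i) /\ W b = 0).
Proof.
have [[i bi]|no] := classic (exists i, b = pt i); [by left; exists i|right].
split=> [i bi|]; first by apply: no; exists i.
by rewrite /W; case: pickP => // i /eqP bi; case: no; exists i.
Qed.

Let pt_pred i : pt i = cat_comp h0 (pt (i + p.-1)).
Proof.
have p0 := prime_gt0 p_pr.
by rewrite cat_compA -aut_mulE -expgS -addnS prednK // ptD h0p.
Qed.

Let W_left b : W (cat_comp h0 b) = W b *m U.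
Proof.
have [[i ->]|[nb ->]] := W_cases b.
  by rewrite cat_compA -aut_mulE -expgS !W_pt exprSr.
have [[i hb]|[_ ->]] := W_cases (cat_comp h0 b); last by rewrite mul0mx.
case: (nb (i + p.-1)%N); have := congr1 (cat_comp (h0^-1)%g) hb.
by rewrite pt_pred !cat_compA !aut_mulVE !cat_comp1m.
Qed.

Let W_right b : W (cat_comp b g0) = U *m W b.
Proof.
have [[i ->]|[nb ->]] := W_cases b; first by rewrite pt_g0 !W_pt exprS.
have [[i gb]|[_ ->]] := W_cases (cat_comp b g0); last by rewrite mulmx0.
case: (nb (i + p.-1)%N); have := congr1 (cat_comp^~ (g0^-1)%g) gb.
rewrite pt_pred cat_compA -aut_mulE -expgS -pt_g0 -!cat_compA aut_mulEV.
by rewrite !cat_compm1.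
Qed.

Let W_f0 : W f0 = 1. Proof. by rewrite -{1}[f0]cat_comp1m (W_pt 0). Qed.

Let W_comm b M : N *m M = M *m N -> W b *m M = M *m W b.
Proof.
move=> NM; rewrite /W; case: pickP => [i _|_]; last by rewrite mul0mx mulmx0.
apply: esym; apply: (@commrX _ M U); rewrite /GRing.comm mulrDr mulrDl mulr1 mul1r.
by congr (_ + _); rewrite -[LHS]/(M *m N) -NM.
Qed.

Let ExU : Ex *m U = U *m Ex.
Proof. by rewrite mulmxDr mulmxDl ExN12 mulmx1 mul1mx. Qed.
Let EyU : Ey *m U = U *m Ey.
Proof. by rewrite mulmxDr mulmxDl EyN12 mulmx1 mul1mx. Qed.
Let FU : F *m U = U *m F.
Proof. by rewrite mulmxDr mulmxDl NF12 mulmx1 mul1mx. Qed.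
Let WEx b : W b *m Ex = Ex *m W b. Proof. by apply: W_comm; rewrite ExN12. Qed.
Let WEy b : W b *m Ey = Ey *m W b. Proof. by apply: W_comm; rewrite EyN12. Qed.
Let WF b : W b *m F = F *m W b. Proof. by apply: W_comm; rewrite NF12. Qed.
Let FEx : F *m Ex = 0. Proof. by rewrite -(FEy12 l) -mulmxA Eyx12 mulmx0. Qed.
Let EyF : Ey *m F = 0. Proof. by rewrite -(ExF12 l) mulmxA Eyx12 mul0mx. Qed.
Let FF : F *m F = 0. Proof. by rewrite -{1}(FEy12 l) -mulmxA EyF mulmx0. Qed.
Let Exx : Ex *m Ex = Ex. Proof. exact: Exx12. Qed.
Let Eyy : Ey *m Ey = Ey. Proof. exact: Eyy12. Qed.
Let Exy : Ex *m Ey = 0. Proof. exact: Exy12. Qed.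
Let Eyx : Ey *m Ex = 0. Proof. exact: Eyx12. Qed.
Let ExF : Ex *m F = F. Proof. exact: ExF12. Qed.
Let FEy : F *m Ey = F. Proof. exact: FEy12. Qed.

Section Weights.
Variable w : cat_mor C -> 'M[k]_12.
Hypotheses (w_x : forall g : cat_hom x x, w (Mor g) = W (cat_comp f0 g) *m Ex)
  (w_y : forall h : cat_hom y y, w (Mor h) = W (cat_comp h f0) *m Ey)
  (w_xy : forall f : cat_hom x y, w (Mor f) = W f *m F).

(** The morphisms over the subgroup of Q generated by h0 act on the module of
four lines; all others are sent to 0.  The resulting map is compatible with left
and right multiplication by g0, h0 and f0 ([weight_gens_l], [weight_gens_r]),
which splits the module off the restriction of the coinduced one. *)
Definition weight (a : A) : 'M[k]_12 := \sum_m a m *: w m.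

Fact weight_linear : linear weight.
Proof.
move=> c a b; rewrite /weight scaler_sumr -big_split; apply: eq_bigr => m _ /=.
by rewrite !ffunE scalerDl scalerA.
Qed.
HB.instance Definition _ := GRing.isLinear.Build k A 'M[k]_12 *:%R weight weight_linear.

Let weight_mor a b (m : @cat_hom C a b) : weight (B m) = w (Mor m).
Proof.
rewrite /weight (bigD1 (Mor m)) //= big1 ?addr0; first by rewrite ffunE eqxx scale1r.
by move=> m' mm'; rewrite ffunE (negPf mm') scale0r.
Qed.

Let weight_ext_l (u : A) (M : 'M[k]_12) :
  (forall m, weight (u * cat_alg_basis k m) = weight (cat_alg_basis k m) *m M) ->
  forall a, weight (u * a) = weight a *m M.
Proof.
move=> um a; have /ex_linear[f fE] : linear (fun a : A => weight (u * a)).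
  by move=> c a1 a2; rewrite mulrDr -cat_alg_scaleAr linearP.
have /ex_linear[g gE] : linear (fun a : A => weight a *m M).
  by move=> c a1 a2; rewrite linearP mulmxDl scalemxAl.
by rewrite -fE -gE; apply: cat_alg_ind => m; rewrite fE gE um.
Qed.

Let weight_ext_r (u : A) (M : 'M[k]_12) :
  (forall m, weight (cat_alg_basis k m * u) = M *m weight (cat_alg_basis k m)) ->
  forall a, weight (a * u) = M *m weight a.
Proof.
move=> um a; have /ex_linear[f fE] : linear (fun a : A => weight (a * u)).
  by move=> c a1 a2; rewrite mulrDl -cat_alg_scaleAl linearP.
have /ex_linear[g gE] : linear (fun a : A => M *m weight a).
  by move=> c a1 a2; rewrite linearP mulmxDr scalemxAr.
by rewrite -fE -gE; apply: cat_alg_ind => m; rewrite fE gE um.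
Qed.

Let yx_neq : y <> x. Proof. by move=> yx; apply: xy_neq. Qed.

Let wl_x (g : cat_aut x) (V : 'M[k]_12) :
  (forall g', W (cat_comp f0 (cat_comp g g')) = W (cat_comp f0 g') *m V) -> Ex *m V = V *m Ex ->
  forall a, weight (B g * a) = weight a *m (V *m Ex).
Proof.
move=> gV ExV; apply: weight_ext_l => m; case: (mor_cases xy_all hom_yx m) => -[m' ->].
- rewrite -[cat_alg_basis _ _]/(B m') mor_basisM !weight_mor !w_x gV -ExV -!mulmxA.
  by rewrite (mulmxA Ex) Exx ExV.
- rewrite -[cat_alg_basis _ _]/(B m') mor_basisM0 // linear0 weight_mor w_y -ExV -!mulmxA.
  by rewrite (mulmxA Ey) Eyx mul0mx mulmx0.
rewrite -[cat_alg_basis _ _]/(B m') mor_basisM0 // linear0 weight_mor w_xy -ExV -!mulmxA.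
by rewrite (mulmxA F) FEx mul0mx mulmx0.
Qed.

Let wl_y (h : cat_aut y) (V : 'M[k]_12) :
  (forall b, W (cat_comp h b) = W b *m V) -> Ey *m V = V *m Ey -> F *m V = V *m F ->
  forall a, weight (B h * a) = weight a *m (V *m Ey).
Proof.
move=> hV EyV FV; apply: weight_ext_l => m; case: (mor_cases xy_all hom_yx m) => -[m' ->].
- rewrite -[cat_alg_basis _ _]/(B m') mor_basisM0 // linear0 weight_mor w_x -EyV -!mulmxA.
  by rewrite (mulmxA Ex) Exy mul0mx mulmx0.
- rewrite -[cat_alg_basis _ _]/(B m') mor_basisM !weight_mor !w_y -cat_compA hV -EyV -!mulmxA.
  by rewrite (mulmxA Ey) Eyy EyV.
rewrite -[cat_alg_basis _ _]/(B m') mor_basisM !weight_mor !w_xy hV -!mulmxA.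
by rewrite (mulmxA F) FV -mulmxA FEy.
Qed.

Let wl_xy a : weight (B f0 * a) = weight a *m F.
Proof.
apply: weight_ext_l => m; case: (mor_cases xy_all hom_yx m) => -[m' ->].
- by rewrite -[cat_alg_basis _ _]/(B m') mor_basisM !weight_mor w_x w_xy -mulmxA ExF.
- by rewrite -[cat_alg_basis _ _]/(B m') mor_basisM0 // linear0 weight_mor w_y -mulmxA EyF mulmx0.
by rewrite -[cat_alg_basis _ _]/(B m') mor_basisM0 // linear0 weight_mor w_xy -mulmxA FF mulmx0.
Qed.

Let wr_x (g : cat_aut x) (V : 'M[k]_12) :
  (forall b, W (cat_comp b g) = V *m W b) -> Ex *m V = V *m Ex ->
  forall a, weight (a * B g) = (V *m Ex) *m weight a.
Proof.
move=> gV ExV; apply: weight_ext_r => m; case: (mor_cases xy_all hom_yx m) => -[m' ->].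
- rewrite -[cat_alg_basis _ _]/(B m') mor_basisM !weight_mor !w_x cat_compA gV.
  by rewrite -!mulmxA (mulmxA Ex) -WEx -mulmxA Exx.
- rewrite -[cat_alg_basis _ _]/(B m') mor_basisM0 // linear0 weight_mor w_y.
  by rewrite -!mulmxA WEy (mulmxA Ex) Exy mul0mx mulmx0.
rewrite -[cat_alg_basis _ _]/(B m') mor_basisM !weight_mor !w_xy gV.
by rewrite -!mulmxA (mulmxA Ex) -WEx -mulmxA ExF.
Qed.

Let wr_y (h : cat_aut y) (V : 'M[k]_12) :
  (forall h', W (cat_comp (cat_comp h' h) f0) = V *m W (cat_comp h' f0)) -> Ey *m V = V *m Ey ->
  forall a, weight (a * B h) = (V *m Ey) *m weight a.
Proof.
move=> hV EyV; apply: weight_ext_r => m; case: (mor_cases xy_all hom_yx m) => -[m' ->].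
- rewrite -[cat_alg_basis _ _]/(B m') mor_basisM0 // linear0 weight_mor w_x.
  by rewrite -!mulmxA WEx (mulmxA Ey) Eyx mul0mx mulmx0.
- rewrite -[cat_alg_basis _ _]/(B m') mor_basisM !weight_mor !w_y hV.
  by rewrite -!mulmxA (mulmxA Ey) -WEy -mulmxA Eyy.
rewrite -[cat_alg_basis _ _]/(B m') mor_basisM0 // linear0 weight_mor w_xy.
by rewrite -!mulmxA WF (mulmxA Ey) EyF mul0mx mulmx0.
Qed.

Let wr_xy a : weight (a * B f0) = F *m weight a.
Proof.
apply: weight_ext_r => m; case: (mor_cases xy_all hom_yx m) => -[m' ->].
- by rewrite -[cat_alg_basis _ _]/(B m') mor_basisM0 // linear0 weight_mor w_x WEx mulmxA FEx mul0mx.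
- by rewrite -[cat_alg_basis _ _]/(B m') mor_basisM !weight_mor w_y w_xy mulmxA -WF -mulmxA FEy.
by rewrite -[cat_alg_basis _ _]/(B m') mor_basisM0 // linear0 weight_mor w_xy WF mulmxA FF mul0mx.
Qed.

Local Notation gens := (glue_gens k g0 h0 f0).
Definition line_gens := quintuple Ex Ey (N *m Ex) (N *m Ey) F.

Let UEx : U *m Ex - Ex = N *m Ex. Proof. by rewrite mulmxDl mul1mx addrK. Qed.
Let UEy : U *m Ey - Ey = N *m Ey. Proof. by rewrite mulmxDl mul1mx addrK. Qed.

Lemma weight_gens_l i a : weight (gens i * a) = weight a *m line_gens i.
Proof.
have wex a' : weight (B (cat_id x) * a') = weight a' *m Ex.
  rewrite -[Ex in RHS]mul1mx; apply: wl_x; rewrite ?mulmx1 ?mul1mx //.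
  by move=> g'; rewrite cat_comp1m mulmx1.
have wey a' : weight (B (cat_id y) * a') = weight a' *m Ey.
  rewrite -[Ey in RHS]mul1mx; apply: wl_y; rewrite ?mulmx1 ?mul1mx //.
  by move=> g'; rewrite cat_comp1m mulmx1.
case: i => [[|[|[|[|[|//]]]]] ?]; rewrite /glue_gens /line_gens /quintuple /=.
- exact: wex.
- exact: wey.
- rewrite mulrBl linearB /= wex (wl_x (V := U)) // => [|g'].
    by rewrite -mulmxBr UEx.
  by rewrite cat_compA gh0 -cat_compA W_left.
- by rewrite mulrBl linearB /= wey (wl_y (V := U)) // -mulmxBr UEy.
exact: wl_xy.
Qed.

Lemma weight_gens_r i a : weight (a * gens i) = line_gens i *m weight a.
Proof.
have wex a' : weight (a' * B (cat_id x)) = Ex *m weight a'.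
  rewrite -[Ex in RHS]mul1mx; apply: wr_x; rewrite ?mulmx1 ?mul1mx // => b.
  by rewrite cat_compm1 mul1mx.
have wey a' : weight (a' * B (cat_id y)) = Ey *m weight a'.
  rewrite -[Ey in RHS]mul1mx; apply: wr_y; rewrite ?mulmx1 ?mul1mx // => b.
  by rewrite cat_compm1 mul1mx.
case: i => [[|[|[|[|[|//]]]]] ?]; rewrite /glue_gens /line_gens /quintuple /=.
- exact: wex.
- exact: wey.
- by rewrite mulrBr linearB /= wex (wr_x (V := U)) // -mulmxBl UEx.
- rewrite mulrBr linearB /= wey (wr_y (V := U)) // ?(-mulmxBl, UEy) //.
  + by rewrite -mulmxBl UEy.
  by move=> h'; rewrite -cat_compA -gh0 cat_compA W_right.
exact: wr_xy.
Qed.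

Lemma weight1 : weight 1 = 1%:M.
Proof.
rewrite (cat_alg_1E k xy_neq xy_all) linearD /= !weight_mor w_x w_y cat_compm1 cat_comp1m W_f0.
by rewrite !mul1mx E12_sum.
Qed.

Local Notation X := (N *m Ex).
Local Notation Y := (N *m Ey).
Definition line_coind : lmodType A := coind gens line_gens.
Local Notation X_k := (scal_restr (@cat_scal k C) line_coind).
Local Notation ev F := (coind_ev 1 (F : line_coind)).

Lemma line_section : exists sec : 'rV[k]_12 -> line_coind,
  forall u a, coind_ev a (sec u) = u *m weight a.
Proof.
have exF u : exists F : line_coind, forall a, coind_ev a F = u *m weight a.
  apply: coind_ex => [c a b|i a]; first by rewrite linearP mulmxDr scalemxAr.
  by rewrite weight_gens_l mulmxA.
exists (fun u => epsilon (inhabits 0) (fun F : line_coind => forall a, coind_ev a F = u *m weight a)).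
move=> u; exact: (epsilon_spec (inhabits 0) _ (exF u)).
Qed.

Section Projection.
Variable sec : 'rV[k]_12 -> line_coind.
Hypothesis secE : forall u a, coind_ev a (sec u) = u *m weight a.

(** Evaluation at 1 followed by its section: the projection onto a copy of the
module of four lines. *)
Definition line_proj (F : line_coind) : line_coind := sec (ev F).

Let ev_sec u : ev (sec u) = u. Proof. by rewrite secE weight1 mulmx1. Qed.
Let ev0 : ev 0 = 0. Proof. exact: coind_ev0. Qed.
Let sec0 : sec 0 = 0.
Proof. by apply: coind_ev_inj => m; rewrite secE mul0mx coind_ev0. Qed.

Let line_proj_eq0 F : line_proj F = 0 <-> ev F = 0.
Proof.
split=> [pF|evF]; last by rewrite /line_proj evF sec0.
by rewrite -(ev_sec (ev F)) -/(line_proj F) pF ev0.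
Qed.

Fact line_proj_linear : exists pi : {linear X_k -> X_k}, forall F, pi F = line_proj F.
Proof.
apply: (@ex_linear k X_k X_k line_proj) => c F F'; apply: coind_ev_inj => m.
by rewrite secE coind_evD !coind_evZ coind_evD coind_evZ !secE mulmxDl scalemxAl.
Qed.

(** The elements c for which the projection commutes with c, together with the
matrix of c on the module of four lines. *)
Definition intertwined (c : A) (M : 'M[k]_12) : Prop := forall F : line_coind,
  ev (c *: F) = ev F *m M /\ line_proj (c *: F) = c *: line_proj F.

Let intertwined_gens i : intertwined (gens i) (line_gens i).
Proof.
move=> F; have e : ev (gens i *: F) = ev F *m line_gens i.
  by rewrite coind_ev_act mul1r -[gens i]mulr1 coind_ev_equiv.
split=> //; apply: coind_ev_inj => m.
by rewrite secE e coind_ev_act secE weight_gens_r mulmxA.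
Qed.

Let intertwinedM c c' M M' : intertwined c M -> intertwined c' M' -> intertwined (c * c') (M' *m M).
Proof.
move=> H H' F; have [e1 p1] := H' F; have [e2 p2] := H (c' *: F).
by rewrite -scalerA e2 e1 p2 p1 scalerA mulmxA.
Qed.

Let intertwined_scal c : intertwined (cat_scal C c) c%:M.
Proof.
move=> F; have [pi piE] := line_proj_linear; split.
  by rewrite -(scal_restr_scaleE (@cat_scal k C)) coind_evZ mul_mx_scalar.
by rewrite -!piE -!(scal_restr_scaleE (@cat_scal k C)) linearZ.
Qed.

Let intertwined0 : intertwined 0 0.
Proof. by move=> F; rewrite scale0r ev0 mulmx0 scale0r /line_proj ev0 sec0. Qed.

Let intertwinedN c M : intertwined c M -> intertwined (- c) (- M).
Proof.
move=> H; have := intertwinedM (intertwined_scal (-1)) H.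
by rewrite rmorphN rmorph1 mulN1r mul_mx_scalar scaleN1r.
Qed.

Let al := gens (@Ordinal 5 2 isT).
Let be := gens (@Ordinal 5 3 isT).
Let ph := gens (@Ordinal 5 4 isT).

(** With X = al, Y = be and F = ph, the kernel of the pencil at m consists of
the triples (v, a, w) with X^3 v + X^2 a = 0, F a = Y^2 w and
Y^2 F v + m Y^3 w = 0.  For m = l the generators v, a2 and w of the module of
four lines are such a triple. *)
Definition lines_mx0 : 'M[A]_3 := \matrix_(i, j)
  nth 0 (nth [::] [:: [:: al * al * al; al * al; 0]; [:: 0; ph; - (be * be)]; [:: be * be * ph; 0; 0]] i) j.
Definition lines_mx1 : 'M[A]_3 := \matrix_(i, j)
  nth 0 (nth [::] [:: [:: 0; 0; 0]; [:: 0; 0; 0]; [:: 0; 0; be * be * be]] i) j.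
Let act m (v : {ffun 'I_3 -> line_coind}) := pencil_act (@cat_scal k C) lines_mx0 lines_mx1 m v.

Let T m (i j : 'I_3) : 'M[k]_12 :=
  nth 0 (nth [::] [:: [:: X *m X *m X; X *m X; 0]; [:: 0; F; - (Y *m Y)];
    [:: F *m Y *m Y; 0; m *: (Y *m Y *m Y)]] i) j.

Let intertwined_entry m i j : intertwined (lines_mx0 i j + cat_scal C m * lines_mx1 i j) (T m i j).
Proof.
have ial : intertwined al X := intertwined_gens (@Ordinal 5 2 isT).
have ibe : intertwined be Y := intertwined_gens (@Ordinal 5 3 isT).
have iph : intertwined ph F := intertwined_gens (@Ordinal 5 4 isT).
rewrite !mxE /T; case: i => [[|[|[|//]]] ?]; case: j => [[|[|[|//]]] ?] /=; rewrite ?mulr0 ?addr0 ?add0r //.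
- by rewrite -[X *m X *m X]mulmxA; do 2?apply: intertwinedM.
- exact: intertwinedM.
- exact/intertwinedN/intertwinedM.
- by rewrite -[F *m Y *m Y]mulmxA; do 2?apply: intertwinedM.
rewrite -mul_mx_scalar -[Y *m Y *m Y]mulmxA; apply: intertwinedM; first exact: intertwined_scal.
by do 2?apply: intertwinedM.
Qed.

Let ev_act m v i : ev (act m v i) = \sum_j ev (v j) *m T m i j.
Proof.
rewrite ffunE (big_morph (fun F : line_coind => ev F) (coind_evD 1) ev0); apply: eq_bigr => j _.
by rewrite mxE; apply: (intertwined_entry m i j (v j)).1.
Qed.

Let proj_act m v i : line_proj (act m v i) = act m (ffun_map line_proj v) i.
Proof.
rewrite !ffunE; have [pi piE] := line_proj_linear; rewrite -piE linear_sum.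
apply: eq_bigr => j _; rewrite piE ffunE mxE.
exact: (intertwined_entry m i j (v j)).2.
Qed.

Lemma line_coind_drops : drops (@cat_scal k C) lines_mx0 lines_mx1 line_coind l.
Proof.
have [pi piE] := line_proj_linear.
apply: (@drops_of_projection k A (@cat_scal k C) (@cat_scal_central k C) _ _ _ _ _ pi).
- exact: coind_fin_dim.
- by move=> F; rewrite !piE /line_proj ev_sec.
- move=> m v; apply/ffunP => i; rewrite [RHS]ffunE piE proj_act.
  by congr (act m _ i); apply/ffunP => j; rewrite !ffunE piE.
- move=> m v ml pv.
  have evm i : \sum_j ev (v j) *m T m i j = 0 by rewrite -ev_act; apply/line_proj_eq0; rewrite -piE; apply: pv.
  move=> i; rewrite piE; apply/line_proj_eq0; rewrite -/(act l v) ev_act.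
  have e0 := evm (@Ordinal 3 0 isT); have e1 := evm (@Ordinal 3 1 isT); have e2 := evm (@Ordinal 3 2 isT).
  rewrite !big_ord_recl big_ord0 /T /= ?mulmx0 ?add0r ?addr0 ?mulmxN -?scalemxAr in e0 e1 e2.
  have rigid := four_lines_rigid ml e0 e1 e2.
  case: i => [[|[|[|//]]] ?]; rewrite !big_ord_recl big_ord0 /T /= ?mulmx0 ?add0r ?addr0 ?mulmxN -?scalemxAr //.
pose v : {ffun 'I_3 -> line_coind} := [ffun j : 'I_3 => sec (nth 0 [:: delta12 k 0; delta12 k 2; delta12 k 6] j)].
have evv m i : ev (act m v i) = \sum_j nth 0 [:: delta12 k 0; delta12 k 2; delta12 k 6] (nat_of_ord j) *m T m i j.
  by rewrite ev_act; apply: eq_bigr => j _; rewrite ffunE ev_sec.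
have sol m := four_lines_solution l m.
exists v => [i|m ml].
  rewrite piE; apply/line_proj_eq0; rewrite -/(act l v) evv; have [s0 s1 s2] := sol l.
  case: i => [[|[|[|//]]] ?]; rewrite !big_ord_recl big_ord0 /T /=;
  by rewrite ?mulmx0 ?add0r ?addr0 ?mulmxN -?scalemxAr ?s2 ?subrr ?scale0r.
exists (@Ordinal 3 2 isT); rewrite piE => /line_proj_eq0; rewrite -/(act m v) evv.
have [_ _ s2] := sol m.
rewrite !big_ord_recl big_ord0 /T /= ?mulmx0 ?add0r ?addr0 -?scalemxAr s2 => /eqP.
by rewrite scaler_eq0 subr_eq0 eq_sym (negPf ml) (negPf (delta12_neq0 k)).
Qed.

End Projection.
End Weights.
End InfiniteType.

(** * From Sylow subgroups to elements of order p *)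

Section Assembly.
Import GRing.Theory.
Local Open Scope ring_scope.

Lemma infinite_rep_type_of_order_p (k : closedFieldType) (C : finEICat) (x y : C)
    (xy_neq : x <> y) (xy_all : forall z : C, z = x \/ z = y) (hom_yx : #|cat_hom y x| = 0%N)
    (p : nat) (p_pr : prime p) (p_char : p \in [pchar k]) (p_ge4 : (4 <= p)%N)
    (f0 : cat_hom x y) (g0 : cat_aut x) (h0 : cat_aut y) :
  cat_comp f0 g0 = cat_comp h0 f0 -> cat_comp (h0 ^+ p)%g f0 = f0 -> cat_comp h0 f0 <> f0 ->
  ~ finite_rep_type (cat_alg k C).
Proof.
move=> gh h0p h0_neq.
apply: (infinite_rep_type_of_drops (@cat_scal_central k C)
  (P := lines_mx0 k f0 g0 h0) (Q := lines_mx1 k f0 g0 h0)) => l.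
have [w [w_x w_y w_xy]] := mor_function xy_neq xy_all hom_yx 0
  (fun g => orbit_weight p f0 h0 l (cat_comp f0 g) *m Ex12 k)
  (fun h => orbit_weight p f0 h0 l (cat_comp h f0) *m Ey12 k)
  (fun f => orbit_weight p f0 h0 l f *m F12 l).
have [sec secE] := line_section xy_neq xy_all hom_yx p_pr p_char p_ge4 gh h0p h0_neq w_x w_y w_xy.
exists (line_coind f0 g0 h0 l); first exact: coind_fin_dim.
exact: (line_coind_drops xy_neq xy_all hom_yx p_pr p_char p_ge4 gh h0p h0_neq w_x w_y w_xy secE).
Qed.

Lemma pC_residual_ind (gT : finGroupType) p (G : {group gT}) (K : gT -> Prop) :
  K 1%g -> (forall s t, K s -> K t -> K (s * t)%g) ->
  (forall (P : {group gT}) s, P \in 'Syl_p(G)%g -> s \in P -> K s) ->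
  forall g, g \in pC_residual p G -> K g.
Proof.
move=> K1 KM KS g /gen_prodgP[n [c cP ->]].
elim/big_ind: _ => // i _; have /bigcupP[P sP cP'] := cP i.
exact: KS sP cP'.
Qed.

Lemma Sylow_sub_pC_residual (gT : finGroupType) p (G P : {group gT}) :
  P \in 'Syl_p(G)%g -> P \subset pC_residual p G.
Proof. by move=> sP; apply: sub_gen; apply: (bigcup_sup P). Qed.

(** The last of the powers s^(p^j) that does not satisfy the condition. *)
Lemma ex_order_p_step (gT : finGroupType) (p : nat) (s : gT) (fixes : gT -> Prop) :
  (p.-elt s)%g -> fixes 1%g -> ~ fixes s -> exists t, ~ fixes t /\ fixes (t ^+ p)%g.
Proof.
move=> ps fix1 nfix.
have [|j [fj min_j]] := @ex_least (fun j => fixes (s ^+ (p ^ j))%g) (logn p #[s]%g).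
  by rewrite -p_part part_pnat_id // expg_order.
case: j fj min_j => [|j] fj min_j; first by rewrite expn0 expg1 in fj.
exists (s ^+ (p ^ j))%g; split; last by rewrite -expgM -expnSr.
by move=> /min_j; rewrite ltnn.
Qed.

(** For p = 0 the Sylow subgroup is trivial and its index, the order of the
group, is nonzero in k like every positive integer. *)
Lemma Sylow_pchar (k : fieldType) p (gT : finGroupType) (P : {group gT}) :
  has_char k p -> P \in 'Syl_p([set: gT])%g ->
  [pchar k].-nat #|P| /\ #|[set: gT] : P|%g%:R != 0 :> k.
Proof.
case: p => [|p] /= ck.
  rewrite Syl0 inE => /eqP ->; split; first by rewrite cards1.
  by move: ck => /pcharf0P->; rewrite -lt0n indexg_gt0.
rewrite inE => /and3P[_ pP p'P]; split.
  by move: pP; rewrite /pgroup; apply: sub_in_pnat => q _ /eqP->.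
rewrite -(dvdn_pcharf ck).
have p_pr := pcharf_prime ck.
by rewrite -p'natE.
Qed.

End Assembly.

Theorem theorem1p2 (k : closedFieldType) (p : nat) (C : finEICat) (x y : C)
  (char_k : has_char k p)
  (C_skeletal : cat_skeletal C)
  (C_connected : cat_connected C)
  (xy_neq : x <> y)
  (xy_all : forall z : C, z = x \/ z = y)
  (hom_xy : (0 < #|cat_hom x y|)%N)
  (hom_yx : #|cat_hom y x| = 0%N)
  (SylG : cyclic_Sylows p [set: cat_aut x])
  (SylH : cyclic_Sylows p [set: cat_aut y])
  (G_trans : forall f f' : cat_hom x y, exists g : cat_aut x, cat_comp f g = f')
  (H_trans : forall f f' : cat_hom x y, exists h : cat_aut y, cat_comp h f = f')
  (p_neq2 : p <> 2) (p_neq3 : p <> 3) :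
  finite_rep_type (cat_alg k C) <->
    ((forall g : cat_aut x, g \in pC_residual p [set: cat_aut x] ->
        forall f : cat_hom x y, cat_comp f g = f) /\
     (forall h : cat_aut y, h \in pC_residual p [set: cat_aut y] ->
        forall f : cat_hom x y, cat_comp h f = f)).
Proof.
split=> [finC|[fixG fixH]]; last first.
  have [P sylP] := Sylow_exists p [set: cat_aut x]%G.
  have [R sylR] := Sylow_exists p [set: cat_aut y]%G.
  have {}sylP : P \in 'Syl_p([set: cat_aut x])%g by rewrite inE.
  have {}sylR : R \in 'Syl_p([set: cat_aut y])%g by rewrite inE.
  have /cyclicP[sg Psg] := SylG P sylP; have /cyclicP[tu Rtu] := SylH R sylR.
  have [P_nat P_idx] := Sylow_pchar char_k sylP.
  have [R_nat R_idx] := Sylow_pchar char_k sylR.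
  rewrite Psg in P_nat P_idx; rewrite Rtu in R_nat R_idx.
  have [z _] := card_gt0P hom_xy.
  apply: (@finite_rep_type_of_trivial_action k C x y xy_neq xy_all hom_yx G_trans H_trans sg tu z) => //.
    by apply: fixG; apply: (subsetP (Sylow_sub_pC_residual sylP)); rewrite Psg cycle_id.
  by apply: fixH; apply: (subsetP (Sylow_sub_pC_residual sylR)); rewrite Rtu cycle_id.
have Kx := @pC_residual_ind _ p [set: cat_aut x]%G (fun g => forall f : cat_hom x y, cat_comp f g = f).
have Ky := @pC_residual_ind _ p [set: cat_aut y]%G (fun h => forall f : cat_hom x y, cat_comp h f = f).
suff [fixx fixy] : (forall (P : {group cat_aut x}) s, P \in 'Syl_p([set: cat_aut x])%g -> s \in P ->
      forall f : cat_hom x y, cat_comp f s = f) /\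
    (forall (P : {group cat_aut y}) s, P \in 'Syl_p([set: cat_aut y])%g -> s \in P ->
      forall f : cat_hom x y, cat_comp s f = f).
  split; [apply: Kx => // [f|s t fs ft f] | apply: Ky => // [f|s t fs ft f]].
  - exact: cat_compm1.
  - by rewrite aut_mulE cat_compA fs ft.
  - exact: cat_comp1m.
  - by rewrite aut_mulE -cat_compA ft fs.
case: p char_k p_neq2 p_neq3 {SylG SylH Kx Ky} => [|p'] ck n2 n3.
  by split=> P s; rewrite Syl0 inE => /eqP-> /set1P-> f; rewrite ?cat_compm1 ?cat_comp1m.
have p_pr := GRing.Theory.pcharf_prime ck; set p := p'.+1 in ck n2 n3 p_pr *.
have p_ge4 : (4 <= p)%N by case: (p) p_pr n2 n3 => [|[|[|[|q]]]].
have no_order_p (f0 : cat_hom x y) (g0 : cat_aut x) (h0 : cat_aut y) :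
    cat_comp f0 g0 = cat_comp h0 f0 -> cat_comp (h0 ^+ p)%g f0 = f0 -> cat_comp h0 f0 = f0.
  move=> gh hp; apply: NNPP => nfix.
  exact: (infinite_rep_type_of_order_p xy_neq xy_all hom_yx p_pr ck p_ge4 gh hp nfix) finC.
split=> P s; rewrite inE => /and3P[_ pP _] sP f; apply: NNPP => fs.
  have [|t [ft ftp]] := ex_order_p_step (fixes := fun t : cat_aut x => cat_comp f t = f) (mem_p_elt pP sP) _ fs.
    exact: cat_compm1.
  have [h hf] := H_trans f (cat_comp f t).
  apply: ft; rewrite -hf; apply: no_order_p (esym hf) _.
  rewrite -[RHS]ftp; elim: (p) => [|i IH]; first by rewrite !expg0 cat_compm1 cat_comp1m.
  by rewrite expgSr aut_mulE -cat_compA hf cat_compA IH -cat_compA -aut_mulE -expgSr.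
have [|t [ft ftp]] := ex_order_p_step (fixes := fun t : cat_aut y => cat_comp t f = f) (mem_p_elt pP sP) _ fs.
  exact: cat_comp1m.
have [g gf] := G_trans f (cat_comp t f).
exact: ft (no_order_p f g t gf ftp).
Qed.
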